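(* Consider the linear regression model $y_i = x_i^T\beta + z_i$, $i=1,\dots,n$, with $z_1,\dots,z_n \overset{i.i.d.}{\sim} \mathcal{N}(0,\sigma^2)$, random Gaussian design $x_1,\dots,x_n \overset{i.i.d.}{\sim} \mathcal{N}(0,I_p)$ independent of $z=(z_1,\dots,z_n)$, and parameter space $\Theta_k=\{\beta\in\mathbb{R}^p:\|\beta\|_0\le k\}$. Let $R_R(\Theta_k,\sigma)=\inf_{\hat\beta}\sup_{\beta\in\Theta_k}\mathbb{E}_\beta\|\hat\beta-\beta\|_2^2$ be the minimax risk. As $k/p\to 0$ and $(k\log(p/k))/n\to 0$, $$R_R(\Theta_k,\sigma)=\frac{(2+o(1))\,\sigma^2 k\log(p/k)}{n}.$$
   Context: Here $\sigma>0$, $n,p,k\ge 1$ are integers with $k\le p$, and the asymptotics are along sequences $(n,p,k)$ (so $k$ and $p$ may vary with $n$) satisfying the stated limits. $\|\beta\|_0$ is the number of nonzero components of $\beta$ and $\|\cdot\|_2$ is the Euclidean norm. The infimum in $R_R$ is over all estimators $\hat\beta$ (measurable functions of the data $(y,X)$, where $y=(y_1,\dots,y_n)$ and $X\in\mathbb{R}^{n\times p}$ has rows $x_i^T$), and the expectation $\mathbb{E}_\beta$ is over both $X$ and $z$ when the true coefficient vector is $\beta$. $o(1)$ denotes a quantity tending to $0$. *)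

(* Defs.v *)
From HB Require Import structures.
From mathcomp Require Export all_boot all_order all_algebra.
From mathcomp Require Export all_classical all_reals all_analysis.
Export Order.TTheory GRing.Theory Num.Theory numFieldNormedType.Exports.

Set Implicit Arguments.
Unset Strict Implicit.
Unset Printing Implicit Defensive.

Local Open Scope classical_set_scope.
Local Open Scope ring_scope.

Section tuple_cons.
Context d (T : measurableType d) (n : nat).

Definition tuple_cons (u : T * n.-tuple T) : n.+1.-tuple T :=
  [the n.+1.-tuple T of u.1 :: u.2].

Let measurable_tuple_cons : measurable_fun [set: T * n.-tuple T] tuple_cons.
Proof.
by apply: measurable_cons; [exact: measurable_fst|exact: measurable_snd].
Qed.

HB.instance Definition _ :=
  @isMeasurableFun.Build _ _ _ _ tuple_cons measurable_tuple_cons.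

End tuple_cons.

Section iid_prob.
Context d (T : measurableType d) (R : realType).

(* The n-fold product P x ... x P, i.e. the joint law of n i.i.d. variables
   with law P; iid_prob_box characterizes it on boxes. *)
Fixpoint iid_prob (P : probability T R) (n : nat) :
    probability (n.-tuple T) R :=
  match n with
  | 0 => dirac [tuple]
  | m.+1 => distribution (P \x iid_prob P m)%E (@tuple_cons _ T m)
  end.

Lemma iid_prob_box (P : probability T R) (n : nat) (A : 'I_n -> set T) :
  (forall i, measurable (A i)) ->
  iid_prob P n [set t | forall i, A i (tnth t i)] = (\prod_(i < n) P (A i))%E.
Proof.
elim: n A => [|n IHn] A mA.
  rewrite big_ord0 /= diracE mem_set//=.
  by move=> -[].
rewrite big_ord_recl /= /distribution /pushforward /=.
have -> : @tuple_cons _ T n @^-1` [set t | forall i, A i (tnth t i)] =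
    A ord0 `*` [set t | forall i, A (lift ord0 i) (tnth t i)].
  apply/seteqP; split => -[x t] /=.
    move=> h; split; first exact: (h ord0).
    by move=> i; have := h (lift ord0 i); rewrite /tuple_cons/= tnthS.
  move=> [hx ht] i; case: (unliftP ord0 i) => [j ->|->]//.
  by rewrite /tuple_cons/= tnthS.
rewrite product_measure1E//; last first.
  rewrite [X in measurable X](_ : _ =
    \bigcap_(i in [set: 'I_n]) ((@tnth _ T ^~ i) @^-1` A (lift ord0 i))).
    apply: fin_bigcap_measurable => [|i _]; first exact: finite_finset.
    rewrite -[X in measurable X]setTI.
    exact: measurable_tnth.
  by apply/seteqP; split => [t /= h i _|t /= h i]; exact: h.
by congr (_ * _)%E; exact: IHn.
Qed.

End iid_prob.

Section sparse_regression.
Context (R : realType) (n p : nat).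

(* measurableTypeR R is R with its Borel sigma-algebra, on which normal_prob
   is a probability; tuples of it carry the product sigma-algebra. *)
Local Notation coefs := (p.-tuple (measurableTypeR R)).
Local Notation design := (n.-tuple coefs).
Local Notation sample := (n.-tuple (measurableTypeR R)).

(* Law of (X, z): the rows of X are i.i.d. N(0, I_p), whose coordinates are
   i.i.d. N(0, 1), and z is independent of X.  The second parameter of
   normal_prob is the standard deviation, not the variance. *)
Definition design_noise_prob (sigma : R) :
    probability (design * sample)%type R :=
  (iid_prob (iid_prob (normal_prob 0 1) p) n \x
   iid_prob (normal_prob 0 sigma) n)%E.

Definition response (beta : coefs) (X : design) (z : sample) : sample :=
  [tuple \sum_(j < p) tnth (tnth X i) j * tnth beta j + tnth z i | i < n].

Definition l0norm (beta : coefs) : nat := #|[pred j | tnth beta j != 0]|.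

Definition l2norm (v : coefs) : R :=
  Num.sqrt (\sum_(j < p) tnth v j ^+ 2).

Definition tuple_sub (u v : coefs) : coefs :=
  [tuple tnth u j - tnth v j | j < p].

Definition sparse_vectors (k : nat) : set coefs :=
  [set beta | (l0norm beta <= k)%N].

Definition estimator : set (sample * design -> coefs) :=
  [set bhat | measurable_fun setT bhat].

(* The expectation is over w = (X, z) and may be +oo; the estimator sees the
   data (y, X). *)
Definition risk (sigma : R) (bhat : sample * design -> coefs)
    (beta : coefs) : \bar R :=
  'E_(design_noise_prob sigma)[fun w =>
    l2norm (tuple_sub (bhat (response beta w.1 w.2, w.1)) beta) ^+ 2].

Definition minimax_risk (sigma : R) (k : nat) : \bar R :=
  ereal_inf [set ereal_sup [set risk sigma bhat beta
                           | beta in sparse_vectors k]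
            | bhat in estimator].

End sparse_regression.

(* Main.v *)
Require Import Defs.
From mathcomp Require Import measurable_realfun measurable_fun_approximation ring lra zify.

(** Lower bound.  Put one spike of height mu, with mu^2 close to
    2 sigma^2 log(p/k) / n, at a uniformly random place in each of k disjoint
    blocks of about p/k coordinates.  A change of measure removes the spike of
    one block: outside an event of small probability the likelihood ratio is at
    most (p/k)^(1 - c) with c > 0, and without the spike no estimator can favour more
    than one of the p/k positions, so the spike is found with vanishing
    probability and nearly all of its energy mu^2 is lost.

    Upper bound.  A vanishing fraction of the sample yields a pilot estimate:
    an approximate minimizer of the residual sum of squares over the k-sparse
    points of a lattice eta Z^p.  By a Chernoff bound for each lattice point,
    summed over the whole lattice, its squared error is below delta sigma^2
    except for an exponentially small contribution to the risk, uniformly in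
    beta.  Given the pilot b, the vector b + X^T (y - X b) / n formed from the
    remaining sample is beta plus noise with nearly Gaussian tails of variance
    at most (1 + O(delta)) sigma^2 / n per coordinate.  Soft thresholding it at
    t^2 = (2 + O(delta)) sigma^2 log(p/k) / n costs about t^2 on each of the at
    most k nonzero coordinates and o(t^2 k / p) on each of the others. *)

Set Implicit Arguments.
Unset Strict Implicit.
Unset Printing Implicit Defensive.

Local Open Scope classical_set_scope.
Local Open Scope ring_scope.

(** * Integration against product laws *)

(** The nonzero entries of [beta] may be arbitrarily large. Thresholding X^T y / n itself would meet
    noise of variance of order (sigma^2 + |beta|^2) / n, hence the pilot, which first brings the
    error below a small multiple of sigma^2. The two subsamples are independent, so the pilot can be
    frozen in the second stage. Unboundedness also forces infinitely many candidates: the Chernoff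
    bound for one at squared distance x sigma^2 decays as a power of 1 + kap x with exponent
    proportional to the number of rows, and once the exponent reaches 2k + 1 the sum over all
    k-sparse lattice points, weighted by squared error, converges. Countability of the lattice also
    makes the selection of a near minimizer measurable. Only the constant 2 has to be sharp: it
    comes from spike height against likelihood threshold in the lower bound, and from the
    exponential moments at null coordinates in the upper bound. The other constants are crude: they
    are divided by log(p/k), multiply the contribution of a failing pilot, or only decide how small
    k log(p/k) / n must be. *)

Section integral_monotone.
Local Open Scope ereal_scope.
Context d (T : measurableType d) (R : realType).
Variable mu : {measure set T -> \bar R}.

(** The integral is a supremum over the simple functions below the integrand, so this covers
    arbitrary nonnegative functions, and bounds on inner integrals raise no measurability goals. *)
Lemma ge0_le_integralT (f g : T -> \bar R) :
  (forall x, 0 <= f x) -> (forall x, f x <= g x) ->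
  \int[mu]_x f x <= \int[mu]_x g x.
Proof.
move=> f0 fg; have g0 x : 0 <= g x by exact: le_trans (f0 x) (fg x).
rewrite !ge0_integralTE//; apply: le_ereal_sup => _ [h hf <-].
by exists h => // x; apply: le_trans (hf x) (fg x).
Qed.

Lemma ge0_integralZlT (k : R) (f : T -> R) : (0 <= k)%R ->
  measurable_fun setT f -> (forall x, (0 <= f x)%R) ->
  \int[mu]_x (k * f x)%:E = k%:E * \int[mu]_x (f x)%:E.
Proof.
move=> k0 mf f0; under eq_integral do rewrite EFinM.
rewrite ge0_integralZl// ?lee_fin//; [exact/measurable_EFinP|by move=> x _; rewrite lee_fin].
Qed.

Lemma ge0_integralDT (f g : T -> R) :
  measurable_fun setT f -> (forall x, (0 <= f x)%R) ->
  measurable_fun setT g -> (forall x, (0 <= g x)%R) ->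
  \int[mu]_x (f x + g x)%:E = \int[mu]_x (f x)%:E + \int[mu]_x (g x)%:E.
Proof.
move=> mf f0 mg g0; under eq_integral do rewrite EFinD.
by rewrite ge0_integralD//; (try exact/measurable_EFinP) => x _; rewrite lee_fin.
Qed.

Lemma ge0_integral_sumT (I : Type) (s : seq I) (P : pred I) (f : I -> T -> R) :
  (forall i, measurable_fun setT (f i)) -> (forall i x, (0 <= f i x)%R) ->
  \int[mu]_x (\sum_(i <- s | P i) f i x)%:E =
  \sum_(i <- s | P i) \int[mu]_x (f i x)%:E.
Proof.
move=> mf f0; under eq_integral do rewrite -sumEFin -big_filter.
rewrite -[RHS]big_filter ge0_integral_sum//.
  by move=> i; exact/measurable_EFinP.
by move=> i x _; rewrite lee_fin.
Qed.

End integral_monotone.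

Lemma integral_prob_cst d (T : measurableType d) (R : realType)
    (P : probability T R) (c : \bar R) : (\int[P]__ c = c)%E.
Proof. by rewrite integral_cst// [X in (_ * X)%E]probability_setT mule1. Qed.

Lemma ge0_integral_le_cst d (T : measurableType d) (R : realType)
    (P : probability T R) (f : T -> \bar R) (c : \bar R) :
  (forall x, 0 <= f x)%E -> (forall x, f x <= c)%E ->
  (\int[P]_x f x <= c)%E.
Proof.
move=> f0 fc; apply: le_trans (ge0_le_integralT P f0 fc) _.
by rewrite integral_prob_cst.
Qed.

(** * Gaussian integrals on the line *)

Section gaussian.
Context (R : realType).
Local Notation mu := (@lebesgue_measure R).
Local Notation T := (measurableTypeR R).

(** The Radon-Nikodym derivative and the density have the same integral over every measurable set,
    hence agree almost everywhere. *)
Lemma integral_normal_prob (m s : R) (f : T -> \bar R) :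
  measurable_fun setT f -> (forall x, (0 <= f x)%E) ->
  (\int[normal_prob m s]_x f x = \int[mu]_x (f x * (normal_pdf m s x)%:E))%E.
Proof.
move=> mf f0.
rewrite -(Radon_Nikodym_SigmaFinite.change_of_variables
  (normal_prob_dominates m s))//.
have mRN : measurable_fun setT
   (Radon_Nikodym_SigmaFinite.f (normal_prob m s) mu).
  apply: measurable_int (Radon_Nikodym_SigmaFinite.f_integrable _).
  exact: normal_prob_dominates.
apply: ae_eq_integral => //.
- exact: emeasurable_funM.
- apply: emeasurable_funM => //.
  by apply/measurable_EFinP; exact: measurable_normal_pdf.
- apply: ae_eqe_mul2l; apply: integral_ae_eq => //.
  + apply: Radon_Nikodym_SigmaFinite.f_integrable.
    exact: normal_prob_dominates.
  + by apply/measurable_EFinP; exact: measurable_normal_pdf.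
  + move=> E _ mE; rewrite -Radon_Nikodym_SigmaFinite.f_integral//.
    exact: normal_prob_dominates.
Qed.

Lemma integral_lebesgue_shift (a : R) (f : T -> \bar R) :
  measurable_fun setT f -> (forall x, (0 <= f x)%E) ->
  (\int[mu]_x f (x + a)%R = \int[mu]_x f x)%E.
Proof.
move=> mf f0.
have mshift : measurable_fun [set: T] (fun x : T => x + a : T).
  by apply: measurable_funD => //; exact: measurable_cst.
transitivity (\int[pushforward mu (fun x : T => (x + a)%R : T)]_x f x)%E.
  by rewrite ge0_integral_pushforward.
apply: eq_measure_integral => A mA _.
apply/esym/lebesgue_measure_unique => //.
move=> _ [[b c]] _ <-; rewrite /pushforward.
rewrite [RHS]/= /pushforward.
rewrite (_ : _ @^-1` _ = `]b - a, c - a]%classic); last first.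
  by apply/seteqP; split => x /=; rewrite !in_itv/= ltrBlDr lerBrDr.
rewrite !lebesgue_measure_itv/= !lte_fin ltrD2r.
by case: ifP => // _; congr EFin; lra.
Qed.

(** The Cameron-Martin formula: translate Lebesgue measure and divide the two densities. *)
Lemma integral_normal_shift (a s : R) (f : T -> R) : s != 0 ->
  measurable_fun setT f -> (forall x, 0 <= f x) ->
  (\int[normal_prob 0 s]_z (f (z + a)%R)%:E =
   \int[normal_prob 0 s]_z
     (f z * expR ((a * z - a ^+ 2 / 2) / s ^+ 2))%:E)%E.
Proof.
move=> s0 mf f0.
have mshift : measurable_fun [set: T] (fun x : T => x + a : T).
  by apply: measurable_funD => //; exact: measurable_cst.
have mpdf : measurable_fun setT (normal_pdf 0 s : T -> R).
  exact: measurable_normal_pdf.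
rewrite integral_normal_prob//; last 2 first.
- by apply/measurable_EFinP; exact: (measurableT_comp mf).
- by move=> x; rewrite lee_fin.
pose g x := (f x * normal_pdf 0 s (x - a))%:E.
rewrite (eq_integral (fun x : T => g (x + a)%R)); last first.
  by move=> x _; rewrite /g addrK EFinM.
rewrite integral_lebesgue_shift; last 2 first.
- apply/measurable_EFinP; apply: measurable_funM => //.
  apply: (measurableT_comp mpdf).
  by apply: measurable_funB => //; exact: measurable_cst.
- by move=> x; rewrite lee_fin mulr_ge0// normal_pdf_ge0.
rewrite integral_normal_prob; last 2 first.
- apply/measurable_EFinP; apply: measurable_funM => //.
  apply: measurableT_comp => //; apply: measurable_funM => //.
  by apply: measurable_funB => //; apply: measurable_funM.
- by move=> x; rewrite lee_fin mulr_ge0// expR_ge0.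
apply: eq_integral => x _; rewrite /g -EFinM; congr EFin.
rewrite !normal_pdfE// -mulrA; congr *%R.
rewrite mulrCA; congr *%R.
rewrite /normal_fun -expRD; congr expR.
by field.
Qed.

(** Completing the square turns the integrand into a constant times the density of a normal law with
    mean b s^2 / t and standard deviation s / sqrt t, where t = 1 - 2 a s^2. *)
Lemma integral_normal_exp (s a b : R) : s != 0 -> 2 * a * s ^+ 2 < 1 ->
  (\int[normal_prob 0 s]_x (expR (a * x ^+ 2 + b * x))%:E =
   ((Num.sqrt (1 - 2 * a * s ^+ 2))^-1 *
    expR (b ^+ 2 * s ^+ 2 / (2 * (1 - 2 * a * s ^+ 2))))%:E)%E.
Proof.
move=> s0 a2; set t := 1 - 2 * a * s ^+ 2.
have t0 : 0 < t by rewrite /t subr_gt0.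
have st0 : 0 < Num.sqrt t by rewrite sqrtr_gt0.
have mE : measurable_fun setT (fun x : T => expR (a * x ^+ 2 + b * x)).
  apply: measurableT_comp => //; apply: measurable_funD.
    by apply: measurable_funM => //; apply: measurable_funX.
  exact: measurable_funM.
rewrite integral_normal_prob; last 2 first.
- exact/measurable_EFinP.
- by move=> x; rewrite lee_fin expR_ge0.
pose u := (Num.sqrt t)^-1; pose m := b * s ^+ 2 / t.
have u0 : u != 0 by rewrite /u invr_eq0 gt_eqF.
have us0 : u * s != 0 by rewrite mulf_neq0.
have sqt : Num.sqrt t ^+ 2 = t by rewrite sqr_sqrtr// ltW.
rewrite (eq_integral (fun x : T => (u * expR (b ^+ 2 * s ^+ 2 / (2 * t)) *
    normal_pdf m (u * s) x)%:E)).
  rewrite ge0_integralZlT//; last 3 first.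
  - by rewrite mulr_ge0// ?expR_ge0// /u invr_ge0 ltW.
  - exact: measurable_normal_pdf.
  - by move=> x; exact: normal_pdf_ge0.
  by rewrite integral_normal_pdf mule1.
move=> x _; rewrite -EFinM; congr EFin.
rewrite !normal_pdfE// /normal_peak /normal_fun.
have -> : Num.sqrt ((u * s) ^+ 2 * pi *+ 2) = u * Num.sqrt (s ^+ 2 * pi *+ 2).
  rewrite exprMn -mulrA -mulrnAr sqrtrM ?sqr_ge0// sqrtr_sqr ger0_norm//.
  by rewrite /u invr_ge0 ltW.
have alg (E1 E2 E3 E4 q : R) : E1 * E2 = E3 * E4 ->
    E1 * (q^-1 * E2) = u * E3 * ((u * q)^-1 * E4).
  move=> E; have -> : u * E3 * ((u * q)^-1 * E4) = (u / u) * (q^-1 * (E3 * E4)).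
    by rewrite invfM; ring.
  by rewrite divff// mul1r -E mulrCA.
apply: alg.
rewrite -!expRD.
congr expR.
rewrite /m exprMn /u exprVn sqt.
have -> : a = (1 - t) / (2 * s ^+ 2) by rewrite /t; field.
by field; rewrite gt_eqF.
Qed.

End gaussian.

(** * Integrals over samples *)

Section iid.
Local Open Scope ereal_scope.
Context (R : realType).

Lemma integral_iidS d (T : measurableType d) (P : probability T R) (n : nat)
    (f : n.+1.-tuple T -> \bar R) :
  measurable_fun setT f -> (forall t, 0 <= f t) ->
  \int[iid_prob P n.+1]_t f t =
  \int[P]_x \int[iid_prob P n]_t f (tuple_cons (x, t)).
Proof.
move=> mf f0; rewrite ge0_integral_distribution//.
rewrite (fubini_tonelli1 (f \o @tuple_cons _ T n))//; last by move=> x; exact: f0.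
by apply: measurableT_comp => //; exact: measurable_funP.
Qed.

Lemma integral_iid0 d (T : measurableType d) (P : probability T R)
    (f : 0.-tuple T -> \bar R) : measurable_fun setT f ->
  \int[iid_prob P 0]_t f t = f [tuple].
Proof. by move=> mf; rewrite integral_dirac// diracT mul1e. Qed.

Lemma measurable_tuple_consl d (T : measurableType d) (n : nat) (x : T) :
  measurable_fun setT (fun t : n.-tuple T => tuple_cons (x, t)).
Proof.
exact: (@measurableT_comp _ _ _ _ _ _ (@tuple_cons _ T n)).
Qed.

Lemma measurable_tuple_consC d0 (T0 : measurableType d0)
    d (T : measurableType d) (n : nat) (f : T0 -> T) (g : T0 -> n.-tuple T) :
  measurable_fun setT f -> measurable_fun setT g ->
  measurable_fun setT (fun x => tuple_cons (f x, g x)).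
Proof. exact: measurable_cons. Qed.

Lemma measurable_tnth_comp d0 (T0 : measurableType d0) d (T : measurableType d)
    n (f : T0 -> n.-tuple T) (i : 'I_n) :
  measurable_fun setT f -> measurable_fun setT (fun x => tnth (f x) i).
Proof.
by move=> mf; apply: (measurableT_comp (measurable_tnth i)).
Qed.

Lemma measurable_integral_snd d1 (T1 : measurableType d1)
    d2 (T2 : measurableType d2) (P : probability T2 R)
    (f : T1 * T2 -> \bar R) : measurable_fun setT f -> (forall w, 0 <= f w) ->
  measurable_fun setT (fun x => \int[P]_y f (x, y)).
Proof. by move=> mf f0; exact: measurable_fun_fubini_tonelli_F. Qed.

Lemma measurable_fun_uncurry d0 (T0 : measurableType d0)
    d1 (T1 : measurableType d1) d2 (T2 : measurableType d2)
    d3 (T3 : measurableType d3) (f : T1 -> T2 -> T3)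
    (g : T0 -> T1) (h : T0 -> T2) :
  measurable_fun setT (fun w => f w.1 w.2) ->
  measurable_fun setT g -> measurable_fun setT h ->
  measurable_fun setT (fun t => f (g t) (h t)).
Proof.
move=> mf mg mh.
exact: (measurableT_comp mf (measurable_fun_pair mg mh)).
Qed.

Lemma map_tuple_cons (T1 T2 : Type) d (T : measurableType d) d' (T' : measurableType d')
   (n : nat) (g : T -> T') (x : T) (w : n.-tuple T) :
  [tuple g (tnth (tuple_cons (x, w)) i) | i < n.+1] =
  tuple_cons (g x, [tuple g (tnth w i) | i < n]).
Proof.
apply: eq_from_tnth => i; rewrite tnth_mktuple /tuple_cons/=.
by case: (unliftP ord0 i) => [j ->|->]//; rewrite !tnthS tnth_mktuple.
Qed.

(** Regroups the law of (X, z) into n i.i.d. rows (x_i, z_i), the form in which the sample can be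
    split and exponential moments factor. *)
Lemma integral_iid_pair d1 (T1 : measurableType d1) d2 (T2 : measurableType d2)
    (P : probability T1 R) (Q : probability T2 R) (n : nat)
    (f : n.-tuple T1 -> n.-tuple T2 -> \bar R) :
  measurable_fun setT (fun w => f w.1 w.2) -> (forall x y, 0 <= f x y) ->
  \int[(iid_prob P n \x iid_prob Q n)]_w f w.1 w.2 =
  \int[iid_prob (P \x Q) n]_w f [tuple (tnth w i).1 | i < n]
                                 [tuple (tnth w i).2 | i < n].
Proof.
elim: n f => [|n IHn] f mf f0.
  rewrite (fubini_tonelli1 (fun w => f w.1 w.2))// /fubini_F.
  rewrite !integral_iid0.
  - by congr (f _ _); rewrite [RHS]tuple0.
  - exact: (measurable_fun_uncurry mf (@measurable_cst _ _ _ _ setT _) (@measurable_id _ _ setT)).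
  - exact: (measurable_integral_snd (iid_prob Q 0) mf).
  - apply: (measurable_fun_uncurry mf); apply/measurable_fun_tnthP.
      by case.
    by case.
transitivity (\int[iid_prob P n.+1]_X \int[iid_prob Q n.+1]_Z f X Z).
  exact: (fubini_tonelli1 (fun w => f w.1 w.2)).
rewrite [LHS]integral_iidS; last 2 first.
- exact: (measurable_integral_snd (iid_prob Q n.+1) mf).
- by move=> t; exact: integral_ge0.
have mf1 x z : measurable_fun setT (fun w => f (tuple_cons (x, w.1)) (tuple_cons (z, w.2))).
  apply: (measurable_fun_uncurry mf).
    exact: (measurableT_comp (measurable_tuple_consl _)).
  exact: (measurableT_comp (measurable_tuple_consl _)).
rewrite [RHS]integral_iidS; last 2 first.
- apply: (measurable_fun_uncurry mf); apply/measurable_fun_tnthP => i.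
    rewrite (_ : _ \o _ = fun w : n.+1.-tuple (T1 * T2) => (tnth w i).1); last first.
      by apply/funext => w /=; rewrite tnth_mktuple.
    exact: (measurableT_comp measurable_fst (measurable_tnth i)).
  rewrite (_ : _ \o _ = fun w : n.+1.-tuple (T1 * T2) => (tnth w i).2); last first.
    by apply/funext => w /=; rewrite tnth_mktuple.
  exact: (measurableT_comp measurable_snd (measurable_tnth i)).
- by move=> t; exact: f0.
under [RHS]eq_integral => w _.
  under eq_integral => t _ do rewrite (map_tuple_cons T1 T1) (map_tuple_cons T2 T2).
  rewrite -(IHn (fun X Z => f (tuple_cons (w.1, X)) (tuple_cons (w.2, Z))))//.
  over.
have mf3 : measurable_fun setT (fun a : (T1 * T2) * (n.-tuple T1 * n.-tuple T2) =>
    f (tuple_cons (a.1.1, a.2.1)) (tuple_cons (a.1.2, a.2.2))).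
  apply: (measurable_fun_uncurry mf); apply: measurable_tuple_consC.
  - exact: (measurableT_comp measurable_fst).
  - exact: (measurableT_comp measurable_fst).
  - exact: (measurableT_comp measurable_snd).
  - exact: (measurableT_comp measurable_snd).
rewrite (fubini_tonelli1 (fun w : T1 * T2 => \int[iid_prob P n \x iid_prob Q n]_w0
  f (tuple_cons (w.1, w0.1)) (tuple_cons (w.2, w0.2)))); last 2 first.
- exact: (measurable_integral_snd (iid_prob P n \x iid_prob Q n) mf3).
- by move=> w; exact: integral_ge0.
rewrite /fubini_F; apply: eq_integral => x _ /=.
transitivity (\int[iid_prob P n]_X \int[Q]_z \int[iid_prob Q n]_Z
    f (tuple_cons (x, X)) (tuple_cons (z, Z))).
  apply: eq_integral => X _; rewrite integral_iidS//.
  by apply: (measurable_fun_uncurry mf) => //; exact: measurable_cst.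
(* The first noise variable has to be moved in front of the remaining rows [X]; this is Tonelli
   applied to [h]. *)
pose h (w : n.-tuple T1 * T2) := \int[iid_prob Q n]_Z
    f (tuple_cons (x, w.1)) (tuple_cons (w.2, Z)).
rewrite (fubini_tonelli h); last 2 first.
- apply: (measurable_integral_snd (iid_prob Q n) 
    (f := fun w : (n.-tuple T1 * T2) * n.-tuple T2 =>
      f (tuple_cons (x, w.1.1)) (tuple_cons (w.1.2, w.2)))) => //.
  apply: (measurable_fun_uncurry mf); apply: measurable_tuple_consC.
  - exact: measurable_cst.
  - exact: (measurableT_comp measurable_fst).
  - exact: (measurableT_comp measurable_snd).
  - exact: measurable_snd.
- by move=> w; exact: integral_ge0.
apply: eq_integral => z _; rewrite /h/=.
rewrite (fubini_tonelli1 (fun w0 => f (tuple_cons (x, w0.1)) (tuple_cons (z, w0.2))))//.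
Qed.

Lemma integral_iid_cat d (T : measurableType d) (P : probability T R)
    (n1 n2 : nat) (f : (n1 + n2).-tuple T -> \bar R) :
  measurable_fun setT f -> (forall t, 0 <= f t) ->
  \int[iid_prob P (n1 + n2)]_t f t =
  \int[iid_prob P n1]_u \int[iid_prob P n2]_v f [tuple of u ++ v].
Proof.
elim: n1 f => [|n1 IHn] f mf f0.
  rewrite integral_iid0; first by apply: eq_integral => v _; congr f; exact: val_inj.
  rewrite (_ : (fun _ => _) = cst (\int[iid_prob P n2]_v f [tuple of [tuple] ++ v])).
    exact: measurable_cst.
  by apply/funext => u; rewrite [u]tuple0.
have mcat m1 m2 : measurable_fun setT
    (fun w : m1.-tuple T * m2.-tuple T => [tuple of w.1 ++ w.2]).
  apply/measurable_fun_tnthP => i; case: (split_ordP i) => j ->.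
    rewrite (_ : _ \o _ = fun w : m1.-tuple T * m2.-tuple T => tnth w.1 j).
      exact: measurable_tnth_comp.
    by apply/funext => w; rewrite /= tnth_lshift.
  rewrite (_ : _ \o _ = fun w : m1.-tuple T * m2.-tuple T => tnth w.2 j).
    exact: measurable_tnth_comp.
  by apply/funext => w; rewrite /= tnth_rshift.
rewrite [LHS](@integral_iidS _ _ _ (n1 + n2)%N)//.
rewrite integral_iidS; last 2 first.
- apply: (measurable_integral_snd (iid_prob P n2)
    (f := fun w : n1.+1.-tuple T * n2.-tuple T => f [tuple of w.1 ++ w.2])) => //.
  exact: measurableT_comp mf (mcat _ _).
- by move=> t; exact: integral_ge0.
apply: eq_integral => x _.
rewrite IHn; last 2 first.
- exact: measurableT_comp mf (measurable_tuple_consl _).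
- by move=> t; exact: f0.
apply: eq_integral => u _; apply: eq_integral => v _.
by congr f; exact: val_inj.
Qed.

(** Stated with upper bounds on the factors, which is the form that Chernoff arguments use. *)
Lemma integral_iid_prod d (T : measurableType d) (P : probability T R)
    (n : nat) (g : 'I_n -> T -> R) (c : 'I_n -> R) :
  (forall i, measurable_fun setT (g i)) -> (forall i x, (0 <= g i x)%R) ->
  (forall i, \int[P]_x (g i x)%:E <= (c i)%:E) ->
  \int[iid_prob P n]_t (\prod_(i < n) g i (tnth t i))%:E <= (\prod_(i < n) c i)%:E.
Proof.
elim: n g c => [|n IHn] g c mg g0 gc.
  rewrite integral_iid0 ?big_ord0//.
  by apply/measurable_EFinP; under eq_fun do rewrite big_ord0; exact: measurable_cst.
have c0 i : (0 <= c i)%R.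
  by rewrite -lee_fin; apply: le_trans (gc i); apply: integral_ge0 => x _; rewrite lee_fin.
have mprod m (h : 'I_m -> T -> R) : (forall i, measurable_fun setT (h i)) ->
    measurable_fun setT (fun t : m.-tuple T => \prod_(i < m) h i (tnth t i))%R.
  move=> mh; apply: measurable_prod => i _.
  exact: (measurableT_comp (mh i) (measurable_tnth i)).
rewrite integral_iidS; last 2 first.
- by apply/measurable_EFinP; exact: mprod.
- by move=> t; rewrite lee_fin prodr_ge0.
rewrite big_ord_recl.
apply: (@le_trans _ _ (\int[P]_x ((\prod_(i < n) c (lift ord0 i))%:E * (g ord0 x)%:E))).
  apply: ge0_le_integralT => x.
    by apply: integral_ge0 => t _; rewrite lee_fin prodr_ge0.
  under eq_integral => t _.
    rewrite big_ord_recl/=.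
    rewrite (_ : tnth _ ord0 = x)//.
    under eq_bigr => i _ do rewrite /tuple_cons/= tnthS.
    over.
  rewrite ge0_integralZlT//; last 2 first.
  - exact: (mprod n (fun i => g (lift ord0 i)) (fun i => mg _)).
  - by move=> t; rewrite prodr_ge0.
  rewrite [leRHS]muleC lee_wpmul2l ?lee_fin//.
  exact: (IHn (fun i => g (lift ord0 i)) (fun i => c (lift ord0 i))
    (fun i => mg _) (fun i => g0 _) (fun i => gc _)).
rewrite ge0_integralZl//; last 3 first.
- exact/measurable_EFinP.
- by move=> x _; rewrite lee_fin.
- by rewrite lee_fin prodr_ge0.
by rewrite EFinM muleC lee_wpmul2r// lee_fin prodr_ge0.
Qed.

End iid.

(** * Translations of Gaussian vectors *)

Section gaussian_vectors.
Context (R : realType).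
Local Notation T := (measurableTypeR R).

Lemma measurable_mktuple d0 (T0 : measurableType d0) d (T' : measurableType d)
    n (f : 'I_n -> T0 -> T') :
  (forall i, measurable_fun setT (f i)) ->
  measurable_fun setT (fun x => [tuple f i x | i < n]).
Proof.
move=> mf; apply/measurable_fun_tnthP => i.
rewrite (_ : _ \o _ = f i)//.
by apply/funext => x /=; rewrite tnth_mktuple.
Qed.

Lemma measurable_tnth_fun n (i : 'I_n) :
  measurable_fun setT (fun t : n.-tuple T => tnth t i : R).
Proof. exact: measurable_tnth. Qed.

Lemma integral_iid_normal_shift (s : R) n (a : 'I_n -> R) (f : n.-tuple T -> R) :
  s != 0 -> measurable_fun setT f -> (forall x, 0 <= f x) ->
  (\int[iid_prob (normal_prob 0 s) n]_z
     (f [tuple (tnth z i + a i)%R | i < n])%:E =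
   \int[iid_prob (normal_prob 0 s) n]_z
     (f z * expR (\sum_(i < n) (a i * tnth z i - a i ^+ 2 / 2) / s ^+ 2))%:E)%E.
Proof.
move=> s0.
have mE m (b : 'I_m -> R) : measurable_fun setT (fun z : m.-tuple T =>
    expR (\sum_(i < m) (b i * tnth z i - b i ^+ 2 / 2) / s ^+ 2)).
  apply: measurableT_comp => //; apply: measurable_sum => i.
  apply: measurable_funM => //; apply: measurable_funB => //.
  by apply: measurable_funM => //; exact: measurable_tnth_fun.
have mS m (b : 'I_m -> R) : measurable_fun setT (fun z : m.-tuple T =>
    [tuple (tnth z i + b i)%R : T | i < m]).
  apply: measurable_mktuple => i.
  by apply: measurable_funD => //; exact: measurable_tnth_fun.
elim: n a f => [|n IHn] a f mf f0.
  apply: eq_integral => z _; rewrite big_ord0 expR0 mulr1; congr (f _)%:E.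
  by rewrite [RHS]tuple0 [LHS]tuple0.
rewrite !integral_iidS; last 4 first.
- by apply/measurable_EFinP; apply: measurable_funM => //; exact: mE.
- by move=> t; rewrite lee_fin mulr_ge0// expR_ge0.
- by apply/measurable_EFinP; apply: (measurableT_comp mf); exact: mS.
- by move=> t; rewrite lee_fin.
have mf1 : measurable_fun setT (fun w : T * n.-tuple T => f (tuple_cons (w.1, w.2))).
  by apply: (measurableT_comp mf); exact: measurable_tuple_consC.
transitivity (\int[normal_prob 0 s]_x \int[iid_prob (normal_prob 0 s) n]_z
   (f (tuple_cons (x + a ord0, z)) * expR (\sum_(i < n)
      (a (lift ord0 i) * tnth z i - a (lift ord0 i) ^+ 2 / 2) / s ^+ 2))%:E)%E.
  apply: eq_integral => x _.
  rewrite -(IHn (fun i => a (lift ord0 i)) (fun z => f (tuple_cons (x + a ord0, z))))//; last first.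
    by apply: (measurableT_comp mf); exact: measurable_tuple_consl.
  apply: eq_integral => z _; congr (f _)%:E.
  apply: eq_from_tnth => i; rewrite tnth_mktuple /tuple_cons/=.
  by case: (unliftP ord0 i) => [j ->|->]//; rewrite !tnthS tnth_mktuple.
pose G x := (\int[iid_prob (normal_prob 0 s) n]_z
   (f (tuple_cons (x, z)) * expR (\sum_(i < n)
      (a (lift ord0 i) * tnth z i - a (lift ord0 i) ^+ 2 / 2) / s ^+ 2))%:E)%E.
pose h (w : T * n.-tuple T) := f (tuple_cons (w.1, w.2)) * expR (\sum_(i < n)
      (a (lift ord0 i) * tnth w.2 i - a (lift ord0 i) ^+ 2 / 2) / s ^+ 2).
have mh : measurable_fun setT h.
  apply: measurable_funM => //.
  exact: (measurableT_comp (mE n (fun i => a (lift ord0 i)))).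
have h0 w : 0 <= h w by rewrite mulr_ge0// expR_ge0.
have mshift (b : R) : measurable_fun [set: T] (fun x : T => x + b : T).
  by apply: measurable_funD => //; exact: measurable_cst.
have mx : measurable_fun setT (fun x : T => expR ((a ord0 * x - a ord0 ^+ 2 / 2) / s ^+ 2)).
  apply: measurableT_comp => //; apply: measurable_funM => //.
  by apply: measurable_funB => //; apply: measurable_funM.
transitivity (\int[iid_prob (normal_prob 0 s) n]_z \int[normal_prob 0 s]_x
    (h (x + a ord0, z)%R)%:E)%E.
  rewrite (fubini_tonelli (fun w : T * n.-tuple T => (h (w.1 + a ord0, w.2)%R)%:E))//.
    apply/measurable_EFinP; apply: (measurableT_comp mh).
    apply: measurable_fun_pair => //.
    exact: (measurableT_comp (mshift _)).
  by move=> w; rewrite lee_fin.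
transitivity (\int[iid_prob (normal_prob 0 s) n]_z \int[normal_prob 0 s]_x
    (h (x, z)%R * expR ((a ord0 * x - a ord0 ^+ 2 / 2) / s ^+ 2))%:E)%E.
  apply: eq_integral => z _.
  rewrite (integral_normal_shift _ (f := fun x => h (x, z)))//.
  by apply: (measurableT_comp mh).
rewrite -(fubini_tonelli (fun w : T * n.-tuple T => (h w *
  expR ((a ord0 * w.1 - a ord0 ^+ 2 / 2) / s ^+ 2))%:E)); last 2 first.
- apply/measurable_EFinP; apply: measurable_funM => //.
  exact: (measurableT_comp mx).
- by move=> w; rewrite lee_fin mulr_ge0// expR_ge0.
apply: eq_integral => x _; apply: eq_integral => z _.
congr EFin; rewrite /h/= -mulrA -expRD; congr (_ * expR _).
rewrite big_ord_recl addrC; congr (_ + _).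
by apply: eq_bigr => i _; rewrite /tuple_cons/= tnthS.
Qed.

Lemma integral_iid_coord d (T' : measurableType d) (P : probability T' R) n
    (j : 'I_n) (g : T' -> R) (c : R) :
  measurable_fun setT g -> (forall x, 0 <= g x) ->
  (\int[P]_x (g x)%:E <= c%:E)%E ->
  (\int[iid_prob P n]_t (g (tnth t j))%:E <= c%:E)%E.
Proof.
move=> mg g0 gc.
have := @integral_iid_prod _ _ _ P n (fun i => if i == j then g else cst 1)
  (fun i => if i == j then c else 1).
rewrite [X in (_ <= X%:E)%E](bigD1 j)//= eqxx big1 ?mulr1; last by move=> i /negPf ->.
move=> H; apply: le_trans (H _ _ _).
- rewrite le_eqVlt; apply/orP; left; apply/eqP; apply: eq_integral => t _.
  by rewrite (bigD1 j)//= eqxx big1 ?mulr1// => i /negPf ->.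
- by move=> i; case: eqP => // _; exact: measurable_cst.
- by move=> i x; case: eqP.
- move=> i; case: eqP => // _.
  by apply: ge0_integral_le_cst => x; rewrite lee_fin.
Qed.

(* Splits the shifted expectation according to whether the likelihood ratio
   of the shift exceeds [expR g]. *)
Lemma integral_iid_normal_shift_le (s g th : R) n (a : 'I_n -> R)
    (f : n.-tuple T -> R) :
  s != 0 -> 0 < th -> measurable_fun setT f -> (forall x, 0 <= f x <= 1) ->
  (\int[iid_prob (normal_prob 0 s) n]_z
     (f [tuple (tnth z i + a i)%R | i < n])%:E <=
   (expR g)%:E * \int[iid_prob (normal_prob 0 s) n]_z (f z)%:E +
   (expR (- (th * g) +
      (th + th ^+ 2) * (\sum_(i < n) a i ^+ 2) / (2 * s ^+ 2)))%:E)%E.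
Proof.
move=> s0 th0 mf f01.
have f0 x : 0 <= f x by case/andP: (f01 x).
rewrite integral_iid_normal_shift//.
pose l z := \sum_(i < n) (a i * tnth z i - a i ^+ 2 / 2) / s ^+ 2.
have ml : measurable_fun setT (l : n.-tuple T -> R).
  apply: measurable_sum => i.
  apply: measurable_funM => //; apply: measurable_funB => //.
  by apply: measurable_funM => //; exact: measurable_tnth_fun.
(* Where l <= g the likelihood ratio is at most e^g. Where l > g, Chernoff's e^l <= e^(- th g) e^((1
   + th) l) applies, and [f] is at most 1. *)
apply: (@le_trans _ _ (\int[iid_prob (normal_prob 0 s) n]_z
   (expR g * f z + expR (- (th * g)) * expR ((1 + th) * l z))%:E)%E).
  apply: ge0_le_integralT => z; rewrite lee_fin ?mulr_ge0 ?expR_ge0//.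
  have [lg|gl] := leP (l z) g.
    rewrite -[leLHS]addr0 lerD ?mulr_ge0 ?expR_ge0// mulrC ler_wpM2r//.
    by rewrite ler_expR.
  rewrite -[leLHS]add0r lerD ?mulr_ge0 ?expR_ge0// -expRD.
  apply: (@le_trans _ _ (expR (l z))).
    by rewrite ler_piMl ?expR_ge0//; case/andP: (f01 z).
  rewrite ler_expR.
  have : th * g <= th * l z by rewrite ler_wpM2l// ltW.
  lra.
rewrite ge0_integralDT; last 4 first.
- exact: measurable_funM.
- by move=> x; rewrite mulr_ge0 ?expR_ge0.
- apply: measurable_funM => //; apply: measurableT_comp => //.
  exact: measurable_funM.
- by move=> x; rewrite mulr_ge0 ?expR_ge0.
rewrite ge0_integralZlT ?expR_ge0//; apply: leeD2l.
rewrite ge0_integralZlT ?expR_ge0//; last first.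
- by apply: measurableT_comp => //; exact: measurable_funM.
rewrite expRD EFinM lee_wpmul2l ?lee_fin ?expR_ge0//.
pose c i := expR ((th + th ^+ 2) * a i ^+ 2 / (2 * s ^+ 2)).
pose gi i (x : T) := expR ((1 + th) * ((a i * x - a i ^+ 2 / 2) / s ^+ 2)).
have -> : expR ((th + th ^+ 2) * (\sum_(i < n) a i ^+ 2) / (2 * s ^+ 2)) =
    \prod_(i < n) c i.
  by rewrite -expR_sum mulr_sumr mulr_suml.
rewrite (eq_integral (fun z : n.-tuple T => (\prod_(i < n) gi i (tnth z i))%:E)); last first.
  by move=> z _; rewrite /l mulr_sumr expR_sum.
apply: integral_iid_prod => [i|i x|i].
- apply: measurableT_comp => //; apply: measurable_funM => //.
  apply: measurable_funM => //; apply: measurable_funB => //.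
- exact: expR_ge0.
rewrite (eq_integral (fun x : T => (expR (- ((1 + th) * (a i ^+ 2 / 2 / s ^+ 2))) *
   expR (0 * x ^+ 2 + ((1 + th) * a i / s ^+ 2) * x))%:E)); last first.
  by move=> x _; rewrite -expRD /gi; congr (expR _)%:E; field.
rewrite ge0_integralZlT ?expR_ge0//; last first.
  apply: measurableT_comp => //; apply: measurable_funD; apply: measurable_funM => //.
rewrite integral_normal_exp//; last by rewrite mulr0 mul0r ltr01.
rewrite mulr0 mul0r subr0 sqrtr1 invr1 mul1r mulr1 -EFinM lee_fin -expRD.
by rewrite ler_expR /c le_eqVlt; apply/orP; left; apply/eqP; field.
Qed.

End gaussian_vectors.

(** * Lower bound *)

Section score.
Context (R : realType).

(* Up to scaling, [1 - score v l] bounds [|v - e_l|^2] from below; since the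
   scores sum to at most 1, an estimate acts as a randomised guess of [l]. *)
Definition score m (v : 'I_m -> R) (l : 'I_m) : R :=
  Num.max 0 (2 * v l - \sum_(i < m) v i ^+ 2).

Lemma score_ge0 m (v : 'I_m -> R) l : 0 <= score v l.
Proof. by rewrite /score le_max lexx. Qed.

(** If N scores are positive, their sum is at most the sum of 2 v_l - N v_l^2 over these l, because
    S dominates the sum of their v_l^2; each such term is at most 1 / N. *)
Lemma score_sum_le1 m (v : 'I_m -> R) : \sum_(l < m) score v l <= 1.
Proof.
set S := \sum_(i < m) v i ^+ 2.
pose A := [pred l : 'I_m | 0 < 2 * v l - S].
have -> : \sum_(l < m) score v l = \sum_(l in A) (2 * v l - S).
  rewrite [RHS]big_mkcond; apply: eq_bigr => l _; rewrite /score inE.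
  by case: ltP => // h; rewrite -/S.
have [A0|A0] := posnP #|A|.
  rewrite big_pred0 ?ler01// => l; apply/negbTE/negP => lA.
  by have := card0_eq A0 l; rewrite lA.
set N : R := #|A|%:R; have N0 : 0 < N by rewrite ltr0n.
have SA : \sum_(l in A) v l ^+ 2 <= S.
  rewrite /S [leRHS](bigID A)/= lerDl sumr_ge0// => i _; exact: sqr_ge0.
apply: (@le_trans _ _ (\sum_(l in A) (2 * v l - N * v l ^+ 2))).
  rewrite !sumrB lerD2l lerN2 -mulr_sumr sumr_const -[leRHS]mulr_natl.
  by rewrite ler_wpM2l// ltW.
apply: (@le_trans _ _ (\sum_(l in A) N^-1)).
  apply: ler_sum => l _; rewrite -subr_ge0.
  have -> : N^-1 - (2 * v l - N * v l ^+ 2) = N * (v l - N^-1) ^+ 2.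
    by field; rewrite gt_eqF.
  by rewrite mulr_ge0 ?sqr_ge0// ltW.
by rewrite sumr_const -mulr_natl -/N divff// gt_eqF.
Qed.

Lemma score_le1 m (v : 'I_m -> R) l : score v l <= 1.
Proof.
apply: le_trans (score_sum_le1 v); rewrite (bigD1 l)//= lerDl sumr_ge0// => i _.
exact: score_ge0.
Qed.

Lemma score_dist m (v : 'I_m -> R) (l : 'I_m) :
  1 - score v l <= \sum_(i < m) (v i - (i == l)%:R) ^+ 2.
Proof.
have -> : \sum_(i < m) (v i - (i == l)%:R) ^+ 2 =
    \sum_(i < m) v i ^+ 2 - 2 * v l + 1.
  rewrite !(bigD1 l (P := xpredT))//= eqxx.
  rewrite (eq_bigr (fun i => v i ^+ 2)) => [|i /negPf ->]; last by rewrite subr0.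
  by rewrite mulr1n; ring.
have : 2 * v l - \sum_(i < m) v i ^+ 2 <= score v l by rewrite /score le_max lexx orbT.
lra.
Qed.

(** Under a uniform [J], the guess [h J] ignores [J b], so it hits [J b] with mean at most 1 / m.
    The proof averages over the m cyclic shifts of coordinate b, each of which permutes the
    choices. *)
Lemma sum_ffun_coord_le (k m : nat) (b : 'I_k) (h : {ffun 'I_k -> 'I_m} -> 'I_m -> R) :
  (forall (J J' : {ffun 'I_k -> 'I_m}) l, (forall b', b' != b -> J b' = J' b') -> h J l = h J' l) ->
  (forall J, \sum_l h J l <= 1) ->
  m%:R * \sum_J h J (J b) <= #|{ffun 'I_k -> 'I_m}|%:R.
Proof.
case: m h => [|m] h hJ h1; first by rewrite mul0r.
pose phi (t : 'I_m.+1) (J : {ffun 'I_k -> 'I_m.+1}) : {ffun 'I_k -> 'I_m.+1} :=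
  [ffun b' => if b' == b then J b + t else J b'].
have phiK t : cancel (phi t) (phi (- t)).
  by move=> J; apply/ffunP => b'; rewrite !ffunE eqxx; case: eqP => [->|]//; rewrite addrK.
have -> : m.+1%:R * (\sum_J h J (J b)) = \sum_(t < m.+1) \sum_J h J (J b + t).
  set S := (X in _ * X).
  rewrite mulr_natl -[in LHS](card_ord m.+1) -sumr_const.
  apply: eq_bigr => t _; rewrite /S (reindex_inj (can_inj (phiK t))).
  apply: eq_bigr => J _; rewrite ffunE eqxx; apply: hJ => b' /negPf b'b.
  by rewrite ffunE b'b.
rewrite exchange_big/= -sum1_card natr_sum; apply: ler_sum => J _.
apply: le_trans (h1 J); rewrite [leRHS](reindex_inj (addrI (J b))).
exact: lexx.
Qed.

End score.

Section bounded_integral.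
Context d (T : measurableType d) (R : realType) (P : probability T R).

Lemma fine_integral01 (f : T -> R) : (forall x, 0 <= f x <= 1) ->
  (\int[P]_x (f x)%:E = (fine (\int[P]_x (f x)%:E))%:E)%E.
Proof.
move=> f01; rewrite fineK// ge0_fin_numE; last first.
  by apply: integral_ge0 => x _; rewrite lee_fin; case/andP: (f01 x).
apply: (@le_lt_trans _ _ 1%:E); last exact: ltry.
by apply: ge0_integral_le_cst => x; rewrite lee_fin; case/andP: (f01 x).
Qed.

End bounded_integral.

Section response.
Context (R : realType) (n p : nat).
Local Notation T := (measurableTypeR R).
Local Notation coefs := (p.-tuple T).
Local Notation design := (n.-tuple coefs).
Local Notation sample := (n.-tuple T).

Lemma measurable_response d0 (T0 : measurableType d0) (beta : T0 -> coefs)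
    (X : T0 -> design) (z : T0 -> sample) :
  measurable_fun setT beta -> measurable_fun setT X -> measurable_fun setT z ->
  measurable_fun setT (fun w => response (beta w) (X w) (z w)).
Proof.
move=> mb mX mz; apply: measurable_mktuple => i.
apply: measurable_funD; last exact: (measurableT_comp (measurable_tnth_fun i)).
apply: measurable_sum => j; apply: measurable_funM.
  apply: (measurableT_comp (measurable_tnth_fun j)).
  exact: measurable_tnth_comp.
exact: (measurableT_comp (measurable_tnth_fun j)).
Qed.

Lemma l2norm_sub_sqr (u v : coefs) :
  l2norm (tuple_sub u v) ^+ 2 = \sum_(j < p) (tnth u j - tnth v j) ^+ 2.
Proof.
rewrite /l2norm sqr_sqrtr; last by apply: sumr_ge0 => i _; exact: sqr_ge0.
by apply: eq_bigr => j _; rewrite tnth_mktuple.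
Qed.

Lemma measurable_loss d0 (T0 : measurableType d0) (u v : T0 -> coefs) :
  measurable_fun setT u -> measurable_fun setT v ->
  measurable_fun setT (fun w => l2norm (tuple_sub (u w) (v w)) ^+ 2).
Proof.
move=> mu mv; under eq_fun do rewrite l2norm_sub_sqr.
apply: measurable_sum => j; apply: measurable_funX; apply: measurable_funB.
  exact: (measurableT_comp (measurable_tnth_fun j)).
exact: (measurableT_comp (measurable_tnth_fun j)).
Qed.

Lemma riskE (sigma : R) (bhat : sample * design -> coefs) (beta : coefs) :
  risk sigma bhat beta =
  (\int[design_noise_prob n p sigma]_w (l2norm (tuple_sub
      (bhat (response beta w.1 w.2, w.1)) beta) ^+ 2)%:E)%E.
Proof. by rewrite /risk unlock. Qed.

Lemma risk_ge0 (sigma : R) (bhat : sample * design -> coefs) (beta : coefs) :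
  (0 <= risk sigma bhat beta)%E.
Proof. by rewrite riskE; apply: integral_ge0 => w _; rewrite lee_fin sqr_ge0. Qed.

End response.

(** Squared, this is 1 + y <= e^y at y = 2x / (1 - 2x). It puts the moment generating function of a
    squared Gaussian in exponential form. *)
Lemma inv_sqrt_le_expR (R : realType) (x : R) : 2 * x < 1 ->
  (Num.sqrt (1 - 2 * x))^-1 <= expR (x / (1 - 2 * x)).
Proof.
move=> x2; have t0 : 0 < 1 - 2 * x by lra.
rewrite -ler_sqr ?nnegrE ?expR_ge0 ?invr_ge0 ?sqrtr_ge0//.
rewrite exprVn sqr_sqrtr ?(ltW t0)// expr2 -expRD.
apply: le_trans (expR_ge1Dx _); rewrite le_eqVlt; apply/orP; left; apply/eqP.
by field; rewrite gt_eqF.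
Qed.

(** * Bayes risk under the block-spike prior *)

Section bayes_risk.
Context (R : realType) (n p k m : nat) (sigma mu g th : R).
Local Notation T := (measurableTypeR R).
Local Notation coefs := (p.-tuple T).
Local Notation design := (n.-tuple coefs).
Local Notation sample := (n.-tuple T).
Variable pos : 'I_k * 'I_m -> 'I_p.
Hypothesis pos_inj : injective pos.
Hypothesis sigma0 : 0 < sigma.
Hypothesis mu0 : 0 < mu.
Hypothesis th0 : 0 < th.
Hypothesis m0 : (0 < m)%N.

Local Notation choices := {ffun 'I_k -> 'I_m}.

(** With [predT] this is a point of the prior; with [predC1 b] the spike of block b is removed,
    which gives the reference model of the change of measure. *)
Definition spikes (B : pred 'I_k) (J : choices) : coefs :=
  [tuple if [exists b, B b && (j == pos (b, J b))] then mu else 0 | j < p].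

Lemma spikes_sparse J : sparse_vectors k (spikes predT J).
Proof.
rewrite /sparse_vectors/= /l0norm.
apply: leq_trans (_ : #|[set pos (b, J b) | b : 'I_k]| <= _)%N.
  apply: subset_leq_card; apply/fintype.subsetP => j; rewrite inE tnth_mktuple.
  case: ifP => [/existsP[b /andP[_ /eqP ->]] _|]; last by rewrite eqxx.
  exact: imset_f.
by apply: leq_trans (leq_imset_card _ _) _; rewrite card_ord.
Qed.

Lemma spikes_pos (J : choices) b l : tnth (spikes predT J) (pos (b, l)) = mu * (l == J b)%:R.
Proof.
rewrite tnth_mktuple; case: existsP => [[b' /= /eqP/pos_inj[-> ->]]|h].
  by rewrite eqxx mulr1.
case: eqP => [lJ|]; last by rewrite mulr0.
by exfalso; apply: h; exists b => /=; rewrite lJ.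
Qed.

Lemma spikes_split (J : choices) b j : tnth (spikes predT J) j =
  tnth (spikes (predC1 b) J) j + mu * (j == pos (b, J b))%:R.
Proof.
rewrite !tnth_mktuple; case: eqP => [->|jb].
  rewrite mulr1; case: existsP => [_|h]; last first.
    by exfalso; apply: h; exists b => /=.
  case: existsP => [[b' /= /andP[b'b /eqP/pos_inj[bb _]]]|_]; last by rewrite add0r.
  by rewrite bb eqxx in b'b.
rewrite mulr0 addr0; congr (if _ then _ else _); apply/existsP/existsP => -[b' /=].
  move=> /eqP jb'; exists b'; rewrite jb' eqxx andbT.
  by apply/eqP => b'b; apply: jb; rewrite jb' b'b.
by move=> /andP[_ ?]; exists b'.
Qed.

Lemma spikes_indep b (J J' : choices) : (forall b', b' != b -> J b' = J' b') ->
  spikes (predC1 b) J = spikes (predC1 b) J'.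
Proof.
move=> JJ; apply: eq_from_tnth => j; rewrite !tnth_mktuple.
congr (if _ then _ else _); apply: eq_existsb => b' /=.
by case: eqP => //= /eqP b'b; rewrite JJ.
Qed.

(** Given the design, removing a spike amounts to translating the noise by mu times a column of [X],
    so the Gaussian translation bound applies conditionally on [X]. *)
Lemma response_spikes (J : choices) b (X : design) (z : sample) :
  response (spikes predT J) X z = response (spikes (predC1 b) J) X
    [tuple tnth z i + mu * tnth (tnth X i) (pos (b, J b)) | i < n].
Proof.
apply: eq_from_tnth => i; rewrite !tnth_mktuple.
under eq_bigr => j _ do rewrite (spikes_split J b) mulrDr.
rewrite big_split/= -addrA; congr (_ + _).
rewrite addrC; congr (_ + _).
rewrite (bigD1 (pos (b, J b)))//= eqxx mulr1 big1 ?addr0 1?mulrC// => j /negPf ->.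
by rewrite mulr0 mulr0.
Qed.

Variable bhat : sample * design -> coefs.
Hypothesis mbhat : measurable_fun setT bhat.

Local Notation P := (design_noise_prob n p sigma).

Definition guess b (y : sample * design) : 'I_m -> R :=
  fun l => tnth (bhat y) (pos (b, l)) / mu.

Definition escore b l (beta : coefs) (w : design * sample) : R :=
  score (guess b (response beta w.1 w.2, w.1)) l.

Lemma escore01 b l beta w : 0 <= escore b l beta w <= 1.
Proof. by rewrite /escore score_ge0 score_le1. Qed.

Lemma measurable_escore b l beta : measurable_fun setT (escore b l beta).
Proof.
have mr : measurable_fun setT (fun w : design * sample => bhat (response beta w.1 w.2, w.1)).
  apply: (measurableT_comp mbhat); apply: measurable_fun_pair => //.
  by apply: measurable_response => //; exact: measurable_cst.
have mg l' : measurable_fun setT (fun w : design * sample =>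
    guess b (response beta w.1 w.2, w.1) l').
  apply: measurable_funM => //.
  exact: (measurableT_comp (measurable_tnth_fun _) mr).
apply: measurable_maxr => //; apply: measurable_funB.
  by apply: measurable_funM.
by apply: measurable_sum => i; apply: measurable_funX.
Qed.

(** [score_dist] in each block, scaled by mu^2; the blocks are disjoint because [pos] is injective,
    so their losses add up to at most the whole loss. *)
Lemma loss_escore (J : choices) w :
  k%:R * mu ^+ 2 <= l2norm (tuple_sub (bhat (response (spikes predT J) w.1 w.2, w.1))
     (spikes predT J)) ^+ 2 + \sum_b mu ^+ 2 * escore b (J b) (spikes predT J) w.
Proof.
rewrite l2norm_sub_sqr; set bh := bhat _; set be := spikes _ _.
have mu2 : 0 <= mu ^+ 2 by exact: sqr_ge0.
apply: (@le_trans _ _ (\sum_b mu ^+ 2 * ((\sum_l (guess b (response be w.1 w.2, w.1) l - (l == J b)%:R) ^+ 2) +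
     escore b (J b) be w))).
  rewrite -[k in leLHS]card_ord mulr_natl -sumr_const; apply: ler_sum => b _.
  rewrite ler_peMr// -lerBlDr; exact: score_dist.
under eq_bigr => b _ do rewrite mulrDr.
rewrite big_split/= lerD2r.
have -> : \sum_b mu ^+ 2 * (\sum_l (guess b (response be w.1 w.2, w.1) l - (l == J b)%:R) ^+ 2) =
    \sum_(x : 'I_k * 'I_m) (tnth bh (pos x) - tnth be (pos x)) ^+ 2.
  rewrite (eq_bigr (fun b => \sum_l (tnth bh (pos (b, l)) - tnth be (pos (b, l))) ^+ 2)).
    by rewrite pair_big/=; apply: eq_bigr => -[].
  move=> b _; rewrite mulr_sumr; apply: eq_bigr => l _.
  rewrite spikes_pos -exprMn; congr (_ ^+ 2).
  by rewrite /guess mulrBr mulrCA divff ?mulr1// gt_eqF.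
rewrite -(big_imset (fun j => (tnth bh j - tnth be j) ^+ 2) (h := pos) (A := predT))/=; last first.
  by move=> x y _ _; exact: pos_inj.
rewrite [leRHS](bigID (mem (pos @: predT)))/= lerDl sumr_ge0// => j _.
exact: sqr_ge0.
Qed.

(** The coefficient of each squared design entry in the overshoot term of
    [integral_iid_normal_shift_le]. Averaging over a column, a chi-square integral, then bounds that
    term by [eps] below. *)
Let c := (th + th ^+ 2) * mu ^+ 2 / (2 * sigma ^+ 2).
Hypothesis c2 : 2 * c < 1.
Let eps := expR (- (th * g) + n%:R * (c / (1 - 2 * c))).

Lemma integral_design_column (j : 'I_p) :
  (\int[iid_prob (iid_prob (normal_prob 0 1) p) n]_X
     (expR (- (th * g) + (th + th ^+ 2) * (\sum_(i < n) (mu * tnth (tnth X i) j) ^+ 2) /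
         (2 * sigma ^+ 2)))%:E <= eps%:E)%E.
Proof.
have msq : measurable_fun setT (fun x : T => expR (c * x ^+ 2)).
  by apply: measurableT_comp => //; apply: measurable_funM.
have mrow : measurable_fun setT (fun x : coefs => expR (c * (tnth x j) ^+ 2)).
  exact: (measurableT_comp msq (measurable_tnth_fun j)).
have mprod : measurable_fun setT (fun X : design => \prod_(i < n) expR (c * (tnth (tnth X i) j) ^+ 2)).
  apply: measurable_prod => i _.
  exact: (measurableT_comp mrow (measurable_tnth i)).
rewrite (eq_integral (fun X : design => (expR (- (th * g)) *
   \prod_(i < n) expR (c * (tnth (tnth X i) j) ^+ 2))%:E)); last first.
  move=> X _; rewrite -expR_sum -expRD; congr (expR (_ + _))%:E.
  rewrite mulr_sumr mulr_suml; apply: eq_bigr => i _.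
  by rewrite /c; field; rewrite gt_eqF.
rewrite ge0_integralZlT ?expR_ge0//; last first.
  by move=> X; apply: prodr_ge0 => i _; exact: expR_ge0.
rewrite /eps expRD EFinM lee_wpmul2l ?lee_fin ?expR_ge0//.
have -> : expR (n%:R * (c / (1 - 2 * c))) = \prod_(i < n) expR (c / (1 - 2 * c)).
  by rewrite -expR_sum sumr_const card_ord mulr_natl.
apply: (@integral_iid_prod R _ _ (iid_prob (normal_prob (0 : R) 1) p) n
  (fun _ (x : coefs) => expR (c * tnth x j ^+ 2))
  (fun _ => expR (c / (1 - 2 * c)))) => // i.
apply: (integral_iid_coord _ msq) => [x|]; first exact: expR_ge0.
rewrite (eq_integral (fun x : T => (expR (c * x ^+ 2 + 0 * x))%:E)); last first.
  by move=> x _; rewrite mul0r addr0.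
rewrite integral_normal_exp ?oner_eq0//; last by rewrite expr1n mulr1.
by rewrite expr1n !mulr1 expr0n/= mul0r expR0 mulr1 lee_fin inv_sqrt_le_expR.
Qed.

Lemma escore_shift (J : choices) b :
  (\int[P]_w (escore b (J b) (spikes predT J) w)%:E <=
   (expR g)%:E * \int[P]_w (escore b (J b) (spikes (predC1 b) J) w)%:E + eps%:E)%E.
Proof.
have e0 l be w : (0 <= (escore b l be w)%:E)%E.
  by rewrite lee_fin; case/andP: (escore01 b l be w).
have me l be : measurable_fun setT (fun w => (escore b l be w)%:E).
  by apply/measurable_EFinP; exact: measurable_escore.
rewrite /design_noise_prob !fubini_tonelli1// /fubini_F.
pose N := iid_prob (normal_prob 0 sigma) n.
pose D := iid_prob (iid_prob (normal_prob (0 : R) 1) p) n.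
pose F X := (\int[N]_z (escore b (J b) (spikes (predC1 b) J) (X, z))%:E)%E.
have mF : measurable_fun setT F by exact: (measurable_integral_snd N (me (J b) (spikes (predC1 b) J))).
have F0 X : (0 <= F X)%E by exact: integral_ge0.
pose G (X : design) := expR (- (th * g) + (th + th ^+ 2) * (\sum_(i < n) (mu * tnth (tnth X i) (pos (b, J b))) ^+ 2) /
         (2 * sigma ^+ 2)).
apply: (@le_trans _ _ (\int[D]_X ((expR g)%:E * F X + (G X)%:E))%E).
  apply: ge0_le_integralT => X; first exact: integral_ge0.
  pose f z := escore b (J b) (spikes (predC1 b) J) (X, z).
  rewrite (eq_integral (fun z : sample => (f [tuple tnth z i + mu * tnth (tnth X i) (pos (b, J b)) | i < n])%:E)).
    apply: integral_iid_normal_shift_le => //; first by rewrite gt_eqF.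
      exact: (measurableT_comp (measurable_escore _ _ _)).
    by move=> z; exact: escore01.
  by move=> z _; rewrite /f /escore/= (response_spikes J b).
rewrite ge0_integralD//; last 4 first.
- by move=> X _; rewrite mule_ge0// lee_fin expR_ge0.
- exact: measurable_funeM.
- by move=> X _; rewrite lee_fin expR_ge0.
- apply/measurable_EFinP; apply: measurableT_comp => //; apply: measurable_funD => //.
  apply: measurable_funM => //; apply: measurable_funM => //; apply: measurable_sum => i.
  apply: measurable_funX; apply: measurable_funM => //.
  apply: (measurableT_comp (measurable_tnth_fun _)); exact: measurable_tnth.
apply: leeD; last exact: integral_design_column.
by rewrite ge0_integralZl// lee_fin expR_ge0.
Qed.

(** The loss is at least mu^2 times the number of spikes not guessed. Averaged over a uniform [J],
    the score of the true position is at most e^g / m + eps: by [escore_shift] it is compared with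
    the model lacking that spike, where the true position is a blind guess. *)
Lemma bayes_lower_bound (S : R) :
  (forall J, (risk sigma bhat (spikes predT J) <= S%:E)%E) ->
  k%:R * mu ^+ 2 * (1 - expR g / m%:R - eps) <= S.
Proof.
move=> riskS.
pose h b (J : choices) l := fine (\int[P]_w (escore b l (spikes (predC1 b) J) w)%:E)%E.
pose h' b (J : choices) := fine (\int[P]_w (escore b (J b) (spikes predT J) w)%:E)%E.
have hE b J l : (\int[P]_w (escore b l (spikes (predC1 b) J) w)%:E = (h b J l)%:E)%E.
  by apply: fine_integral01 => w; exact: escore01.
have h'E b (J : choices) : (\int[P]_w (escore b (J b) (spikes predT J) w)%:E = (h' b J)%:E)%E.
  by apply: fine_integral01 => w; exact: escore01.
have hh' b (J : choices) : h' b J <= expR g * h b J (J b) + eps.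
  by rewrite -lee_fin -h'E EFinD EFinM -hE escore_shift.
have sumh b J : \sum_l h b J l <= 1.
  rewrite -lee_fin -sumEFin; under eq_bigr => l _ do rewrite -hE.
  rewrite -ge0_integral_sumT; last 2 first.
  - by move=> l; exact: measurable_escore.
  - by move=> l w; case/andP: (escore01 b l (spikes (predC1 b) J) w).
  apply: ge0_integral_le_cst => w; rewrite lee_fin.
    by apply: sumr_ge0 => l _; exact: score_ge0.
  exact: score_sum_le1.
(* [h b J] is computed without the spike of block b, hence does not depend on [J b]. *)
have sumJ (b : 'I_k) : m%:R * \sum_(J : choices) h b J (J b) <= #|{: choices}|%:R.
  apply: (@sum_ffun_coord_le R k m b (h b) _ (sumh b)) => J J' l JJ.
  by rewrite /h (spikes_indep JJ).
have main (J : choices) : k%:R * mu ^+ 2 <= S + mu ^+ 2 * \sum_b h' b J.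
  rewrite -lee_fin.
  apply: (@le_trans _ _ (\int[P]_w (k%:R * mu ^+ 2)%:E)%E).
    by rewrite integral_prob_cst.
  apply: (@le_trans _ _ (\int[P]_w (l2norm (tuple_sub (bhat (response (spikes predT J) w.1 w.2, w.1))
     (spikes predT J)) ^+ 2 + \sum_b mu ^+ 2 * escore b (J b) (spikes predT J) w)%:E)%E).
    apply: ge0_le_integralT => w; first by rewrite lee_fin mulr_ge0// sqr_ge0.
    by rewrite lee_fin loss_escore.
  rewrite ge0_integralDT; last 4 first.
  - apply: measurable_loss; last exact: measurable_cst.
    apply: (measurableT_comp mbhat); apply: measurable_fun_pair => //.
    by apply: measurable_response => //; exact: measurable_cst.
  - by move=> w; exact: sqr_ge0.
  - apply: measurable_sum => b; apply: measurable_funM => //.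
    exact: measurable_escore.
  - move=> w; apply: sumr_ge0 => b _; rewrite mulr_ge0 ?sqr_ge0//.
    exact: score_ge0.
  rewrite EFinD; apply: leeD; first by rewrite -riskE.
  rewrite ge0_integral_sumT; last 2 first.
  - move=> b; apply: measurable_funM => //; exact: measurable_escore.
  - by move=> b w; rewrite mulr_ge0 ?sqr_ge0//; exact: score_ge0.
  rewrite mulr_sumr -sumEFin; apply: lee_sum => b _.
  rewrite ge0_integralZlT ?sqr_ge0//; last 2 first.
  - exact: measurable_escore.
  - by move=> w; exact: score_ge0.
  by rewrite h'E.
set M : R := #|{: choices}|%:R.
have M0 : 0 < M.
  by rewrite ltr0n; apply/card_gt0P; exists [ffun => Ordinal m0].
have mR : 0 < m%:R :> R by rewrite ltr0n.
have sc (x : R) : \sum_(J : choices) x = M * x by rewrite /M mulr_natl sumr_const.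
have total : M * (k%:R * mu ^+ 2) <= M * S + mu ^+ 2 * (k%:R * (expR g * (M / m%:R) + M * eps)).
  apply: (@le_trans _ _ (\sum_(J : choices) (S + mu ^+ 2 * \sum_b h' b J))).
    by rewrite -sc; apply: ler_sum => J _; exact: main.
  rewrite big_split/= sc lerD2l -mulr_sumr ler_wpM2l ?sqr_ge0//.
  rewrite exchange_big/= -[k in leRHS]card_ord mulr_natl -sumr_const.
  apply: ler_sum => b _.
  apply: (@le_trans _ _ (\sum_(J : choices) (expR g * h b J (J b) + eps))).
    by apply: ler_sum => J _; exact: hh'.
  rewrite big_split/= sc lerD2r -mulr_sumr ler_wpM2l ?expR_ge0//.
  by rewrite ler_pdivlMr// mulrC; exact: sumJ.
rewrite -(ler_pM2l M0); move: total; rewrite -lerBlDr.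
apply: le_trans; rewrite le_eqVlt; apply/orP; left; apply/eqP.
by field; rewrite gt_eqF.
Qed.

End bayes_risk.

Section minimax_lower_bound.
Context (R : realType).

(** The risk at 0 is nonnegative, so a supremum other than +oo is real; the infinite case makes a
    lower bound trivial. *)
Lemma sum_sup_risk_fin n p k (sigma : R) bhat (S : \bar R) :
  S = ereal_sup [set risk sigma bhat beta | beta in @sparse_vectors R p k] ->
  S != +oo%E -> exists2 s : R, S = s%:E &
    forall beta, sparse_vectors k beta -> (@risk R n p sigma bhat beta <= s%:E)%E.
Proof.
move=> SE Sy.
have S0 : (0 <= S)%E.
  rewrite SE; apply: le_ereal_sup_tmp.
  exists (risk sigma bhat [tuple 0 : measurableTypeR R | j < p]).
    exists [tuple 0 : measurableTypeR R | j < p] => //.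
    rewrite /sparse_vectors/= /l0norm eq_card0// => j.
    by rewrite inE tnth_mktuple eqxx.
  exact: risk_ge0.
have Sfin : S = (fine S)%:E by rewrite fineK// ge0_fin_numE// lt_neqAle Sy leey.
exists (fine S) => // beta hb; rewrite -Sfin SE; apply: ereal_sup_ubound.
by exists beta.
Qed.

(** The spikes carry energy k mu^2 = (1 - d) times 2 sigma^2 k L / n, and a fraction at least 1 - d
    of it is lost; (1 - d)^2 >= 1 - 2 d gives the factor 2 - 4 d. *)
Lemma minimax_risk_ge (d sigma : R) (n p k : nat) (L := ln (p%:R / k%:R) : R) :
  0 < sigma -> 0 < d <= 1 / 2 -> (0 < n)%N -> (0 < k)%N ->
  2 <= p%:R / k%:R :> R ->
  2 * expR (- (d / 4 * L)) <= d / 2 ->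
  expR (- (d ^+ 2 / 16 * L)) <= d / 2 ->
  L / n%:R <= d / 8 ->
  (((2 - 4 * d) * sigma ^+ 2 * k%:R * L / n%:R)%:E <= minimax_risk n p sigma k)%E.
Proof.
move=> s0 /andP[d0 d2] n0 k0 pk2 e1 e2 Ln.
have nR : 0 < n%:R :> R by rewrite ltr0n.
have kR : 0 < k%:R :> R by rewrite ltr0n.
have pk0 : 0 < p%:R / k%:R :> R by lra.
have L0 : 0 < L by rewrite /L ln_gt0//; lra.
pose m := (p %/ k)%N.
have mk : (k * m <= p)%N by rewrite mulnC leq_trunc_div.
have mpk : p%:R / k%:R <= 2 * m%:R :> R.
  have : p%:R / k%:R <= m%:R + 1 :> R.
    by rewrite natr1 ler_pdivrMr// -natrM ler_nat ltnW// ltn_ceil.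
  have m1 : 1 <= m%:R :> R.
    rewrite ler1n divn_gt0// -(ler_nat R).
    by move: pk2; rewrite ler_pdivlMr//; lra.
  lra.
have m0 : (0 < m)%N by rewrite -(ltr_nat R); lra.
have mR : 0 < m%:R :> R by rewrite ltr0n.
have pos_lt (x : 'I_k * 'I_m) : (x.1 * m + x.2 < p)%N.
  apply: leq_trans mk; apply: (@leq_trans (x.1 * m + m)).
    by rewrite ltn_add2l.
  by rewrite -mulSnr leq_mul2r ltn_ord orbT.
pose pos x : 'I_p := Ordinal (pos_lt x).
have pos_inj : injective pos.
  move=> [b l] [b' l'] /(congr1 val)/= E.
  have Eb : b = b' :> nat.
    by have := congr1 (fun x => x %/ m)%N E; rewrite !divnMDl// !divn_small// !addn0.
  have El : l = l' :> nat by move: E; rewrite Eb => /addnI.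
  by congr pair; exact: val_inj.
pose mu := Num.sqrt (2 * (1 - d) * sigma ^+ 2 * L / n%:R).
have mu2 : mu ^+ 2 = 2 * (1 - d) * sigma ^+ 2 * L / n%:R.
  rewrite sqr_sqrtr//; apply: divr_ge0; last exact: ltW.
  apply: mulr_ge0; last exact: ltW.
  by apply: mulr_ge0; [lra|exact: sqr_ge0].
have mu0 : 0 < mu.
  rewrite sqrtr_gt0 divr_gt0// !mulr_gt0//; lra.
(* With the spike present the log-likelihood ratio is centred near n mu^2 / (2 sigma^2) = (1 - d) L.
   The threshold [g] lies between this value and L, so overshoots are rare while e^g is still small
   against m. This [th] makes the overshoot exponent at most - d^2 L / 16. *)
pose th := d / 2; have th0 : 0 < th by rewrite /th; lra.
pose g := (1 - d / 4) * L.
pose c := (th + th ^+ 2) * mu ^+ 2 / (2 * sigma ^+ 2).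
have cE : c = (th + th ^+ 2) * (1 - d) * (L / n%:R).
  by rewrite /c mu2; field; rewrite !gt_eqF.
have Ln0 : 0 < L / n%:R by rewrite divr_gt0.
have c0 : 0 <= c.
  rewrite cE; apply: mulr_ge0; last exact: ltW.
  by apply: mulr_ge0; [rewrite addr_ge0 ?sqr_ge0// ltW|lra].
have c2 : 2 * c <= d / 8.
  apply: le_trans Ln; rewrite cE mulrA ger_pMl//.
  rewrite /th; nra.
have c2' : 2 * c < 1 by lra.
have eps_le : expR (- (th * g) + n%:R * (c / (1 - 2 * c))) <= d / 2.
  apply: le_trans e2; rewrite ler_expR.
  have -> : n%:R * (c / (1 - 2 * c)) = L * (((th + th ^+ 2) * (1 - d)) / (1 - 2 * c)).
    rewrite {1}cE; field; rewrite gt_eqF//=; lra.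
  suff : (th + th ^+ 2) * (1 - d) / (1 - 2 * c) <= th * (1 - 3 * d / 8).
    move=> H; have := ler_wpM2l (ltW L0) H; rewrite /g /th; nra.
  rewrite ler_pdivrMr; last lra.
  have -> : th + th ^+ 2 = th * (1 + th) by ring.
  rewrite -[leLHS]mulrA -[leRHS]mulrA ler_wpM2l ?(ltW th0)// /th.
  have : (1 - 3 * d / 8) * (1 - d / 8) <= (1 - 3 * d / 8) * (1 - 2 * c).
    by rewrite ler_wpM2l//; lra.
  nra.
have gm : expR g / m%:R <= d / 2.
  apply: le_trans e1; rewrite ler_pdivrMr//.
  have -> : expR g = p%:R / k%:R * expR (- (d / 4 * L)).
    have <- : expR L = p%:R / k%:R by rewrite /L lnK// posrE.
    by rewrite -expRD /g; congr expR; ring.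
  by rewrite [leRHS]mulrAC ler_wpM2r ?expR_ge0//.
apply/ereal_infP => _ [bhat mbhat <-].
set S := ereal_sup _.
have [->|Sy] := eqVneq S +oo%E; first exact: leey.
have [s Ss hs] := sum_sup_risk_fin (erefl S) Sy.
rewrite Ss lee_fin.
have := @bayes_lower_bound R n p k m sigma mu g th pos pos_inj s0 mu0 th0 m0 bhat mbhat c2' s.
move=> /(_ (fun J => hs _ (spikes_sparse _ _ _))).
apply: le_trans.
set e := expR (_ + _) in eps_le *; set f := expR g / _ in gm *.
rewrite mu2.
have K0 : 0 <= k%:R * (sigma ^+ 2 * L / n%:R).
  by rewrite mulr_ge0// divr_ge0 ?mulr_ge0 ?sqr_ge0// ltW.
have : (1 - d) * (1 - d) <= (1 - d) * (1 - f - e) by rewrite ler_wpM2l//; lra.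
have -> : (2 - 4 * d) * sigma ^+ 2 * k%:R * L / n%:R = (2 - 4 * d) * (k%:R * (sigma ^+ 2 * L / n%:R)) by field; rewrite gt_eqF.
have -> : k%:R * (2 * (1 - d) * sigma ^+ 2 * L / n%:R) * (1 - f - e) =
   (2 * ((1 - d) * (1 - f - e))) * (k%:R * (sigma ^+ 2 * L / n%:R)) by field; rewrite gt_eqF.
move=> H; rewrite ler_wpM2r//; nra.
Qed.

End minimax_lower_bound.

(** * Exponential moments of a Gaussian row *)

Section rows.
Context (R : realType).
Local Notation T := (measurableTypeR R).
Local Notation N01 p := (iid_prob (normal_prob (0 : R) 1) p).

Definition dot p (x d : 'I_p -> R) : R := \sum_(j < p) x j * d j.

Lemma measurable_dot p d0 (T0 : measurableType d0) (x d : 'I_p -> T0 -> R) :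
  (forall j, measurable_fun setT (x j)) -> (forall j, measurable_fun setT (d j)) ->
  measurable_fun setT (fun w => dot (x ^~ w) (d ^~ w)).
Proof. by move=> mx md; apply: measurable_sum => j; exact: measurable_funM. Qed.

Lemma measurable_dot_tnth p (d : 'I_p -> R) :
  measurable_fun setT (fun x : p.-tuple T => dot (tnth x) d).
Proof.
apply: (measurable_dot (x := fun j x => tnth x j)) => j //.
exact: measurable_tnth_fun.
Qed.

Lemma inv_sqrtM (x y e : R) : 0 < x ->
  (Num.sqrt x)^-1 * ((Num.sqrt y)^-1 * e) = (Num.sqrt (x * y))^-1 * e.
Proof. by move=> x0; rewrite sqrtrM ?ltW// invfM mulrA. Qed.

Lemma integral_normal_expR_sqr (s c a z : R) : s != 0 -> 0 < 1 + 2 * c * (a * s) ^+ 2 ->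
  (\int[normal_prob 0 s]_x (expR (- c * (x * a + z) ^+ 2))%:E =
   ((Num.sqrt (1 + 2 * c * (a * s) ^+ 2))^-1 *
    expR (- (c / (1 + 2 * c * (a * s) ^+ 2)) * z ^+ 2))%:E)%E.
Proof.
move=> s0 c0.
rewrite (eq_integral (fun x : T => (expR (- c * z ^+ 2) *
   expR ((- c * a ^+ 2) * x ^+ 2 + (- 2 * c * a * z) * x))%:E)); last first.
  by move=> x _; rewrite -expRD; congr (expR _)%:E; ring.
rewrite ge0_integralZlT ?expR_ge0//; last first.
  apply: measurableT_comp => //; apply: measurable_funD; apply: measurable_funM => //.
have E : 1 - 2 * (- c * a ^+ 2) * s ^+ 2 = 1 + 2 * c * (a * s) ^+ 2 by ring.
rewrite integral_normal_exp//; last by rewrite -subr_gt0 E.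
rewrite E -EFinM mulrCA -expRD; congr (_ * expR _)%:E.
by field; rewrite gt_eqF.
Qed.

(** The scalar product has law N(0, |d|^2). Coordinates are integrated one at a time: the maps c ->
    c / (1 + 2 c v) compose by adding the variances v, and the prefactors multiply. Both signs of
    [c] occur later. *)
Lemma integral_normal_expR_dot_sqr p (d : 'I_p -> R) (c z : R) :
  0 < 1 + 2 * c * dot d d ->
  (\int[N01 p]_x (expR (- c * (dot (tnth x) d + z) ^+ 2))%:E =
   ((Num.sqrt (1 + 2 * c * dot d d))^-1 *
    expR (- (c / (1 + 2 * c * dot d d)) * z ^+ 2))%:E)%E.
Proof.
have mE m (d' : 'I_m -> R) y : measurable_fun setT (fun x : m.-tuple T =>
    expR (- c * (dot (tnth x) d' + y) ^+ 2)).
  apply: measurableT_comp => //; apply: measurable_funM => //; apply: measurable_funX.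
  by apply: measurable_funD => //; exact: measurable_dot_tnth.
elim: p d z => [|p IHp] d z c0.
  rewrite integral_iid0; last by apply/measurable_EFinP; exact: mE.
  by rewrite /dot !big_ord0 !mulr0 !addr0 sqrtr1 invr1 mul1r mulr1 add0r.
rewrite integral_iidS; last 2 first.
- by apply/measurable_EFinP; exact: mE.
- by move=> t; rewrite lee_fin expR_ge0.
pose d' i := d (lift ord0 i).
have dE : dot d d = d ord0 ^+ 2 + dot d' d' by rewrite /dot big_ord_recl expr2.
have d'0 : 0 <= dot d' d' by apply: sumr_ge0 => i _; rewrite -expr2 sqr_ge0.
have c0' : 0 < 1 + 2 * c * dot d' d'.
  have [c1|c1] := leP 0 c; first by rewrite ltr_pwDl// !mulr_ge0.
  apply: lt_le_trans c0 _; rewrite lerD2l dE.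
  have : 0 <= d ord0 ^+ 2 by exact: sqr_ge0.
  nra.
have c0'' : 0 < 1 + 2 * (c / (1 + 2 * c * dot d' d')) * (d ord0 * 1) ^+ 2.
  have -> : 1 + 2 * (c / (1 + 2 * c * dot d' d')) * (d ord0 * 1) ^+ 2 =
      (1 + 2 * c * dot d d) / (1 + 2 * c * dot d' d').
    by rewrite dE; field; rewrite gt_eqF.
  by rewrite divr_gt0.
transitivity (\int[normal_prob 0 1]_x ((Num.sqrt (1 + 2 * c * dot d' d'))^-1 *
    expR (- (c / (1 + 2 * c * dot d' d')) * (x * d ord0 + z) ^+ 2))%:E)%E.
  apply: eq_integral => x _; rewrite -IHp//; apply: eq_integral => t _.
  congr (expR (_ * (_ ^+ 2)))%:E; rewrite /dot big_ord_recl.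
  rewrite [LHS]addrAC [RHS]addrC; congr (_ + _); apply: eq_bigr => i _.
  by rewrite /tuple_cons/= tnthS.
rewrite ge0_integralZlT ?invr_ge0 ?sqrtr_ge0//; last first.
  apply: measurableT_comp => //; apply: measurable_funM => //; apply: measurable_funX.
  by apply: measurable_funD => //; apply: measurable_funM.
rewrite integral_normal_expR_sqr ?oner_eq0// -EFinM inv_sqrtM//.
have E : (1 + 2 * c * dot d' d') * (1 + 2 * (c / (1 + 2 * c * dot d' d')) * (d ord0 * 1) ^+ 2) =
   1 + 2 * c * dot d d.
  by rewrite dE; field; rewrite gt_eqF.
have E2 : c / (1 + 2 * c * dot d' d') /
    (1 + 2 * (c / (1 + 2 * c * dot d' d')) * (d ord0 * 1) ^+ 2) =
    c / (1 + 2 * c * dot d d) by rewrite -mulrA -invfM E.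
by rewrite E E2.
Qed.

(* Law of one row [(x_i, z_i)] of the regression. *)
Definition row_prob (sigma : R) p : probability (p.-tuple T * T)%type R :=
  (N01 p \x normal_prob 0 sigma)%E.

Lemma measurable_dot_row p (d : 'I_p -> R) :
  measurable_fun setT (fun w : p.-tuple T * T => dot (tnth w.1) d + w.2).
Proof.
apply: measurable_funD => //.
exact: (measurableT_comp (measurable_dot_tnth d)).
Qed.

Lemma integral_row_expR_sqr (sigma : R) p (d : 'I_p -> R) (c : R) :
  sigma != 0 -> 0 < 1 + 2 * c * (dot d d + sigma ^+ 2) ->
  (\int[row_prob sigma p]_w (expR (- c * (dot (tnth w.1) d + w.2) ^+ 2))%:E =
   ((Num.sqrt (1 + 2 * c * (dot d d + sigma ^+ 2)))^-1)%:E)%E.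
Proof.
move=> s0 c0.
have d0 : 0 <= dot d d by apply: sumr_ge0 => i _; rewrite -expr2 sqr_ge0.
have s2 : 0 <= sigma ^+ 2 by exact: sqr_ge0.
have c0' : 0 < 1 + 2 * c * dot d d.
  have [c1|c1] := leP 0 c; first by rewrite ltr_pwDl// !mulr_ge0.
  by apply: lt_le_trans c0 _; rewrite lerD2l; nra.
rewrite (fubini_tonelli2 (fun w : p.-tuple T * T => (expR (- c * (dot (tnth w.1) d + w.2) ^+ 2))%:E)); last 2 first.
- apply/measurable_EFinP; apply: measurableT_comp => //; apply: measurable_funM => //.
  by apply: measurable_funX; exact: measurable_dot_row.
- by move=> w; rewrite lee_fin expR_ge0.
rewrite /fubini_G.
transitivity (\int[normal_prob 0 sigma]_z ((Num.sqrt (1 + 2 * c * dot d d))^-1 *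
    expR (- (c / (1 + 2 * c * dot d d)) * (z * 1 + 0) ^+ 2))%:E)%E.
  by apply: eq_integral => z _; rewrite mulr1 addr0; exact: integral_normal_expR_dot_sqr.
rewrite ge0_integralZlT ?invr_ge0 ?sqrtr_ge0//; last first.
  apply: measurableT_comp => //; apply: measurable_funM => //; apply: measurable_funX.
  by apply: measurable_funD => //; apply: measurable_funM.
have E : (1 + 2 * c * dot d d) * (1 + 2 * (c / (1 + 2 * c * dot d d)) * (1 * sigma) ^+ 2) =
   1 + 2 * c * (dot d d + sigma ^+ 2).
  by field; rewrite gt_eqF.
rewrite integral_normal_expR_sqr//; last first.
  by rewrite -(pmulr_rgt0 _ c0') E.
by rewrite -EFinM inv_sqrtM// E expr0n/= mulr0 expR0 mulr1.
Qed.

Lemma integral_normal_expR_lin (s b : R) : s != 0 ->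
  (\int[normal_prob 0 s]_x (expR (b * x))%:E = (expR (b ^+ 2 * s ^+ 2 / 2))%:E)%E.
Proof.
move=> s0; rewrite (eq_integral (fun x : T => (expR (0 * x ^+ 2 + b * x))%:E)); last first.
  by move=> x _; rewrite mul0r add0r.
rewrite integral_normal_exp//; last by rewrite mulr0 mul0r ltr01.
by rewrite mulr0 mul0r subr0 sqrtr1 invr1 mul1r mulr1.
Qed.

(** Given x_j, the rest of the scalar product is N(0, |h|^2 - h_j^2), so its exponential moment is
    again a quadratic exponential in x_j. The term in [al] collects the contributions of the
    coordinates already integrated. *)
Lemma integral_normal_expR_bilin p (j : 'I_p) (h : 'I_p -> R) (al a : R) :
  (\int[N01 p]_x (expR (al * tnth x j ^+ 2 + a * (tnth x j * dot (tnth x) h)))%:E <=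
   \int[normal_prob 0 1]_x
     (expR ((al + a * h j + a ^+ 2 * (dot h h - h j ^+ 2) / 2) * x ^+ 2))%:E)%E.
Proof.
have mE m (j' : 'I_m) (h' : 'I_m -> R) be : measurable_fun setT (fun x : m.-tuple T =>
    expR (be * tnth x j' ^+ 2 + a * (tnth x j' * dot (tnth x) h'))).
  apply: measurableT_comp => //; apply: measurable_funD; apply: measurable_funM => //.
    apply: measurable_funX; exact: measurable_tnth_fun.
  by apply: measurable_funM; [exact: measurable_tnth_fun|exact: measurable_dot_tnth].
elim: p j h al => [[]//|p IHp] j h al.
rewrite integral_iidS; last 2 first.
- by apply/measurable_EFinP; exact: mE.
- by move=> t; rewrite lee_fin expR_ge0.
pose h' i := h (lift ord0 i).
have hE : dot h h = h ord0 ^+ 2 + dot h' h' by rewrite /dot big_ord_recl expr2.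
have dotE x (t : p.-tuple T) : dot (tnth (tuple_cons (x, t))) h = x * h ord0 + dot (tnth t) h'.
  rewrite /dot big_ord_recl; congr (_ + _); apply: eq_bigr => i _.
  by rewrite /tuple_cons/= tnthS.
case: (unliftP ord0 j) => [j' ->|->].
  rewrite (fubini_tonelli (fun w : T * p.-tuple T => (expR
     (al * tnth (tuple_cons w) (lift ord0 j') ^+ 2 +
      a * (tnth (tuple_cons w) (lift ord0 j') * dot (tnth (tuple_cons w)) h)))%:E)); last 2 first.
  - apply/measurable_EFinP; apply: (measurableT_comp (mE p.+1 (lift ord0 j') h al)).
    exact: measurable_funP.
  - by move=> w; rewrite lee_fin expR_ge0.
  have -> : al + a * h (lift ord0 j') + a ^+ 2 * (dot h h - h (lift ord0 j') ^+ 2) / 2 =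
      (al + a ^+ 2 * h ord0 ^+ 2 / 2) + a * h' j' + a ^+ 2 * (dot h' h' - h' j' ^+ 2) / 2.
    by rewrite hE /h'; field.
  apply: le_trans (IHp j' h' (al + a ^+ 2 * h ord0 ^+ 2 / 2)).
  apply: ge0_le_integralT => t.
    by apply: integral_ge0 => x _; rewrite lee_fin expR_ge0.
  rewrite (eq_integral (fun x : T => (expR (al * tnth t j' ^+ 2 + a * (tnth t j' * dot (tnth t) h')) *
     expR ((a * tnth t j' * h ord0) * x))%:E)); last first.
    move=> x _; rewrite -expRD dotE {1 2}/tuple_cons/= tnthS; congr (expR _)%:E.
    by ring.
  rewrite ge0_integralZlT ?expR_ge0//; last first.
    by apply: measurableT_comp => //; apply: measurable_funM.
  rewrite integral_normal_expR_lin ?oner_eq0// -EFinM -expRD lee_fin ler_expR.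
  by rewrite le_eqVlt; apply/orP; left; apply/eqP; field.
apply: ge0_le_integralT => x.
  by apply: integral_ge0 => t _; rewrite lee_fin expR_ge0.
rewrite (eq_integral (fun t : p.-tuple T => (expR ((al + a * h ord0) * x ^+ 2) *
   \prod_(i < p) expR ((a * x * h' i) * tnth t i))%:E)); last first.
  move=> t _; rewrite -expR_sum -expRD dotE (_ : tnth (tuple_cons (x, t)) ord0 = x)//.
  congr (expR _)%:E.
  have -> : \sum_i a * x * h' i * tnth t i = a * x * dot (tnth t) h'.
    by rewrite /dot mulr_sumr; apply: eq_bigr => i _; ring.
  by ring.
rewrite ge0_integralZlT ?expR_ge0//; last 2 first.
- apply: measurable_prod => i _; apply: measurableT_comp => //.
  by apply: measurable_funM => //; exact: measurable_tnth_fun.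
- by move=> t; apply: prodr_ge0 => i _; exact: expR_ge0.
have -> : expR ((al + a * h ord0 + a ^+ 2 * (dot h h - h ord0 ^+ 2) / 2) * x ^+ 2) =
    expR ((al + a * h ord0) * x ^+ 2) * \prod_(i < p) expR ((a * x * h' i) ^+ 2 / 2).
  rewrite -expR_sum -expRD hE; congr expR.
  have -> : \sum_i (a * x * h' i) ^+ 2 / 2 = (a * x) ^+ 2 / 2 * dot h' h'.
    by rewrite /dot mulr_sumr; apply: eq_bigr => i _; field.
  by field.
rewrite EFinM lee_wpmul2l ?lee_fin ?expR_ge0//.
apply: (@integral_iid_prod R _ _ (normal_prob (0 : R) 1) p
  (fun i (y : T) => expR ((a * x * h' i) * y)) (fun i => expR ((a * x * h' i) ^+ 2 / 2))).
- by move=> i; apply: measurableT_comp => //; apply: measurable_funM.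
- by move=> i y; exact: expR_ge0.
- by move=> i; rewrite integral_normal_expR_lin ?oner_eq0// expr1n mulr1.
Qed.

(* Moment generating function of the centred summand of the debiased
   estimator of coordinate [j], when the current error is [h]. *)
Lemma integral_row_bilin_le (sigma : R) p (j : 'I_p) (h : 'I_p -> R) (a : R) :
  sigma != 0 -> a ^+ 2 * (sigma ^+ 2 + dot h h) <= 1 / 64 ->
  (\int[row_prob sigma p]_w
     (expR (a * (tnth w.1 j * (dot (tnth w.1) h + w.2) - h j)))%:E <=
   (expR (a ^+ 2 * (sigma ^+ 2 / 2 + 9 * dot h h +
      2 * a ^+ 2 * (sigma ^+ 2 + dot h h) ^+ 2)))%:E)%E.
Proof.
move=> s0 a64; set H := dot h h in a64 *.
have hj : h j ^+ 2 <= H.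
  by rewrite /H /dot (bigD1 j)//= -expr2 lerDl sumr_ge0// => i _; rewrite -expr2 sqr_ge0.
have mw : measurable_fun setT (fun w : p.-tuple T * T =>
     expR (a * (tnth w.1 j * (dot (tnth w.1) h + w.2) - h j))).
  apply: measurableT_comp => //; apply: measurable_funM => //; apply: measurable_funB => //.
  apply: measurable_funM; last exact: measurable_dot_row.
  exact: (measurableT_comp (measurable_tnth_fun j)).
rewrite (fubini_tonelli1 (fun w : p.-tuple T * T =>
   (expR (a * (tnth w.1 j * (dot (tnth w.1) h + w.2) - h j)))%:E)); last 2 first.
- exact/measurable_EFinP.
- by move=> w; rewrite lee_fin expR_ge0.
rewrite /fubini_F.
apply: (@le_trans _ _ (\int[N01 p]_x ((expR (- (a * h j)))%:E * (expR ((a ^+ 2 * sigma ^+ 2 / 2) * tnth x j ^+ 2 + a * (tnth x j * dot (tnth x) h)))%:E)))%E.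
  apply: ge0_le_integralT => x.
    by apply: integral_ge0 => t _; rewrite lee_fin expR_ge0.
  rewrite (eq_integral (fun z : T => (expR (- (a * h j) + a * (tnth x j * dot (tnth x) h)) *
     expR ((a * tnth x j) * z))%:E)); last first.
    by move=> z _; rewrite -expRD; congr (expR _)%:E => /=; ring.
  rewrite ge0_integralZlT ?expR_ge0//; last first.
    by apply: measurableT_comp => //; apply: measurable_funM.
  rewrite integral_normal_expR_lin// -!EFinM -!expRD lee_fin ler_expR.
  by rewrite le_eqVlt; apply/orP; left; apply/eqP; field.
rewrite ge0_integralZl// ?lee_fin ?expR_ge0//; last first.
  apply/measurable_EFinP; apply: measurableT_comp => //; apply: measurable_funD; apply: measurable_funM => //.
    apply: measurable_funX; exact: measurable_tnth_fun.
  by apply: measurable_funM; [exact: measurable_tnth_fun|exact: measurable_dot_tnth].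
(* The coefficient of x_j^2 left after integrating the noise and the other coordinates. As al <= 1 /
   4, (1 - 2 al)^(-1/2) <= exp (al + 4 al^2). *)
set al := a ^+ 2 * sigma ^+ 2 / 2 + a * h j + a ^+ 2 * (H - h j ^+ 2) / 2.
have H0 : 0 <= H by apply: le_trans hj; exact: sqr_ge0.
have s2 : 0 < sigma ^+ 2 by rewrite exprn_even_gt0.
have a2 : 0 <= a ^+ 2 by exact: sqr_ge0.
have ah : (a * h j) ^+ 2 <= 1 / 64.
  rewrite exprMn; apply: le_trans a64; rewrite ler_wpM2l//; lra.
have ah8 : a * h j <= 1 / 8.
  rewrite leNgt; apply/negP => lt8; have : (1 / 8) ^+ 2 < (a * h j) ^+ 2 by rewrite ltr_pXn2r// nnegrE; lra.
  lra.
have al4 : al <= 1 / 4.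
  have : a ^+ 2 * (H - h j ^+ 2) <= a ^+ 2 * H by rewrite ler_wpM2l// gerBl sqr_ge0.
  rewrite /al; lra.
apply: (@le_trans _ _ ((expR (- (a * h j)))%:E * (expR (al + 4 * al ^+ 2))%:E)%E).
  rewrite lee_wpmul2l ?lee_fin ?expR_ge0//.
  apply: le_trans (integral_normal_expR_bilin j h _ a) _.
  rewrite (eq_integral (fun x : T => (expR (al * x ^+ 2 + 0 * x))%:E)); last first.
    by move=> x _; rewrite mul0r addr0.
  rewrite integral_normal_exp ?oner_eq0//; last by rewrite expr1n; lra.
  rewrite expr1n !mulr1 expr0n/= mul0r expR0 mulr1 lee_fin.
  apply: (le_trans (inv_sqrt_le_expR _)); first lra.
  rewrite ler_expR ler_pdivrMr; last lra.
  have -> : (al + 4 * al ^+ 2) * (1 - 2 * al) = al + 2 * al ^+ 2 * (1 - 4 * al) by ring.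
  by rewrite lerDl; apply: mulr_ge0; [rewrite mulr_ge0 ?sqr_ge0//|lra].
rewrite -EFinM -expRD lee_fin ler_expR.
(* The centring cancels the first-order [x]. What remains is y + 4 (x + y)^2 <= y + 8 x^2 + 8 y^2,
   whose leading part is exactly a^2 sigma^2 / 2. *)
set x := a * h j; set y := a ^+ 2 * (sigma ^+ 2 + (H - h j ^+ 2)) / 2.
have -> : al = x + y by rewrite /al /x /y; field.
have y0 : 0 <= y.
  by rewrite /y divr_ge0// mulr_ge0// addr_ge0 ?subr_ge0// ltW.
have yb : y <= a ^+ 2 * (sigma ^+ 2 + H) / 2.
  by rewrite /y ler_pM2r// ler_wpM2l// lerD2l gerBl sqr_ge0.
have y2 : 8 * y ^+ 2 <= 2 * (a ^+ 2 * (sigma ^+ 2 + H)) ^+ 2.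
  have : y ^+ 2 <= (a ^+ 2 * (sigma ^+ 2 + H) / 2) ^+ 2 by rewrite ler_pXn2r// nnegrE; lra.
  by rewrite expr_div_n; lra.
have xy : (x + y) ^+ 2 <= 2 * x ^+ 2 + 2 * y ^+ 2 by have := sqr_ge0 (x - y); nra.
have x2 : x ^+ 2 <= a ^+ 2 * H by rewrite /x exprMn ler_wpM2l.
have yb' : y <= a ^+ 2 * sigma ^+ 2 / 2 + a ^+ 2 * H / 2 by lra.
have -> : a ^+ 2 * (sigma ^+ 2 / 2 + 9 * H + 2 * a ^+ 2 * (sigma ^+ 2 + H) ^+ 2) =
  a ^+ 2 * sigma ^+ 2 / 2 + 9 * (a ^+ 2 * H) + 2 * (a ^+ 2 * (sigma ^+ 2 + H)) ^+ 2 by field.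
have aH : 0 <= a ^+ 2 * H by rewrite mulr_ge0.
lra.
Qed.

End rows.

(** * Debiased soft thresholding *)

Section soft_threshold.
Context (R : realType).

Definition soft (t x : R) : R := Num.max (x - t) 0 + Num.min (x + t) 0.

Lemma measurable_soft t : measurable_fun setT (soft t).
Proof.
apply: measurable_funD.
  by apply: measurable_maxr => //; exact: measurable_funB.
by apply: measurable_minr => //; exact: measurable_funD.
Qed.

Lemma soft0 x : soft 0 x = x.
Proof. by rewrite /soft subr0 addr0 addr_max_min addr0. Qed.

Lemma sqr_le_expR (y : R) : 0 <= y -> y ^+ 2 <= 4 * expR y.
Proof.
move=> y0; have -> : expR y = expR (y / 2) ^+ 2.
  by rewrite expr2 -expRD; congr expR; field.
have : y / 2 <= expR (y / 2).
  by apply: le_trans (expR_ge1Dx _); rewrite lerDr.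
have -> : y ^+ 2 = 4 * (y / 2) ^+ 2 by field.
move=> H; rewrite ler_wpM2l// ler_pXn2r// nnegrE ?expR_ge0//; lra.
Qed.

(** From y^2 <= 4 e^y at y = th (|w| - t): the risk of a null coordinate is thereby controlled by
    the exponential moments of its noise. *)
Lemma soft_sqr_le (t th w : R) : 0 <= t -> 0 < th ->
  soft t w ^+ 2 <= 4 / th ^+ 2 * expR (- (th * t)) * (expR (th * w) + expR (- (th * w))).
Proof.
move=> t0 th0.
have th2 : 0 < th ^+ 2 by rewrite exprn_gt0.
have key y : 0 <= y -> y ^+ 2 <= 4 / th ^+ 2 * expR (th * y).
  move=> y0; rewrite mulrAC ler_pdivlMr// mulrC -exprMn.
  by apply: sqr_le_expR; rewrite mulr_ge0// ltW.
have C0 : 0 <= 4 / th ^+ 2 by rewrite divr_ge0// ltW.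
rewrite /soft; have [wt|tw] := leP (w - t) 0.
  have [w0|w0] := leP (w + t) 0.
    rewrite add0r -sqrrN; have y0 : 0 <= - (w + t) by lra.
    apply: le_trans (key _ y0) _; rewrite -[leRHS]mulrA ler_wpM2l// mulrDr -!expRD.
    rewrite (_ : th * - (w + t) = - (th * t) - th * w); last by ring.
    by rewrite lerDr expR_ge0.
  rewrite addr0 expr0n/=; apply: mulr_ge0; last by rewrite addr_ge0 ?expR_ge0.
  by apply: mulr_ge0 => //; exact: expR_ge0.
have -> : Num.min (w + t) 0 = 0 by apply/min_idPr; lra.
rewrite addr0; apply: le_trans (key _ (ltW tw)) _.
rewrite -[leRHS]mulrA ler_wpM2l// [expR (- _) * _]mulrDr -!expRD.
rewrite (_ : th * (w - t) = - (th * t) + th * w); last by ring.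
by rewrite lerDl expR_ge0.
Qed.

Lemma soft_dist (t x : R) : 0 <= t -> (soft t x - x) ^+ 2 <= t ^+ 2.
Proof.
move=> t0; rewrite -[leRHS]ger0_norm ?sqr_ge0// -[leLHS]ger0_norm ?sqr_ge0//.
rewrite !normrX ler_pXn2r// ?nnegrE ?normr_ge0// [leRHS]ger0_norm//.
rewrite ler_norml /soft.
by case: (leP (x - t) 0) => ?; case: (leP (x + t) 0) => ?; apply/andP; split; lra.
Qed.

(** Soft thresholding moves its argument by at most t. Young's inequality with a small [al] keeps
    the coefficient of t^2 near 1, as the sharp constant requires, at the expense of w^2. *)
Lemma soft_err (al t b w : R) : 0 <= t -> 0 < al ->
  (soft t (b + w) - b) ^+ 2 <= (1 + al) * t ^+ 2 + (1 + al^-1) * w ^+ 2.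
Proof.
move=> t0 al0; have := soft_dist (b + w) t0; set e := soft _ _ - (b + w).
have -> : soft t (b + w) - b = e + w by rewrite /e; ring.
move=> e2.
have H : (e + w) ^+ 2 <= (1 + al) * e ^+ 2 + (1 + al^-1) * w ^+ 2.
  rewrite -subr_ge0.
  have -> : (1 + al) * e ^+ 2 + (1 + al^-1) * w ^+ 2 - (e + w) ^+ 2 = (al * e - w) ^+ 2 / al.
    by field; rewrite gt_eqF.
  by rewrite divr_ge0 ?sqr_ge0// ltW.
apply: le_trans H _; rewrite lerD2r ler_wpM2l//; lra.
Qed.

End soft_threshold.

Section refine.
Context (R : realType) (p n : nat) (sigma : R).
Local Notation T := (measurableTypeR R).
Local Notation coefs := (p.-tuple T).
Local Notation row := (coefs * T)%type.
Local Notation rows := (n.-tuple row).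
Local Notation P := (iid_prob (row_prob sigma p) n).
Hypothesis sigma0 : 0 < sigma.
Hypothesis n0 : (0 < n)%N.

(* [(x_i, z_i)] is mapped to the data [(x_i, y_i)]. *)
Definition observe (beta : 'I_p -> R) (w : row) : row :=
  (w.1, dot (tnth w.1) beta + w.2).

Definition summand (h : 'I_p -> R) j (w : row) : R :=
  tnth w.1 j * (dot (tnth w.1) h + w.2) - h j.

Definition noise (h : 'I_p -> R) j (v : rows) : R :=
  n%:R^-1 * \sum_(i < n) summand h j (tnth v i).

Definition refine (t : R) (bt : coefs) (D : rows) : coefs :=
  [tuple soft t (tnth bt j + n%:R^-1 * \sum_(i < n) tnth (tnth D i).1 j *
     ((tnth D i).2 - dot (tnth (tnth D i).1) (tnth bt))) | j < p].

Lemma dotB (x b c : 'I_p -> R) : dot x (fun j => b j - c j) = dot x b - dot x c.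
Proof. by rewrite /dot -sumrB; apply: eq_bigr => j _; rewrite mulrBr. Qed.

(** Since E x x^T is the identity, adding the averaged product of residual and regressor cancels the
    pilot; its error [h] survives only inside the centred noise. *)
Lemma tnth_refine t bt (beta : 'I_p -> R) (v : rows) j :
  tnth (refine t bt [tuple observe beta (tnth v i) | i < n]) j =
  soft t (beta j + noise (fun j => beta j - tnth bt j) j v).
Proof.
rewrite tnth_mktuple; congr soft.
have nR : n%:R != 0 :> R by rewrite pnatr_eq0 -lt0n.
rewrite /noise /summand big_split/= sumr_const card_ord mulrDr.
rewrite [X in _ = _ + (_ + X)](_ : _ = - (beta j - tnth bt j)); last first.
  by rewrite -(mulr_natl (- (beta j - tnth bt j))) mulrA mulVf// mul1r.
rewrite (eq_bigr (fun i => tnth (tnth v i).1 j *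
   (dot (tnth (tnth v i).1) (fun j => beta j - tnth bt j) + (tnth v i).2))); last first.
  by move=> i _; rewrite tnth_mktuple/= dotB; congr (_ * _); ring.
ring.
Qed.

Lemma measurable_summand h j : measurable_fun setT (summand h j).
Proof.
apply: measurable_funB => //; apply: measurable_funM; last exact: measurable_dot_row.
exact: (measurableT_comp (measurable_tnth_fun j)).
Qed.

Lemma measurable_noise h j : measurable_fun setT (noise h j).
Proof.
apply: measurable_funM => //; apply: measurable_sum => i.
exact: (measurableT_comp (measurable_summand h j) (measurable_tnth i)).
Qed.

Lemma dot_ge0 (h : 'I_p -> R) : 0 <= dot h h.
Proof. by apply: sumr_ge0 => i _; rewrite -expr2 sqr_ge0. Qed.

Lemma integral_expR_noise h j (a : R) : a ^+ 2 * (sigma ^+ 2 + dot h h) <= 1 / 64 ->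
  (\int[P]_v (expR (n%:R * a * noise h j v))%:E <=
   (expR (n%:R * (a ^+ 2 * (sigma ^+ 2 / 2 + 9 * dot h h +
      2 * a ^+ 2 * (sigma ^+ 2 + dot h h) ^+ 2))))%:E)%E.
Proof.
move=> a64; set e := a ^+ 2 * _.
have nR : n%:R != 0 :> R by rewrite pnatr_eq0 -lt0n.
rewrite (eq_integral (fun v : rows => (\prod_(i < n) expR (a * summand h j (tnth v i)))%:E)); last first.
  move=> v _; rewrite -expR_sum -mulr_sumr /noise; congr (expR _)%:E.
  by field.
have -> : expR (n%:R * e) = \prod_(i < n) expR e.
  by rewrite -expR_sum sumr_const card_ord mulr_natl.
apply: (@integral_iid_prod R _ _ (row_prob sigma p) n
  (fun _ (w : row) => expR (a * summand h j w)) (fun _ => expR e)).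
- move=> i; apply: measurableT_comp => //; apply: measurable_funM => //.
  exact: measurable_summand.
- by move=> i w; exact: expR_ge0.
- by move=> i; apply: integral_row_bilin_le => //; rewrite gt_eqF.
Qed.

Lemma integral_soft_noise h j (t a : R) : 0 <= t -> 0 < a ->
  a ^+ 2 * (sigma ^+ 2 + dot h h) <= 1 / 64 ->
  (\int[P]_v (soft t (noise h j v) ^+ 2)%:E <=
   (8 / (n%:R * a) ^+ 2 * expR (- (n%:R * a * t) +
     n%:R * (a ^+ 2 * (sigma ^+ 2 / 2 + 9 * dot h h +
      2 * a ^+ 2 * (sigma ^+ 2 + dot h h) ^+ 2))))%:E)%E.
Proof.
move=> t0 a0 a64; set e := n%:R * (a ^+ 2 * _).
have nR : 0 < n%:R :> R by rewrite ltr0n.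
have th0 : 0 < n%:R * a by rewrite mulr_gt0.
have mexp b : measurable_fun setT (fun v : rows => expR (b * noise h j v)).
  by apply: measurableT_comp => //; apply: measurable_funM => //; exact: measurable_noise.
pose C := 4 / (n%:R * a) ^+ 2 * expR (- (n%:R * a * t)).
have C0 : 0 <= C by rewrite mulr_ge0 ?expR_ge0// divr_ge0// sqr_ge0.
apply: (@le_trans _ _ (\int[P]_v (C * (expR (n%:R * a * noise h j v) +
    expR (n%:R * (- a) * noise h j v)))%:E)%E).
  apply: ge0_le_integralT => v; rewrite lee_fin ?sqr_ge0//.
  by apply: le_trans (soft_sqr_le _ t0 th0) _; rewrite mulrN mulNr.
rewrite ge0_integralZlT//; last first.
- by apply: measurable_funD; exact: mexp.
rewrite ge0_integralDT//.
apply: (@le_trans _ _ (C%:E * ((expR e)%:E + (expR e)%:E))%E).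
  rewrite lee_wpmul2l ?lee_fin//; apply: leeD.
    exact: integral_expR_noise.
  have := @integral_expR_noise h j (- a); rewrite sqrrN => H; exact: H.
rewrite -EFinD -EFinM lee_fin expRD /C le_eqVlt; apply/orP; left; apply/eqP.
by field; rewrite !gt_eqF.
Qed.

Lemma expR_quarter_le : expR (1 / 4) <= 4 / 3 :> R.
Proof.
have := expR_ge1Dx (- (1 / 4) : R); rewrite expRN => H.
have e0 := expR_gt0 (1 / 4 : R).
rewrite -[leLHS]invrK -[leRHS]invrK lef_pV2 ?posrE ?invr_gt0//; lra.
Qed.

(** Thresholding at 0 is the identity, so the exponential bound yields a second moment. Its constant
    is crude but harmless: this term lacks the factor log(p/k) of the leading one. *)
Lemma integral_noise_sqr h j :
  (\int[P]_v (noise h j v ^+ 2)%:E <= (32 ^+ 2 * (sigma ^+ 2 + dot h h) / n%:R)%:E)%E.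
Proof.
set s2 := sigma ^+ 2 + dot h h.
have sg : 0 < sigma ^+ 2 by rewrite exprn_gt0.
have s20 : 0 < s2 by rewrite ltr_pwDl// dot_ge0.
have nR : 0 < n%:R :> R by rewrite ltr0n.
have n1 : 1 <= n%:R :> R by rewrite ler1n.
(* Keeps the total exponent below 1 / 4, and 8 / (n a)^2 = 512 s2 / n; the remaining exponential is
   at most 2. *)
pose a := Num.sqrt ((64 * s2 * n%:R)^-1).
have a2 : a ^+ 2 = (64 * s2 * n%:R)^-1 by rewrite sqr_sqrtr// invr_ge0 !mulr_ge0// ltW.
have a0 : 0 < a by rewrite sqrtr_gt0 invr_gt0 !mulr_gt0.
have as2 : a ^+ 2 * s2 = 1 / 64 / n%:R by rewrite a2; field; rewrite !gt_eqF.
have nV : n%:R^-1 <= 1 :> R by rewrite invf_le1.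
have a64 : a ^+ 2 * s2 <= 1 / 64 by rewrite as2 ler_piMr.
under eq_integral => v _ do rewrite -[X in X ^+ 2]soft0.
apply: le_trans (integral_soft_noise j (lexx 0) a0 a64) _.
rewrite -/s2 mulr0 oppr0 add0r lee_fin.
have -> : 8 / (n%:R * a) ^+ 2 = 32 ^+ 2 / 2 * s2 / n%:R.
  by rewrite exprMn a2; field; rewrite !gt_eqF.
have -> : 32 ^+ 2 * s2 / n%:R = 32 ^+ 2 / 2 * s2 / n%:R * 2 by field; rewrite gt_eqF.
apply: ler_wpM2l.
  by apply: divr_ge0; [apply: mulr_ge0; [lra|exact: ltW]|exact: ltW].
apply: (@le_trans _ _ (expR (1 / 4))); last by have := expR_quarter_le; lra.
rewrite ler_expR.
have -> : a ^+ 2 * (sigma ^+ 2 / 2 + 9 * dot h h + 2 * a ^+ 2 * s2 ^+ 2) =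
   a ^+ 2 * (sigma ^+ 2 / 2 + 9 * dot h h) + 2 * (a ^+ 2 * s2) ^+ 2 by ring.
have H : a ^+ 2 * (sigma ^+ 2 / 2 + 9 * dot h h) <= a ^+ 2 * s2 * 9.
  by rewrite -mulrA ler_wpM2l ?sqr_ge0// /s2; have := dot_ge0 h; lra.
have H2 : (a ^+ 2 * s2) ^+ 2 <= a ^+ 2 * s2 * (1 / 64).
  by rewrite expr2 ler_wpM2l// mulr_ge0 ?sqr_ge0// ltW.
have -> : 1 / 4 = n%:R * (1 / 4 / n%:R) :> R by field; rewrite gt_eqF.
rewrite ler_wpM2l ?(ltW nR)//.
have : 0 <= n%:R^-1 :> R by rewrite invr_ge0 ltW.
rewrite as2 in H H2 *; lra.
Qed.

Definition sqerr (b beta : 'I_p -> R) : R := \sum_(j < p) (b j - beta j) ^+ 2.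

Lemma sqerrE (b beta : 'I_p -> R) :
  sqerr b beta = dot (fun j => beta j - b j) (fun j => beta j - b j).
Proof. by apply: eq_bigr => j _; rewrite -expr2 -sqrrN opprB. Qed.

Lemma measurable_refine_term t h j b :
  measurable_fun setT (fun v : rows => (soft t (b + noise h j v) - b) ^+ 2).
Proof.
apply: measurable_funX; apply: measurable_funB => //.
apply: (measurableT_comp (measurable_soft t)); apply: measurable_funD => //.
exact: measurable_noise.
Qed.

Lemma integral_soft_err h j (al t b : R) : 0 <= t -> 0 < al ->
  (\int[P]_v ((soft t (b + noise h j v) - b) ^+ 2)%:E <=
   ((1 + al) * t ^+ 2 + (1 + al^-1) * (32 ^+ 2 * (sigma ^+ 2 + dot h h) / n%:R))%:E)%E.
Proof.
move=> t0 al0.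
have c1 : 0 <= (1 + al) * t ^+ 2 by rewrite mulr_ge0 ?sqr_ge0//; lra.
have c2 : 0 <= 1 + al^-1 by rewrite addr_ge0// invr_ge0 ltW.
apply: (@le_trans _ _ (\int[P]_v ((1 + al) * t ^+ 2 + (1 + al^-1) * noise h j v ^+ 2)%:E)%E).
  by apply: ge0_le_integralT => v; rewrite lee_fin ?sqr_ge0// soft_err.
have mn2 : measurable_fun setT (fun v => noise h j v ^+ 2).
  by apply: measurable_funX; exact: measurable_noise.
rewrite ge0_integralDT//; [|by apply: measurable_funM|by move=> v; rewrite mulr_ge0 ?sqr_ge0].
rewrite integral_prob_cst EFinD leeD2l//.
rewrite ge0_integralZlT//; last by move=> v; exact: sqr_ge0.
by rewrite EFinM lee_wpmul2l ?lee_fin// integral_noise_sqr.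
Qed.

(** Holds for every pilot and is affine in its squared error; meant for the event where the pilot
    fails. *)
Lemma integral_refine_le t bt (beta : coefs) : 0 <= t ->
  (\int[P]_v (sqerr (tnth (refine t bt [tuple observe (tnth beta) (tnth v i) | i < n])) (tnth beta))%:E <=
   (p%:R * (2 * t ^+ 2 + 2 * 32 ^+ 2 * (sigma ^+ 2 + sqerr (tnth bt) (tnth beta)) / n%:R))%:E)%E.
Proof.
move=> t0; rewrite [sqerr (tnth bt) _]sqerrE; set h := (fun j : 'I_p => tnth beta j - tnth bt j).
under eq_integral => v _.
  rewrite /sqerr; under eq_bigr => j _ do rewrite tnth_refine.
  over.
rewrite ge0_integral_sumT; last 2 first.
- by move=> j; exact: measurable_refine_term.
- by move=> j v; exact: sqr_ge0.
have -> : p%:R * (2 * t ^+ 2 + 2 * 32 ^+ 2 * (sigma ^+ 2 + dot h h) / n%:R) =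
  \sum_(j < p) (2 * t ^+ 2 + 2 * 32 ^+ 2 * (sigma ^+ 2 + dot h h) / n%:R).
  by rewrite sumr_const card_ord mulr_natl.
rewrite -sumEFin; apply: lee_sum => j _.
apply: le_trans (integral_soft_err _ _ _ t0 ltr01) _.
by rewrite lee_fin invr1 -!mulrA; lra.
Qed.

(** The at most k nonzero coordinates cost about t^2 each by [integral_soft_err], the null ones only
    the exponentially small bound of [integral_soft_noise]. *)
Lemma integral_refine_good t bt (beta : coefs) k (al a d : R) :
  0 <= t -> 0 < al -> 0 < a -> 0 < d <= 1 / 10 -> a ^+ 2 * sigma ^+ 2 <= d / 8 ->
  (l0norm beta <= k)%N ->
  sqerr (tnth bt) (tnth beta) <= d * sigma ^+ 2 ->
  (\int[P]_v (sqerr (tnth (refine t bt [tuple observe (tnth beta) (tnth v i) | i < n])) (tnth beta))%:E <=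
   (k%:R * ((1 + al) * t ^+ 2 + (1 + al^-1) * (2 * 32 ^+ 2 * sigma ^+ 2 / n%:R)) +
    p%:R * (8 / (n%:R * a) ^+ 2 * expR (- (n%:R * a * t) +
       n%:R * (a ^+ 2 * sigma ^+ 2 * ((1 + 19 * d) / 2)))))%:E)%E.
Proof.
move=> t0 al0 a0 /andP[d0 d10] ad hk; rewrite sqerrE.
set h := (fun j : 'I_p => tnth beta j - tnth bt j) => hd.
have sg : 0 < sigma ^+ 2 by rewrite exprn_gt0.
have nR : 0 < n%:R :> R by rewrite ltr0n.
have H0 := dot_ge0 h.
under eq_integral => v _.
  rewrite /sqerr; under eq_bigr => j _ do rewrite tnth_refine.
  over.
rewrite ge0_integral_sumT; last 2 first.
- by move=> j; exact: measurable_refine_term.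
- by move=> j v; exact: sqr_ge0.
set A := (1 + al) * _ + _; set B := 8 / _ * _.
have A0 : 0 <= A.
  have e1 : 0 <= al^-1 by rewrite invr_ge0 ltW.
  have e2 : 0 <= sigma ^+ 2 / n%:R by rewrite divr_ge0 ?(ltW sg) ?(ltW nR).
  have e3 : 0 <= t ^+ 2 by exact: sqr_ge0.
  rewrite /A; nra.
have B0 : 0 <= B by rewrite mulr_ge0 ?expR_ge0// divr_ge0 ?sqr_ge0.
have a2 : 0 <= a ^+ 2 by exact: sqr_ge0.
have a64 : a ^+ 2 * (sigma ^+ 2 + dot h h) <= 1 / 64.
  have : a ^+ 2 * dot h h <= a ^+ 2 * (d * sigma ^+ 2) by rewrite ler_wpM2l.
  have : d * (a ^+ 2 * sigma ^+ 2) <= d * (d / 8) by rewrite ler_wpM2l// ltW.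
  nra.
have term j : (\int[P]_v ((soft t (tnth beta j + noise h j v) - tnth beta j) ^+ 2)%:E <=
    ((if tnth beta j != 0 then A else 0) + B)%:E)%E.
  case: eqP => [->|_] /=.
    under eq_integral => v _ do rewrite add0r subr0.
    rewrite add0r; apply: le_trans (integral_soft_noise _ t0 a0 a64) _.
    rewrite lee_fin /B ler_wpM2l ?divr_ge0 ?sqr_ge0// ler_expR lerD2l ler_wpM2l ?(ltW nR)//.
    have -> : a ^+ 2 * (sigma ^+ 2 / 2 + 9 * dot h h + 2 * a ^+ 2 * (sigma ^+ 2 + dot h h) ^+ 2) =
      a ^+ 2 * (sigma ^+ 2 / 2) + 9 * (a ^+ 2 * dot h h) + 2 * (a ^+ 2 * (sigma ^+ 2 + dot h h)) ^+ 2 by ring.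
    set u := a ^+ 2 * sigma ^+ 2 in ad *.
    have u0 : 0 <= u by rewrite mulr_ge0// ltW.
    have H1 : a ^+ 2 * dot h h <= d * u by rewrite /u mulrCA ler_wpM2l.
    have H2 : a ^+ 2 * (sigma ^+ 2 + dot h h) <= u * (1 + d) by rewrite mulrDr -/u; lra.
    have H3 : 0 <= a ^+ 2 * (sigma ^+ 2 + dot h h) by rewrite mulr_ge0 ?addr_ge0// ltW.
    have H4 : (a ^+ 2 * (sigma ^+ 2 + dot h h)) ^+ 2 <= (u * (1 + d)) ^+ 2.
      by rewrite ler_pXn2r// nnegrE mulr_ge0//; lra.
    have -> : a ^+ 2 * (sigma ^+ 2 / 2) = u / 2 by rewrite /u mulrA.
    clearbody u.
    (* Origin of 19: the exponent is at most u / 2 + 9 d u + 2 u d / 4 = u (1 + 19 d) / 2. *)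
    have H5 : (u * (1 + d)) ^+ 2 <= u * (d / 8 * 2).
      have -> : (u * (1 + d)) ^+ 2 = u * (u * (1 + d) ^+ 2) by ring.
      rewrite ler_wpM2l//.
      have : u * (1 + d) ^+ 2 <= (d / 8) * (1 + d) ^+ 2 by rewrite ler_wpM2r ?sqr_ge0.
      nra.
    lra.
  apply: le_trans (integral_soft_err _ _ _ t0 al0) _.
  rewrite lee_fin -[leLHS]addr0 lerD// /A lerD2l ler_wpM2l ?addr_ge0 ?invr_ge0 ?(ltW al0)//.
  rewrite ler_pM2r ?invr_gt0//.
  have : d * sigma ^+ 2 <= sigma ^+ 2 by rewrite ler_piMl ?(ltW sg)//; lra.
  lra.
apply: (@le_trans _ _ (\sum_(j < p) ((if tnth beta j != 0 then A else 0) + B)%:E)%E).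
  by apply: lee_sum => j _; exact: term.
rewrite sumEFin lee_fin big_split/= sumr_const card_ord -[B *+ p]mulr_natl lerD2r.
rewrite -big_mkcond/= sumr_const -(mulr_natl A) ler_wpM2r// ler_nat.
by apply: leq_trans hk.
Qed.

End refine.

(** * Least squares on a lattice *)

Section lattice_sum.
Context (R : realType).

(** A rational substitute for arctan in an integral test: it is bounded, and its unit increments
    dominate 1 / (1 + y^2) up to a constant. *)
Definition squash (y : R) : R := y / (1 + `|y|).

Lemma squash_le1 y : `|squash y| <= 1.
Proof.
have y0 : 0 < 1 + `|y| by rewrite ltr_pwDl.
rewrite /squash normrM normfV [`|1 + _|]gtr0_norm// ler_pdivrMr// mul1r.
by rewrite lerDr.
Qed.

Lemma squash_step y : (1 + y ^+ 2)^-1 <= 6 * (squash (y + 1) - squash y).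
Proof.
have y2 : 0 < 1 + y ^+ 2 by rewrite ltr_pwDl// sqr_ge0.
rewrite -[leLHS]mul1r ler_pdivrMr//.
have [y0|y0] := leP 0 y.
  rewrite /squash !ger0_norm//; last lra.
  have -> : (y + 1) / (1 + (y + 1)) - y / (1 + y) = ((1 + y) * (2 + y))^-1.
    by field; rewrite !gt_eqF//; lra.
  have d0 : 0 < (1 + y) * (2 + y) by rewrite mulr_gt0//; lra.
  rewrite mulrAC ler_pdivlMr// mul1r; nra.
have [y1|y1] := leP 0 (y + 1).
  rewrite /squash [`|y|]ltr0_norm// [`|y + 1|]ger0_norm//.
  have d1 : 0 < 1 + (y + 1) by lra.
  have d2 : 0 < 1 - y by lra.
  have e1 : (y + 1) / 2 <= (y + 1) / (1 + (y + 1)).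
    by rewrite ler_wpM2l// lef_pV2 ?posrE//; lra.
  have e2 : - y / 2 <= - y / (1 - y).
    by rewrite ler_wpM2l ?lef_pV2 ?posrE//; lra.
  have -> : (y + 1) / (1 + (y + 1)) - y / (1 - y) = (y + 1) / (1 + (y + 1)) + (- y / (1 - y)) by rewrite mulNr.
  set A := (y + 1) / (1 + (y + 1)) in e1 *; set B := - y / (1 - y) in e2 *.
  have AB : 1 / 2 <= A + B by lra.
  have : 0 <= y ^+ 2 by exact: sqr_ge0.
  nra.
rewrite /squash !ltr0_norm//.
have -> : (y + 1) / (1 - (y + 1)) - y / (1 - y) = (- y * (1 - y))^-1.
  have h1 : y != 0 by rewrite lt_eqF.
  have h2 : 1 - y != 0 by rewrite gt_eqF//; lra.
  rewrite (_ : 1 - (y + 1) = - y); last by ring.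
  by field; rewrite ?h1 ?h2 ?oppr_eq0 ?h1.
have d0 : 0 < - y * (1 - y) by rewrite mulr_gt0//; lra.
rewrite mulrAC ler_pdivlMr// mul1r; nra.
Qed.

(** Telescoping along [squash], whose total variation is at most 2, gives a bound uniform in the
    centre [a] and the range N. *)
Lemma sum_cauchy_kernel_le (c a : R) N : 0 < c <= 1 ->
  \sum_(t < N) (1 + c * (t%:R - a) ^+ 2)^-1 <= 12 / c.
Proof.
move=> /andP[c0 c1].
apply: (@le_trans _ _ (\sum_(t < N) c^-1 * (6 * (squash (t.+1%:R - a) - squash (t%:R - a))))).
  apply: ler_sum => t _.
  have s0 : 0 <= (t%:R - a) ^+ 2 by exact: sqr_ge0.
  apply: (@le_trans _ _ (c^-1 * (1 + (t%:R - a) ^+ 2)^-1)).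
    rewrite -invfM lef_pV2 ?posrE ?mulr_gt0//; try by rewrite ltr_pwDl// mulr_ge0// ltW.
    by rewrite mulrDr mulr1 lerD2r.
  rewrite ler_wpM2l ?invr_ge0 ?(ltW c0)//.
  by have := squash_step (t%:R - a); rewrite (_ : t%:R - a + 1 = t.+1%:R - a)// -natr1; ring.
rewrite -mulr_sumr -mulr_sumr.
rewrite (_ : 12 / c = c^-1 * (6 * 2)); last by rewrite mulrC; congr (_ * _); ring.
rewrite ler_wpM2l ?invr_ge0 ?(ltW c0)// ler_wpM2l//.
rewrite -(big_mkord xpredT (fun t => squash (t.+1%:R - a) - squash (t%:R - a))).
rewrite (telescope_sumr (fun t => squash (t%:R - a)))//.
have := squash_le1 (N%:R - a); have := squash_le1 (0%:R - a).
rewrite !ler_norml => /andP[A _] /andP[_ B]; lra.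
Qed.

(** The inequality of arithmetic and geometric means with the product padded to K factors. It
    converts a power of the total error into a product over coordinates, which can be summed over
    the lattice. *)
Lemma prod1D_le p (X : 'I_p -> R) K : (0 < K)%N -> (forall j, 0 <= X j) ->
  (#|[pred j | X j != 0%R]| <= K)%N ->
  \prod_(j < p) (1 + X j) <= (1 + (\sum_(j < p) X j) / K%:R) ^+ K.
Proof.
move=> K0 X0 XK; set N := #|_| in XK.
have KR : 0 < K%:R :> R by rewrite ltr0n.
set S := \sum_(j < p) X j; set u := S / K%:R.
have S0 : 0 <= S by exact: sumr_ge0.
have u0 : 0 <= u by rewrite divr_ge0// ltW.
have u1 : 0 < 1 + u by rewrite ltr_pwDl.
have -> : \prod_(j < p) (1 + X j) = \prod_(j < p | X j != 0) (1 + X j).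
  rewrite [RHS]big_mkcond; apply: eq_bigr => j _; case: eqP => //= ->.
  by rewrite addr0.
(* A tangent bound at the mean u. The N nonzero X_j sum to K u, leaving K - N factors exp (u / (1 +
   u)), each at most 1 + u. *)
apply: (@le_trans _ _ (\prod_(j < p | X j != 0) ((1 + u) * expR ((X j - u) / (1 + u))))).
  apply: ler_prod => j _; rewrite addr_ge0//=.
  have -> : 1 + X j = (1 + u) * (1 + (X j - u) / (1 + u)) by field; rewrite gt_eqF.
  by rewrite ler_wpM2l ?(ltW u1)// expR_ge1Dx.
rewrite big_split/= prodr_const -expR_sum -/N.
have -> : \sum_(j < p | X j != 0) (X j - u) / (1 + u) = (K - N)%:R * (u / (1 + u)).
  rewrite -mulr_suml sumrB sumr_const -/N.
  have -> : \sum_(j < p | X j != 0) X j = K%:R * u.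
    rewrite /u mulrC divfK ?gt_eqF// /S [in RHS](bigID (fun j => X j != 0))/=.
    rewrite [X in _ = _ + X]big1 ?addr0// => j.
    by rewrite negbK => /eqP.
  by rewrite natrB// -[u *+ N]mulr_natl -mulrBl mulrA.
rewrite -[in leRHS](subnKC XK) exprD ler_wpM2l ?exprn_ge0 ?(ltW u1)//.
rewrite mulrC expRM_natr; apply: lerXn2r; rewrite ?nnegrE ?expR_ge0 ?(ltW u1)//.
rewrite -[leRHS]invrK -[leLHS]invrK lef_pV2 ?posrE ?invr_gt0 ?expR_gt0//.
rewrite -expRN; apply: le_trans (expR_ge1Dx _).
by rewrite le_eqVlt; apply/orP; left; apply/eqP; field; rewrite gt_eqF.
Qed.

Lemma big_seq_le_fin (I : finType) (Z : eqType) (iota : I -> Z) (s : seq Z) (f : Z -> R) :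
  injective iota -> (forall z, 0 <= f z) -> uniq s ->
  (forall z, z \in s -> exists i, z = iota i) ->
  \sum_(z <- s) f z <= \sum_(i : I) f (iota i).
Proof.
move=> inj f0 us sI.
rewrite -(big_map iota xpredT f).
set r := [seq iota i | i <- index_enum I].
have ur : uniq r by rewrite map_inj_uniq// index_enum_uniq.
rewrite (perm_big [seq z <- r | z \in s]); last first.
  apply: uniq_perm => //; first exact: filter_uniq.
  move=> z; rewrite mem_filter; case: (boolP (z \in s)) => //= zs.
  by have [i ->] := sI _ zs; rewrite map_f// mem_index_enum.
rewrite big_filter [leRHS](bigID (fun z => z \in s))/= lerDl.
by apply: sumr_ge0 => z _.
Qed.

Definition support_size p (m : {ffun 'I_p -> int}) : nat := #|[pred j | m j != 0]|.

(* The weight [w ^ support_size m] lets the sum over sparse lattice points be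
   bounded by a sum over all of them, which factors over the coordinates. *)
Lemma sum_sparse_lattice_le p k (s : seq {ffun 'I_p -> int}) (b : 'I_p -> R) (c w : R) :
  0 < c <= 1 -> 0 < w <= 1 -> uniq s ->
  (forall m, m \in s -> (support_size m <= k)%N) ->
  \sum_(m <- s) \prod_(j < p) (1 + c * (b j - (m j)%:~R) ^+ 2)^-1 <=
    w^-1 ^+ k * expR (p%:R * (w * (12 / c))).
Proof.
move=> c01 /andP[w0 w1] us sk; have /andP[c0 c1] := c01.
pose f j (t : int) := (1 + c * (b j - t%:~R) ^+ 2)^-1.
have d1 j (t : int) : 1 <= 1 + c * (b j - t%:~R) ^+ 2.
  by rewrite lerDl mulr_ge0 ?sqr_ge0// ltW.
have f0 j t : 0 <= f j t by rewrite invr_ge0; apply: le_trans (d1 j t).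
have f1 j t : f j t <= 1 by rewrite invf_le1// (lt_le_trans _ (d1 j t)).
pose g j (t : int) := (if t != 0 then w else 1) * f j t.
have g0 j t : 0 <= g j t by rewrite mulr_ge0//; case: ifP => // _; exact: ltW.
apply: (@le_trans _ _ (\sum_(m <- s) w^-1 ^+ k * \prod_(j < p) g j (m j))).
  rewrite big_seq [leRHS]big_seq; apply: ler_sum => m ms.
  rewrite big_split/= mulrA; apply: ler_peMl.
    by apply: prodr_ge0 => j _; exact: f0.
  rewrite -big_mkcond/= prodr_const -/(support_size m) exprVn.
  rewrite mulrC ler_pdivlMr ?exprn_gt0// mul1r.
  by rewrite ler_wiXn2l ?(ltW w0)// sk.
rewrite -mulr_sumr ler_wpM2l ?exprn_ge0 ?invr_ge0 ?(ltW w0)//.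
(* A crude bound on all entries occurring in [s], which places [s] in a finite box; there the sum of
   products is a product of sums, bounded independently of M. *)
pose M := (\sum_(m <- s) \sum_(j < p) `|m j|%N)%N.
have sM m j : m \in s -> (`|m j| <= M)%N.
  move=> ms; rewrite /M (bigD1_seq m)//= (bigD1 j)//= -addnA; exact: leq_addr.
pose io (phi : {ffun 'I_p -> 'I_(2 * M).+1}) : {ffun 'I_p -> int} :=
  [ffun j => (phi j)%:Z - M%:Z].
apply: (@le_trans _ _ (\sum_(phi : {ffun 'I_p -> 'I_(2 * M).+1}) \prod_(j < p) g j (io phi j))).
  apply: (@big_seq_le_fin _ _ io s (fun m => \prod_(j < p) g j (m j))) => //.
  - move=> phi psi /ffunP E; apply/ffunP => j; apply: val_inj.
    by have := E j; rewrite !ffunE => /addIr [].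
  - by move=> m; apply: prodr_ge0.
  - move=> m ms; exists [ffun j => inord `|(m j + M%:Z)%R|%N].
    apply/ffunP => j; rewrite !ffunE inordK.
      have := sM m j ms; lia.
    have := sM m j ms; lia.
under eq_bigr => phi _ do under eq_bigr => j _ do rewrite ffunE.
rewrite -(bigA_distr_bigA (fun j (t : 'I_(2 * M).+1) => g j (t%:Z - M%:Z)))/=.
have -> : expR (p%:R * (w * (12 / c))) = \prod_(j < p) expR (w * (12 / c)).
  by rewrite -expR_sum sumr_const card_ord mulr_natl.
apply: ler_prod => j _; rewrite sumr_ge0//=.
apply: le_trans (expR_ge1Dx _).
have M2 : (M < (2 * M).+1)%N by lia.
(* Only the entry 0 escapes the weight w, and it contributes at most 1. *)
apply: (@le_trans _ _ (1 + \sum_(t < (2 * M).+1) w * f j (t%:Z - M%:Z))).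
  rewrite (bigD1 (Ordinal M2))//= [in leRHS](bigD1 (Ordinal M2))//= /g subrr eqxx/= mul1r.
  have e1 := f1 j 0; have e2 : 0 <= w * f j 0 by rewrite mulr_ge0// ltW.
  rewrite addrA; apply: lerD; first lra.
  apply: ler_sum => t /negP tM; case: ifP => // /negbT.
  rewrite negbK subr_eq0 => /eqP[tM']; exfalso; apply: tM.
  by apply/eqP/val_inj.
rewrite lerD2l -mulr_sumr ler_wpM2l ?(ltW w0)//.
apply: le_trans (sum_cauchy_kernel_le (b j + M%:R) (2 * M).+1 c01).
apply: ler_sum => t _; rewrite /f le_eqVlt; apply/orP; left; apply/eqP.
congr (_^-1); congr (1 + c * _); rewrite rmorphB/= -[RHS]sqrrN; congr (_ ^+ 2).
by rewrite !pmulrn; ring.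
Qed.

End lattice_sum.

Section first_hit.
Context d d' (T1 : measurableType d) (T2 : measurableType d').
Variables (W : nat -> set T1) (f : nat -> T2).
Hypothesis mW : forall i, measurable (W i).
Hypothesis covW : forall x, exists i, `[< W i x >].

(** Taking the least index makes the selection measurable: its level sets are differences of the
    [W i]. *)
Definition first_hit x : nat := ex_minn (covW x).

Lemma first_hitP x : W (first_hit x) x.
Proof. by rewrite /first_hit; case: ex_minnP => i /asboolP. Qed.

Lemma measurable_first_hit : measurable_fun setT (fun x => f (first_hit x)).
Proof.
move=> _ B mB; rewrite setTI.
pose V i := W i `&` ~` \bigcup_(j in [set j | (j < i)%N]) W j.
have -> : (fun x => f (first_hit x)) @^-1` B =
   \bigcup_(i in [set i | B (f i)]) V i.
  apply/seteqP; split => x /=.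
    move=> Bx; exists (first_hit x) => //; split; first exact: first_hitP.
    move=> [j /= ji Wj]; move: ji; rewrite /first_hit; case: ex_minnP => i _ H.
    by rewrite ltnNge H//; apply/asboolP.
  move=> [i /= Bi [Wi nW]]; suff -> : first_hit x = i by [].
  rewrite /first_hit; case: ex_minnP => i' /asboolP Wi' H; apply/eqP.
  rewrite eqn_leq H/=; last exact/asboolP.
  by rewrite leqNgt; apply/negP => ii; apply: nW; exists i'.
apply: bigcup_measurable => i _; apply: measurableI => //; apply: measurableC.
by apply: bigcup_measurable => j _.
Qed.

End first_hit.

(** * Exponential comparison of residuals, one row at a time *)

Section row_comparison.
Context (R : realType) (p : nat) (sigma : R).
Hypothesis sigma0 : 0 < sigma.
Local Notation T := (measurableTypeR R).
Local Notation coefs := (p.-tuple T).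
Local Notation row := (coefs * T)%type.

Lemma measurable_expR_row_sqr (d : 'I_p -> R) (c : R) :
  measurable_fun setT (fun w : row => expR (c * (dot (tnth w.1) d + w.2) ^+ 2)).
Proof.
apply: measurableT_comp => //; apply: measurable_funM => //; apply: measurable_funX.
exact: measurable_dot_row.
Qed.

(* Cauchy-Schwarz between the two quadratic exponentials. *)
Lemma integral_row_compare (d0 d : 'I_p -> R) (la al be : R) :
  0 < la -> 4 * la * (dot d0 d0 + sigma ^+ 2) < 1 ->
  (Num.sqrt (1 - 4 * la * (dot d0 d0 + sigma ^+ 2)))^-1 <= expR al ->
  (Num.sqrt (1 + 4 * la * (dot d d + sigma ^+ 2)))^-1 <= expR (- be) ->
  (\int[row_prob sigma p]_w (expR (la * ((dot (tnth w.1) d0 + w.2) ^+ 2 -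
       (dot (tnth w.1) d + w.2) ^+ 2)))%:E <= (expR ((al - be) / 2))%:E)%E.
Proof.
move=> la0 la1 Hal Hbe.
have dd0 := dot_ge0 d; have s0 : sigma != 0 by rewrite gt_eqF.
have s2 : 0 < sigma ^+ 2 by rewrite exprn_gt0.
(* The weight in A B <= (A^2 + B^2) / 2 that gives both halves the same bound exp ((al - be) /
   2). *)
pose tau := expR (- (al + be) / 2).
pose X (w : row) := expR (2 * la * (dot (tnth w.1) d0 + w.2) ^+ 2).
pose Y (w : row) := expR (- (2 * la) * (dot (tnth w.1) d + w.2) ^+ 2).
have mX : measurable_fun setT X by exact: measurable_expR_row_sqr.
have mY : measurable_fun setT Y by exact: measurable_expR_row_sqr.
have tau0 : 0 < tau by exact: expR_gt0.
apply: (@le_trans _ _ (\int[row_prob sigma p]_w (tau / 2 * X w + tau^-1 / 2 * Y w)%:E)%E).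
  apply: ge0_le_integralT => w; rewrite lee_fin ?expR_ge0//.
  set x := (_ + _) ^+ 2; set y := (_ + _) ^+ 2.
  pose A := expR (la * x + (- (al + be) / 4)); pose B := expR (- la * y + (al + be) / 4).
  have -> : expR (la * (x - y)) = A * B.
    by rewrite /A /B -expRD; congr expR; field.
  have -> : tau / 2 * X w = A ^+ 2 / 2.
    by rewrite mulrAC /tau /A expr2 -!expRD /X -/x; congr (expR _ / 2); field.
  have -> : tau^-1 / 2 * Y w = B ^+ 2 / 2.
    by rewrite mulrAC /tau /B -expRN expr2 -!expRD /Y -/y; congr (expR _ / 2); field.
  have := sqr_ge0 (A - B); nra.
rewrite ge0_integralDT//; last 4 first.
- exact: measurable_funM.
- by move=> w; rewrite mulr_ge0 ?expR_ge0// divr_ge0 ?expR_ge0.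
- exact: measurable_funM.
- by move=> w; rewrite mulr_ge0 ?expR_ge0// divr_ge0 ?invr_ge0 ?expR_ge0.
rewrite ge0_integralZlT//; last 2 first.
- by rewrite divr_ge0 ?expR_ge0.
- by move=> w; exact: expR_ge0.
rewrite ge0_integralZlT//; last 2 first.
- by rewrite divr_ge0 ?invr_ge0 ?expR_ge0.
- by move=> w; exact: expR_ge0.
have IX : (\int[row_prob sigma p]_w (X w)%:E <= (expR al)%:E)%E.
  rewrite (eq_integral (fun w : row => (expR (- (- (2 * la)) * (dot (tnth w.1) d0 + w.2) ^+ 2))%:E)); last first.
    by move=> w _; rewrite opprK.
  rewrite integral_row_expR_sqr//.
    by rewrite lee_fin (_ : 1 + _ = 1 - 4 * la * (dot d0 d0 + sigma ^+ 2))//; ring.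
  by rewrite (_ : 1 + _ = 1 - 4 * la * (dot d0 d0 + sigma ^+ 2)) ?subr_gt0//; ring.
have IY : (\int[row_prob sigma p]_w (Y w)%:E <= (expR (- be))%:E)%E.
  rewrite integral_row_expR_sqr//.
    by rewrite lee_fin (_ : 1 + _ = 1 + 4 * la * (dot d d + sigma ^+ 2))//; ring.
  by rewrite ltr_pwDl// !mulr_ge0 ?addr_ge0 ?(ltW la0) ?(ltW s2).
apply: (@le_trans _ _ ((tau / 2)%:E * (expR al)%:E + (tau^-1 / 2)%:E * (expR (- be))%:E)%E).
  by apply: leeD; rewrite lee_wpmul2l// lee_fin divr_ge0 ?invr_ge0 ?expR_ge0.
rewrite -!EFinM -EFinD lee_fin mulrAC [tau^-1 / 2 * _]mulrAC /tau -expRN -!expRD.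
rewrite (_ : - (al + be) / 2 + al = (al - be) / 2); last by field.
rewrite (_ : - (- (al + be) / 2) - be = (al - be) / 2); last by field.
lra.
Qed.

(* [delta] is the target relative accuracy, [rho] the squared distance from
   the truth to the lattice in units of [sigma]. *)
Lemma integral_row_compare_le (delta : R) (d0 d : 'I_p -> R)
  (q := delta / 144) (rho := delta / 32) (kap := q / (1 + q)) (x := dot d d / sigma ^+ 2) :
  0 < delta <= 1 -> dot d0 d0 <= rho * sigma ^+ 2 -> delta <= x ->
  (\int[row_prob sigma p]_w (expR (q / (4 * sigma ^+ 2) * ((dot (tnth w.1) d0 + w.2) ^+ 2 -
       (dot (tnth w.1) d + w.2) ^+ 2 + rho * sigma ^+ 2)))%:E <=
   (expR (- ((ln (1 + kap * delta) + ln (1 + kap * x)) / 16)))%:E)%E.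
Proof.
move=> /andP[del0 del1] hd0 dx.
have s2 : 0 < sigma ^+ 2 by rewrite exprn_gt0.
have q0 : 0 < q by rewrite /q divr_gt0.
have rho0 : 0 < rho by rewrite /rho divr_gt0.
have q1 : q <= 1 / 144 by rewrite /q ler_pM2r//.
have rho1 : rho <= 1 / 32 by rewrite /rho ler_pM2r//.
have kap0 : 0 < kap by rewrite /kap divr_gt0//; lra.
have dd := dot_ge0 d; have dd0 := dot_ge0 d0.
have x0 : 0 < x by lra.
set la := q / (4 * sigma ^+ 2).
have la0 : 0 < la by rewrite divr_gt0// mulr_gt0.
pose Y := q * (1 + rho).
have Y4 : 4 * la * (dot d0 d0 + sigma ^+ 2) <= Y.
  have -> : 4 * la * (dot d0 d0 + sigma ^+ 2) = q * (dot d0 d0 / sigma ^+ 2 + 1).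
    by rewrite /la; field; rewrite gt_eqF.
  rewrite ler_wpM2l ?(ltW q0)// addrC lerD2l ler_pdivrMr//.
have Y1 : Y <= 1 / 2 by rewrite /Y; nra.
pose al := (2 * la * (dot d0 d0 + sigma ^+ 2)) / (1 - 4 * la * (dot d0 d0 + sigma ^+ 2)).
pose be := ln (1 + q + q * x) / 2.
pose Z := 4 * la * (dot d0 d0 + sigma ^+ 2).
have Z0 : 0 <= Z.
  apply: mulr_ge0; first by apply: mulr_ge0 => //; exact: ltW.
  by apply: addr_ge0 => //; exact: ltW.
have Y4' : Z <= Y by exact: Y4.
have alle : 2 * al <= Y + 2 * Y ^+ 2.
  have -> : 2 * al = Z / (1 - Z).
    by rewrite /al -/Z (_ : 2 * la * (dot d0 d0 + sigma ^+ 2) = Z / 2); [field; rewrite gt_eqF//; lra|rewrite /Z; field].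
  rewrite ler_pdivrMr; last lra.
  have : 0 <= (Y - Z) * (1 - Z) by rewrite mulr_ge0; lra.
  nra.
have H1 : (\int[row_prob sigma p]_w (expR (la * ((dot (tnth w.1) d0 + w.2) ^+ 2 -
       (dot (tnth w.1) d + w.2) ^+ 2)))%:E <= (expR ((al - be) / 2))%:E)%E.
  apply: integral_row_compare => //.
  - by rewrite -/Z; lra.
  - have -> : 4 * la * (dot d0 d0 + sigma ^+ 2) = 2 * (2 * la * (dot d0 d0 + sigma ^+ 2)) by ring.
    apply: le_trans (inv_sqrt_le_expR _) _.
      rewrite (_ : 2 * _ = Z); [lra|rewrite /Z; ring].
    rewrite ler_expR /al le_eqVlt; apply/orP; left; apply/eqP; congr (_ / (1 - _)); ring.
  - have -> : 1 + 4 * la * (dot d d + sigma ^+ 2) = 1 + q + q * x.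
      by rewrite /la /x; field; rewrite gt_eqF.
    have t0 : 0 < 1 + q + q * x by rewrite !addr_gt0// mulr_gt0.
    rewrite -ler_sqr ?nnegrE ?expR_ge0 ?invr_ge0 ?sqrtr_ge0//.
    rewrite exprVn sqr_sqrtr ?(ltW t0)// expr2 -expRD /be.
    by rewrite (_ : - _ + - _ = - ln (1 + q + q * x)) ?expRN ?lnK ?posrE//; field.
rewrite (eq_integral (fun w : row => (expR (q * rho / 4) * expR (la * ((dot (tnth w.1) d0 + w.2) ^+ 2 -
       (dot (tnth w.1) d + w.2) ^+ 2)))%:E)); last first.
  by move=> w _; rewrite -expRD; congr (expR _)%:E; rewrite /la; field; rewrite gt_eqF.
rewrite ge0_integralZlT ?expR_ge0//; last first.
  apply: measurableT_comp => //; apply: measurable_funM => //; apply: measurable_funB;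
  apply: measurable_funX; exact: measurable_dot_row.
apply: (@le_trans _ _ ((expR (q * rho / 4))%:E * (expR ((al - be) / 2))%:E)%E).
  by rewrite lee_wpmul2l// lee_fin expR_ge0.
rewrite -EFinM -expRD lee_fin ler_expR.
have lnle (u : R) : 0 < u -> u / (1 + u) <= ln (1 + u).
  move=> u0; have u1 : 0 < 1 + u by rewrite addr_gt0.
  rewrite -ler_expR lnK ?posrE// -[leRHS]invrK -[leLHS]invrK lef_pV2 ?posrE ?invr_gt0 ?expR_gt0//.
  rewrite -expRN; apply: le_trans (expR_ge1Dx _).
  by rewrite le_eqVlt; apply/orP; left; apply/eqP; field; rewrite gt_eqF.
set sd := ln (1 + kap * delta); set s := ln (1 + kap * x).
have kd0 : 0 < kap * delta by rewrite mulr_gt0.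
have kx0 : 0 < kap * x by rewrite mulr_gt0.
have sds : sd <= s.
  rewrite /sd /s ler_ln ?posrE ?addr_gt0// lerD2l ler_wpM2l//; exact: ltW.
(* Origin of [kap]: 1 + q + q x = (1 + q) (1 + kap x). *)
have be2 : 2 * be = ln (1 + q) + s.
  rewrite /be /s -lnM ?posrE ?addr_gt0//.
  rewrite mulrC divfK//; congr ln; rewrite /kap; field; rewrite gt_eqF//; lra.
have kq : q / 2 <= kap.
  by rewrite /kap ler_wpM2l ?(ltW q0)// lef_pV2 ?posrE//; lra.
have kq' : kap <= q.
  by rewrite /kap ler_pdivrMr; [nra|lra].
have lnq : q - q ^+ 2 <= ln (1 + q).
  apply: (le_trans _ (lnle _ q0)); rewrite ler_pdivlMr; last lra.
  have : 0 <= q ^+ 3 by rewrite exprn_ge0// ltW.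
  nra.
have sd4 : q * delta / 4 <= sd.
  apply: (le_trans _ (lnle _ kd0)); rewrite ler_pdivlMr; last by rewrite addr_gt0.
  have : q * delta <= 2 * (kap * delta) by nra.
  have : kap * delta <= 1 by nra.
  nra.
(* First-order terms in q cancel, leaving q (2 rho + 9 q); 32 and 144 make this q delta / 8, at most
   sd / 2. As sd <= s, the final exponent is at most - s / 8, and it is split between [sd], for
   decay in n, and [s], for summability over the lattice. *)
have key : Y + 2 * Y ^+ 2 - ln (1 + q) + q * rho <= sd / 2.
  have e : 2 * rho + 9 * q = delta / 8 by rewrite /rho /q; field.
  have : q * (2 * rho + 9 * q) <= sd / 2 by rewrite e; lra.
  have : 2 * Y ^+ 2 <= 8 * q ^+ 2.
    rewrite /Y exprMn; have : (1 + rho) ^+ 2 <= 2 ^+ 2 by rewrite lerXn2r// ?nnegrE; lra.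
    have := sqr_ge0 q; nra.
  rewrite /Y; nra.
lra.
Qed.

End row_comparison.

(** * Measurable approximate least squares over the sparse lattice *)

Section pilot.
Context (R : realType) (n p k : nat).
Local Notation T := (measurableTypeR R).
Local Notation coefs := (p.-tuple T).
Local Notation row := (coefs * T)%type.
Local Notation rows := (n.-tuple row).
Local Notation Z := {ffun 'I_p -> int}.
Variables (eta r : R).
Hypothesis r0 : 0 < r.

Definition lattice_point (m : Z) : coefs := [tuple eta * (m j)%:~R : T | j < p].

Definition rss (D : rows) (b : 'I_p -> R) : R :=
  \sum_(i < n) ((tnth D i).2 - dot (tnth (tnth D i).1) b) ^+ 2.

Definition near_minimizer (m : Z) (D : rows) : Prop :=
  (support_size m <= k)%N /\ forall m', (support_size m' <= k)%N ->
    rss D (tnth (lattice_point m)) <= rss D (tnth (lattice_point m')) + r.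

(** Lattice points are numbered by [pickle], so that [first_hit] can select among them. *)
Definition near_minimizers i : set rows :=
  [set D | exists2 m, pickle_inv i = Some m & near_minimizer m D].

Lemma rss_ge0 D b : 0 <= rss D b.
Proof. by apply: sumr_ge0 => i _; exact: sqr_ge0. Qed.

(** Descent: a point that is not a near minimizer is beaten by more than r, which can happen only
    finitely often as the residual sum is nonnegative. *)
Lemma near_minimizer_exists D : exists m, near_minimizer m D.
Proof.
have H (N : nat) m : (support_size m <= k)%N ->
    rss D (tnth (lattice_point m)) <= N%:R * r -> exists m, near_minimizer m D.
  elim: N m => [|N IHN] m mk mN.
    exists m; split => // m' _; apply: le_trans mN _.
    by rewrite mul0r addr_ge0 ?rss_ge0// ltW.
  have [w|nw] := pselect (near_minimizer m D); first by exists m.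
  have [m' [m'k m'r]] : exists m', (support_size m' <= k)%N /\
      rss D (tnth (lattice_point m')) + r < rss D (tnth (lattice_point m)).
    apply: contrapT => H; apply: nw; split => // m' m'k.
    by rewrite leNgt; apply/negP => ?; apply: H; exists m'.
  apply: (IHN m') => //; move: mN; rewrite -natr1 mulrDl mul1r; lra.
pose m0 : Z := [ffun=> 0].
apply: (H (Num.bound (rss D (tnth (lattice_point m0)) / r)) m0).
  by rewrite /support_size eq_card0// => j; rewrite !inE ffunE eqxx.
rewrite -ler_pdivrMr//; apply: ltW; apply: archi_boundP.
by rewrite divr_ge0 ?rss_ge0// ltW.
Qed.

Lemma near_minimizers_cover D : exists i, `[< near_minimizers i D >].
Proof.
have [m mD] := near_minimizer_exists D; exists (pickle m); apply/asboolP.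
by exists m => //; rewrite pickleK_inv.
Qed.

Lemma measurable_rss b : measurable_fun setT (fun D : rows => rss D b).
Proof.
apply: measurable_sum => i; apply: measurable_funX; apply: measurable_funB.
  exact: (measurableT_comp measurable_snd (measurable_tnth i)).
apply: (measurableT_comp (measurable_dot_tnth b)).
exact: (measurableT_comp measurable_fst (measurable_tnth i)).
Qed.

Lemma measurable_near_minimizers i : measurable (near_minimizers i).
Proof.
rewrite /near_minimizers; case: (pickle_inv i) => [m|]; last first.
  by rewrite (_ : [set _ | _] = set0)//; apply/seteqP; split => // D [].
have [mk|mk] := leqP (support_size m) k; last first.
  rewrite (_ : [set _ | _] = set0)//; apply/seteqP; split => // D [m' [<-]].
  by move=> []; rewrite leqNgt mk.
rewrite (_ : [set _ | _] = \bigcap_(i in [set: nat])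
    (if pickle_inv i is Some m' then
       if (support_size m' <= k)%N then
         [set D | rss D (tnth (lattice_point m)) <= rss D (tnth (lattice_point m')) + r]
       else setT
     else setT)); last first.
  apply/seteqP; split => D.
    move=> [_ [<-] [_ H]] i' _; case: (pickle_inv i') => // m'.
    by case: ifP => // m'k; exact: H.
  move=> H; exists m => //; split => // m' m'k.
  by have := H (pickle m') I; rewrite pickleK_inv m'k.
apply: bigcap_measurable => // i' _; case: (pickle_inv i') => // m'.
case: ifP => // _.
rewrite -[X in measurable X]setTI.
apply: (measurable_fun_ler (f := fun D => rss D _) (g := fun D => rss D _ + r)) => //.
  exact: measurable_rss.
by apply: measurable_funD => //; exact: measurable_rss.
Qed.

Definition pilot (D : rows) : coefs :=
  lattice_point (odflt [ffun=> 0] (pickle_inv (first_hit near_minimizers_cover D))).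

Lemma measurable_pilot : measurable_fun setT pilot.
Proof.
exact: (@measurable_first_hit _ _ rows coefs near_minimizers
  (fun i => lattice_point (odflt [ffun=> 0] (@pickle_inv Z i)))
  measurable_near_minimizers near_minimizers_cover).
Qed.

Lemma pilotP D : exists i m, [/\ pickle_inv i = Some m, pilot D = lattice_point m &
  near_minimizer m D].
Proof.
have [m E mD] := first_hitP near_minimizers_cover D.
by exists (first_hit near_minimizers_cover D), m; split => //; rewrite /pilot E.
Qed.

End pilot.

Section pilot_error.
Context (R : realType) (n p k : nat) (sigma delta : R).
Local Notation T := (measurableTypeR R).
Local Notation coefs := (p.-tuple T).
Local Notation row := (coefs * T)%type.
Local Notation rows := (n.-tuple row).
Local Notation Z := {ffun 'I_p -> int}.
Hypothesis sigma0 : 0 < sigma.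
Hypothesis delta01 : 0 < delta <= 1.
Hypothesis k0 : (0 < k)%N.
Hypothesis kp : (k <= p)%N.
Hypothesis nk : (16 * (2 * k).+1 <= n)%N.

Let q := delta / 144.
Let rho := delta / 32.
Let kap := q / (1 + q).
(** The mesh for which rounding at most k coordinates costs at most k eta^2 = rho sigma^2. *)
Let eta := sigma * Num.sqrt (rho / k%:R).
Let r := n%:R * (rho * sigma ^+ 2).

Variable beta : coefs.
Hypothesis beta_sparse : (l0norm beta <= k)%N.

Let diff (m : Z) (j : 'I_p) : R := tnth beta j - tnth (lattice_point eta m) j.
Let err (m : Z) : R := dot (diff m) (diff m).

Let rho0 : 0 < rho. Proof. by rewrite /rho divr_gt0//; case/andP: delta01. Qed.
Let q0 : 0 < q. Proof. by rewrite /q divr_gt0//; case/andP: delta01. Qed.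
Let kap0 : 0 < kap. Proof. by rewrite /kap divr_gt0// addr_gt0. Qed.
Let kR : 0 < k%:R :> R. Proof. by rewrite ltr0n. Qed.
Let s2 : 0 < sigma ^+ 2. Proof. by rewrite exprn_gt0. Qed.
Let n0 : 0 < n%:R :> R. Proof. by rewrite ltr0n; lia. Qed.
Let r0 : 0 < r. Proof. by apply: mulr_gt0 => //; apply: mulr_gt0. Qed.
Let eta0 : 0 < eta. Proof. by rewrite mulr_gt0// sqrtr_gt0 divr_gt0. Qed.
Let eta2 : eta ^+ 2 = sigma ^+ 2 * (rho / k%:R).
Proof. by rewrite exprMn sqr_sqrtr// divr_ge0// ltW. Qed.

(** The competitor of the pilot; rounding sends 0 to 0, so sparsity is kept. *)
Let m0 : Z := [ffun j => Num.floor (tnth beta j / eta)].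

Let m0_support : (support_size m0 <= k)%N.
Proof.
apply: leq_trans beta_sparse; apply: subset_leq_card; apply/fintype.subsetP => j.
rewrite !inE ffunE; apply: contra => /eqP ->.
by rewrite mul0r floor0.
Qed.

Let err_m0 : err m0 <= rho * sigma ^+ 2.
Proof.
apply: (@le_trans _ _ (\sum_(j < p) (if tnth beta j != 0 then eta ^+ 2 else 0))).
  apply: ler_sum => j _; rewrite /diff tnth_mktuple ffunE.
  case: eqP => [->|_] /=; first by rewrite mul0r floor0 mulr0 subr0 mulr0.
  set x := tnth beta j / eta.
  have -> : tnth beta j = eta * x by rewrite /x mulrC divfK// gt_eqF.
  rewrite -mulrBr -expr2 exprMn ler_piMr ?sqr_ge0//.
  have /andP[f1 f2] := floor_itv (x : R).
  have {}f2 : x < (Num.floor x)%:~R + 1 by rewrite -[1]/(1%:~R) -intrD.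
  by rewrite expr_le1// ?subr_ge0//; lra.
rewrite -big_mkcond/= sumr_const -(mulr_natl (eta ^+ 2)) eta2.
apply: (@le_trans _ _ (k%:R * (sigma ^+ 2 * (rho / k%:R)))).
  apply: ler_wpM2r; last by rewrite ler_nat; exact: beta_sparse.
  by apply: mulr_ge0; [exact: ltW|apply: divr_ge0; exact: ltW].
by rewrite le_eqVlt; apply/orP; left; apply/eqP; field; rewrite gt_eqF.
Qed.

Let rowexp (m : Z) (w : row) : R := q / (4 * sigma ^+ 2) *
  ((dot (tnth w.1) (diff m0) + w.2) ^+ 2 - (dot (tnth w.1) (diff m) + w.2) ^+ 2 +
   rho * sigma ^+ 2).

Let bad (m : Z) : bool := (support_size m <= k)%N && (delta * sigma ^+ 2 < err m).

(** A Chernoff majorant of the error of a bad [m]: if [m] is selected, its residual sum exceeds that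
    of [m0] by at most r, the sum over the rows of the slack rho sigma^2, so the exponent is
    nonnegative. *)
Let term (m : Z) (u : rows) : R :=
  if bad m then err m * \prod_(i < n) expR (rowexp m (tnth u i)) else 0.

Let err_ge0 m : 0 <= err m. Proof. exact: dot_ge0. Qed.

Let term_ge0 m u : 0 <= term m u.
Proof.
by rewrite /term; case: ifP => // _; rewrite mulr_ge0// prodr_ge0.
Qed.

Let measurable_rowexp m : measurable_fun setT (fun w : row => expR (rowexp m w)).
Proof.
apply: measurableT_comp => //; apply: measurable_funM => //; apply: measurable_funD => //.
by apply: measurable_funB; apply: measurable_funX; exact: measurable_dot_row.
Qed.

Let measurable_term m : measurable_fun setT (term m).
Proof.
rewrite /term; case: (bad m); last exact: measurable_cst.
apply: measurable_funM => //; apply: measurable_prod => i _.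
exact: (measurableT_comp (measurable_rowexp m) (measurable_tnth i)).
Qed.

Let sd := ln (1 + kap * delta).
Let bound (m : Z) : R := if bad m then
   err m * expR (- (n%:R * ((sd + ln (1 + kap * (err m / sigma ^+ 2))) / 16))) else 0.

Let integral_term m :
  (\int[iid_prob (row_prob sigma p) n]_u (term m u)%:E <= (bound m)%:E)%E.
Proof.
rewrite /term /bound; case: ifP => [/andP[mk dm]|_]; last by rewrite integral0.
rewrite ge0_integralZlT//; last 2 first.
- apply: measurable_prod => i _.
  exact: (measurableT_comp (measurable_rowexp m) (measurable_tnth i)).
- by move=> u; apply: prodr_ge0 => i _; exact: expR_ge0.
rewrite EFinM lee_wpmul2l ?lee_fin//.
set e := (_ / 16); have -> : expR (- (n%:R * e)) = \prod_(i < n) expR (- e).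
  by rewrite -expR_sum sumr_const card_ord -(mulr_natl (- e)) mulrN.
apply: (@integral_iid_prod R _ _ (row_prob sigma p) n
  (fun _ (w : row) => expR (rowexp m w)) (fun _ => expR (- e))) => // i.
apply: integral_row_compare_le => //.
  by rewrite ler_pdivlMr// ltW.
Qed.

Let rss_observe m (u : rows) :
  rss [tuple observe (tnth beta) (tnth u i) | i < n] (tnth (lattice_point eta m)) =
  \sum_(i < n) (dot (tnth (tnth u i).1) (diff m) + (tnth u i).2) ^+ 2.
Proof.
apply: eq_bigr => i _; rewrite tnth_mktuple/=; congr (_ ^+ 2).
by rewrite /diff dotB; ring.
Qed.

Let term_ge_err m u : near_minimizer k eta r m [tuple observe (tnth beta) (tnth u i) | i < n] ->
  delta * sigma ^+ 2 < err m -> err m <= term m u.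
Proof.
move=> [mk mw] dm; rewrite /term /bad mk dm/= ler_peMr//.
rewrite -expR_sum -[leLHS]expR0 ler_expR -mulr_sumr mulr_ge0//.
  by apply: divr_ge0; [exact: ltW|apply: mulr_ge0 => //; exact: ltW].
have := mw m0 m0_support; rewrite !rss_observe.
rewrite big_split/= sumrB sumr_const card_ord -(mulr_natl (rho * _)) -/r; lra.
Qed.

(** The power -n / 16 of 1 + kap x is at most the power -(2k + 1). One factor absorbs the weight x,
    and 2k factors cover the coordinates where [beta] or m is nonzero, so that the sum factors over
    the coordinates. *)
Let sum_bound_le N :
  \sum_(i < N) (if @pickle_inv Z i is Some m then bound m else 0) <=
  sigma ^+ 2 * (expR (- (n%:R * (sd / 16))) * (kap^-1 * ((p%:R / k%:R) ^+ k *
     expR (k%:R * (12 / (2 * kap * rho)))))).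
Proof.
pose s := [seq m <- pmap (@pickle_inv Z) (iota 0 N) | bad m].
have us : uniq s.
  by apply: filter_uniq; apply: (pmap_uniq (@pickle_invK Z)); exact: iota_uniq.
have -> : \sum_(i < N) (if @pickle_inv Z i is Some m then bound m else 0) =
   \sum_(m <- s) err m * expR (- (n%:R * ((sd + ln (1 + kap * (err m / sigma ^+ 2))) / 16))).
  rewrite -(big_mkord xpredT (fun i => if @pickle_inv Z i is Some m then bound m else 0)).
  rewrite /index_iota subn0 /s big_filter big_mkcond/=.
  elim: (iota 0 N) => [|i t IHt]; first by rewrite !big_nil.
  rewrite big_cons /= /oapp; case: (pickle_inv i) => [m|] /=; last by rewrite add0r.
  by rewrite big_cons IHt /bound; case: (bad m) => //; rewrite add0r.
(* Solves kap x = (sum of the X_j) / (2k) for X_j = c (b_j - m_j)^2, given eta^2 = sigma^2 rho /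
   k. *)
pose c := 2 * kap * rho.
pose b j := tnth beta j / eta.
have /andP[del0 del1] := delta01.
have q1 : q <= 1 by rewrite /q; lra.
have rho1 : rho <= 1 / 2 by rewrite /rho; lra.
have kap1 : kap <= 1 by rewrite /kap ler_pdivrMr ?addr_gt0//; lra.
have c01 : 0 < c <= 1.
  apply/andP; split; first by apply: mulr_gt0 => //; apply: mulr_gt0.
  have kr : kap * rho <= 1 * (1 / 2) by apply: ler_pM => //; exact: ltW.
  by rewrite /c -mulrA; lra.
apply: (@le_trans _ _ (\sum_(m <- s) sigma ^+ 2 * (expR (- (n%:R * (sd / 16))) * (kap^-1 *
    \prod_(j < p) (1 + c * (b j - (m j)%:~R) ^+ 2)^-1)))).
  rewrite big_seq [leRHS]big_seq; apply: ler_sum => m.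
  rewrite mem_filter => /andP[/andP[mk dm] _].
  set x := err m / sigma ^+ 2.
  have x0 : 0 <= x by rewrite divr_ge0// ltW.
  have kx : 0 <= kap * x by rewrite mulr_ge0// ltW.
  have k1 : 0 < 1 + kap * x by rewrite ltr_pwDl.
  have -> : err m = sigma ^+ 2 * x by rewrite /x mulrC divfK// gt_eqF.
  rewrite -[leLHS]mulrA ler_wpM2l ?(ltW s2)//.
  have -> : - (n%:R * ((sd + ln (1 + kap * x)) / 16)) =
     - (n%:R * (sd / 16)) + - (n%:R / 16 * ln (1 + kap * x)) by field.
  rewrite expRD mulrCA ler_wpM2l ?expR_ge0//.
  apply: (@le_trans _ _ (x * (1 + kap * x) ^- (2 * k).+1)).
    rewrite ler_wpM2l//.
    have <- : expR (- ((2 * k).+1%:R * ln (1 + kap * x))) = (1 + kap * x) ^- (2 * k).+1.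
      by rewrite expRN mulrC expRM_natr lnK ?posrE.
    rewrite ler_expR lerN2 ler_wpM2r ?ln_ge0 ?lerDl//.
    by rewrite ler_pdivlMr// -natrM ler_nat mulnC.
  rewrite exprS invfM mulrA.
  apply: (@le_trans _ _ (kap^-1 * (1 + kap * x) ^- (2 * k))).
    rewrite ler_wpM2r ?invr_ge0 ?exprn_ge0 ?(ltW k1)//.
    by rewrite ler_pdivrMr// mulrDr mulr1 mulKf ?gt_eqF// lerDr invr_ge0 ltW.
  rewrite ler_wpM2l ?invr_ge0 ?(ltW kap0)//.
  pose X j := c * (b j - (m j)%:~R) ^+ 2.
  have X0 j : 0 <= X j by rewrite /X mulr_ge0 ?sqr_ge0//; case/andP: c01 => /ltW.
  have -> : \prod_(j < p) (1 + c * (b j - (m j)%:~R) ^+ 2)^-1 = (\prod_(j < p) (1 + X j))^-1.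
    by rewrite -prodfV.
  have P0 : 0 < \prod_(j < p) (1 + X j) by apply: prodr_gt0 => j _; rewrite ltr_pwDl.
  rewrite lef_pV2 ?posrE ?exprn_gt0//.
  have -> : kap * x = (\sum_(j < p) X j) / (2 * k)%:R.
    have -> : \sum_(j < p) X j = c / eta ^+ 2 * err m.
      rewrite /err /dot mulr_sumr; apply: eq_bigr => j _.
      rewrite /X /diff /b tnth_mktuple; field; rewrite gt_eqF//.
    by rewrite eta2 /x /c natrM; field; rewrite !gt_eqF.
  apply: prod1D_le => //; first by rewrite muln_gt0.
  apply: (@leq_trans (#|[pred j | tnth beta j != 0%R]| + #|[pred j | m j != 0%R]|)%N); last first.
    by rewrite mul2n -addnn leq_add.
  apply: leq_trans (leq_addr #|[predI [pred j | tnth beta j != 0%R] & [pred j | m j != 0%R]]| _) _.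
  rewrite -[leqRHS]cardUI leq_add2r; apply: subset_leq_card; apply/fintype.subsetP => j.
  rewrite !inE -negb_and; apply: contra => /andP[/eqP bj /eqP mj].
  by rewrite /X /b bj mj mul0r subr0 expr0n/= mulr0.
rewrite -!mulr_sumr ler_wpM2l ?(ltW s2)// ler_wpM2l ?expR_ge0// ler_wpM2l ?invr_ge0 ?(ltW kap0)//.
have pR : 0 < p%:R :> R by rewrite ltr0n; exact: leq_trans k0 kp.
(* The weight w = k / p turns p w into k and leaves (p/k)^k, roughly the number of supports. *)
have w01 : 0 < (k%:R / p%:R : R) <= 1.
  apply/andP; split; first exact: divr_gt0.
  by rewrite ler_pdivrMr// mul1r ler_nat.
have sk m : m \in s -> (support_size m <= k)%N.
  by rewrite mem_filter => /andP[/andP[]].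
apply: le_trans (sum_sparse_lattice_le b c01 w01 us sk) _.
rewrite invf_div mulrA (_ : p%:R * (k%:R / p%:R) = k%:R)//.
by rewrite mulrC divfK// gt_eqF.
Qed.

Let pilot_u (u : rows) := pilot k eta r0 [tuple observe (tnth beta) (tnth u i) | i < n].

(** Whichever bad lattice point is selected, its error is at most its own [term], so a series over
    all points dominates. The positivity proof is a parameter since [pilot] takes it as an
    argument. *)
Lemma integral_pilot_bad (h : 0 < r)
    (pil := fun u : rows => pilot k eta h [tuple observe (tnth beta) (tnth u i) | i < n]) :
  (\int[iid_prob (row_prob sigma p) n]_u
     (if (sqerr (tnth (pil u)) (tnth beta) <= delta * sigma ^+ 2)%R then 0
      else sqerr (tnth (pil u)) (tnth beta))%:E <=
  (sigma ^+ 2 * (expR (- (n%:R * (sd / 16))) * (kap^-1 * ((p%:R / k%:R) ^+ k *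
     expR (k%:R * (12 / (2 * kap * rho)))))))%:E)%E.
Proof.
have -> : pil = pilot_u by rewrite /pil (bool_irrelevance h r0).
pose F i (u : rows) : \bar R := (if @pickle_inv Z i is Some m then term m u else 0)%:E.
have F0 i u : (0 <= F i u)%E.
  by rewrite /F lee_fin; case: pickle_inv => [m|//]; exact: term_ge0.
have mF i : measurable_fun setT (F i).
  rewrite /F; apply/measurable_EFinP; case: pickle_inv => [m|].
    exact: measurable_term.
  exact: measurable_cst.
apply: (@le_trans _ _ (\int[iid_prob (row_prob sigma p) n]_u (\sum_(i <oo) F i u))%E).
  apply: ge0_le_integralT => u.
    rewrite lee_fin; case: ifP => // _; rewrite sqerrE; exact: dot_ge0.
  case: ifPn => [_|]; first by apply: nneseries_ge0.
  rewrite -ltNge => bu.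
  have [i [m [im E mw]]] := @pilotP R n p k eta r r0 [tuple observe (tnth beta) (tnth u i) | i < n].
  have Eerr : sqerr (tnth (pilot_u u)) (tnth beta) = err m by rewrite sqerrE /pilot_u E.
  (* The partial sum runs to i.+1 so as to include the selected index i. *)
  apply: (@le_trans _ _ (\sum_(0 <= j < i.+1) F j u)%E); last first.
    by apply: nneseries_lim_ge => j _ _; exact: F0.
  rewrite big_mkord (bigD1 ord_max)//= -[leLHS]adde0 leeD//; last by apply: sume_ge0.
  by rewrite /F im lee_fin Eerr term_ge_err// -Eerr.
rewrite integral_nneseries//.
apply: lime_le.
  apply: is_cvg_nneseries => i _ _; exact: integral_ge0.
near=> N; rewrite big_mkord.
apply: (@le_trans _ _ (\sum_(i < N) (if @pickle_inv Z i is Some m then bound m else 0))%:E).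
  rewrite -sumEFin; apply: lee_sum => i _; rewrite /F.
  by case: pickle_inv => [m|]; [exact: integral_term|rewrite integral0].
by rewrite lee_fin; exact: sum_bound_le.
Unshelve. all: by end_near. Qed.

End pilot_error.

(** * Upper bound *)

Section two_stage.
Context (R : realType) (n1 n2 p k : nat) (eta r t : R).
Local Notation T := (measurableTypeR R).
Local Notation coefs := (p.-tuple T).
Local Notation design n := (n.-tuple coefs).
Local Notation sample n := (n.-tuple T).
Local Notation row := (coefs * T)%type.
Hypothesis r0 : 0 < r.

Lemma measurable_refine : measurable_fun setT
  (fun w : coefs * n2.-tuple row => refine t w.1 w.2).
Proof.
apply: measurable_mktuple => j.
apply: (measurableT_comp (measurable_soft t)); apply: measurable_funD.
  exact: (measurableT_comp (measurable_tnth_fun j)).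
apply: measurable_funM => //; apply: measurable_sum => i.
have mrow : measurable_fun setT (fun w : coefs * n2.-tuple row => tnth w.2 i).
  exact: measurable_tnth_comp.
apply: measurable_funM.
  apply: (measurableT_comp (measurable_tnth_fun j)).
  exact: (measurableT_comp measurable_fst mrow).
apply: measurable_funB; first exact: (measurableT_comp measurable_snd mrow).
apply: (measurable_dot (x := fun l w => tnth (tnth w.2 i).1 l) (d := fun l w => tnth w.1 l)) => l.
  apply: (measurableT_comp (measurable_tnth_fun l)).
  exact: (measurableT_comp measurable_fst mrow).
exact: (measurableT_comp (measurable_tnth_fun l)).
Qed.

Definition two_stage (yX : sample (n1 + n2) * design (n1 + n2)) : coefs :=
  refine t
    (pilot k eta r0 [tuple (tnth yX.2 (lshift n2 i), tnth yX.1 (lshift n2 i)) | i < n1])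
    [tuple (tnth yX.2 (rshift n1 i), tnth yX.1 (rshift n1 i)) | i < n2].

Lemma measurable_two_stage : estimator two_stage.
Proof.
apply: (measurableT_comp measurable_refine (g := fun yX => (pilot k eta r0 _, _))).
apply: measurable_fun_pair.
  apply: (measurableT_comp (measurable_pilot k eta r0)); apply: measurable_mktuple => i.
  by apply: measurable_fun_pair; exact: measurable_tnth_comp.
apply: measurable_mktuple => i.
by apply: measurable_fun_pair; exact: measurable_tnth_comp.
Qed.

Lemma two_stage_response (beta : coefs) (u : n1.-tuple row) (v : n2.-tuple row) :
  let w := [tuple of u ++ v] in
  let X := [tuple (tnth w i).1 | i < n1 + n2] in
  let z := [tuple (tnth w i).2 | i < n1 + n2] in
  two_stage (response beta X z, X) =
  refine t (pilot k eta r0 [tuple observe (tnth beta) (tnth u i) | i < n1])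
    [tuple observe (tnth beta) (tnth v i) | i < n2].
Proof.
move=> w X z; rewrite /two_stage.
set D1 := [tuple _ | i < n1]; set D1' := [tuple _ | i < n1].
set D2 := [tuple _ | i < n2]; set D2' := [tuple _ | i < n2].
have -> : D1 = D1'.
  apply: eq_from_tnth => i; rewrite !tnth_mktuple /w !tnth_lshift//.
have -> // : D2 = D2'.
by apply: eq_from_tnth => i; rewrite !tnth_mktuple /w !tnth_rshift.
Qed.

(** Regrouping by rows and splitting the sample makes the pilot a constant in the inner integral. *)
Lemma risk_two_stage (sigma : R) (beta : coefs) :
  risk sigma two_stage beta =
  (\int[iid_prob (row_prob sigma p) n1]_u \int[iid_prob (row_prob sigma p) n2]_v
    (sqerr (tnth (refine t
        (pilot k eta r0 [tuple observe (tnth beta) (tnth u i) | i < n1])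
        [tuple observe (tnth beta) (tnth v i) | i < n2])) (tnth beta))%:E)%E.
Proof.
pose f (X : design (n1 + n2)) (z : sample (n1 + n2)) : \bar R :=
  (l2norm (tuple_sub (two_stage (response beta X z, X)) beta) ^+ 2)%:E.
have mf : measurable_fun setT (fun w => f w.1 w.2).
  apply/measurable_EFinP; apply: measurable_loss; last exact: measurable_cst.
  apply: (measurableT_comp measurable_two_stage); apply: measurable_fun_pair => //.
  by apply: measurable_response => //; exact: measurable_cst.
have f0 X z : (0 <= f X z)%E by rewrite lee_fin sqr_ge0.
rewrite riskE [LHS](integral_iid_pair _ _ mf f0).
rewrite integral_iid_cat; last 2 first.
- apply: (measurable_fun_uncurry mf); apply: measurable_mktuple => i.
    exact: (measurableT_comp measurable_fst (measurable_tnth i)).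
  exact: (measurableT_comp measurable_snd (measurable_tnth i)).
- by move=> w; exact: f0.
apply: eq_integral => u _; apply: eq_integral => v _.
by rewrite /f two_stage_response l2norm_sub_sqr.
Qed.

End two_stage.

Section upper_bound.
Context (R : realType) (n1 n2 p k : nat) (sigma d al a t : R).
Local Notation T := (measurableTypeR R).
Local Notation coefs := (p.-tuple T).
Local Notation row := (coefs * T)%type.
Hypothesis sigma0 : 0 < sigma.
Hypothesis d01 : 0 < d <= 1 / 10.
Hypothesis k0 : (0 < k)%N.
Hypothesis kp : (k <= p)%N.
Hypothesis n1k : (16 * (2 * k).+1 <= n1)%N.
Hypothesis n20 : (0 < n2)%N.
Hypothesis t0 : 0 <= t.
Hypothesis al0 : 0 < al.
Hypothesis a0 : 0 < a.
Hypothesis ad : a ^+ 2 * sigma ^+ 2 <= d / 8.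

Let q := d / 144.
Let rho := d / 32.
Let kap := q / (1 + q).

Definition pilot_tail : R := expR (- (n1%:R * (ln (1 + kap * d) / 16))) *
  (kap^-1 * ((p%:R / k%:R) ^+ k * expR (k%:R * (12 / (2 * kap * rho))))).

Definition main_term : R :=
  k%:R * ((1 + al) * t ^+ 2 + (1 + al^-1) * (2 * 32 ^+ 2 * sigma ^+ 2 / n2%:R)) +
  p%:R * (8 / (n2%:R * a) ^+ 2 * expR (- (n2%:R * a * t) +
       n2%:R * (a ^+ 2 * sigma ^+ 2 * ((1 + 19 * d) / 2)))).

Definition tail_factor : R :=
  p%:R * (2 * t ^+ 2 / (d * sigma ^+ 2) + 2 * 32 ^+ 2 * (d^-1 + 1) / n2%:R).

Lemma minimax_risk_le_two_stage :
  (minimax_risk (n1 + n2) p sigma k <=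
   (main_term + tail_factor * (sigma ^+ 2 * pilot_tail))%:E)%E.
Proof.
have /andP[d0 d10] := d01.
have d1 : 0 < d <= 1 by rewrite d0/=; lra.
have s2 : 0 < sigma ^+ 2 by rewrite exprn_gt0.
have nR : 0 < n2%:R :> R by rewrite ltr0n.
have r0 : 0 < n1%:R * (rho * sigma ^+ 2).
  apply: mulr_gt0; first by rewrite ltr0n; lia.
  by apply: mulr_gt0 => //; apply: divr_gt0.
pose eta := sigma * Num.sqrt (rho / k%:R).
pose est := @two_stage R n1 n2 p k eta _ t r0.
apply: ge_ereal_inf; exists (ereal_sup [set risk sigma est beta | beta in @sparse_vectors R p k]).
  by exists est => //; exact: measurable_two_stage.
apply/ereal_supP => _ [beta hb <-].
rewrite risk_two_stage.
pose pil (u : n1.-tuple row) := pilot k eta r0 [tuple observe (tnth beta) (tnth u i) | i < n1].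
pose S u := sqerr (tnth (pil u)) (tnth beta).
pose bad u := if S u <= d * sigma ^+ 2 then 0 else S u.
have S0 u : 0 <= S u by rewrite /S sqerrE dot_ge0.
have bad0 u : 0 <= bad u by rewrite /bad; case: ifP.
have mS : measurable_fun setT S.
  apply: measurable_sum => j; apply: measurable_funX; apply: measurable_funB => //.
  apply: (measurableT_comp (measurable_tnth_fun j)).
  apply: (measurableT_comp (measurable_pilot k eta r0)); apply: measurable_mktuple => i.
  have mrow : measurable_fun setT (fun u : n1.-tuple row => tnth u i) by exact: measurable_tnth.
  apply: measurable_fun_pair; first exact: (measurableT_comp measurable_fst mrow).
  exact: (measurableT_comp (measurable_dot_row (tnth beta)) mrow).
have mbad : measurable_fun setT bad.
  apply: measurable_fun_ifT => //.
  by apply: measurable_fun_ler.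
have tf0 : 0 <= tail_factor.
  apply: mulr_ge0 => //; apply: addr_ge0.
    by rewrite divr_ge0 ?mulr_ge0 ?sqr_ge0 ?(ltW d0)// ltW.
  apply: divr_ge0; last exact: ltW.
  apply: mulr_ge0; first lra.
  by rewrite addr_ge0// invr_ge0 ltW.
have mt0 : 0 <= main_term.
  have e1 : 0 <= al^-1 by rewrite invr_ge0 ltW.
  apply: addr_ge0; apply: mulr_ge0 => //.
    apply: addr_ge0; apply: mulr_ge0.
    - by rewrite addr_ge0// ltW.
    - exact: sqr_ge0.
    - by rewrite addr_ge0.
    - by apply: divr_ge0; [apply: mulr_ge0; [lra|exact: ltW]|exact: ltW].
  by apply: mulr_ge0; [rewrite divr_ge0 ?sqr_ge0|exact: expR_ge0].
apply: (@le_trans _ _ (\int[iid_prob (row_prob sigma p) n1]_u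
    (main_term + tail_factor * bad u)%:E)%E).
  apply: ge0_le_integralT => u.
    by apply: integral_ge0 => v _; rewrite lee_fin sqerrE dot_ge0.
  rewrite /bad; case: ifPn => [Su|].
    by rewrite mulr0 addr0; exact: integral_refine_good.
  rewrite -ltNge => Su.
  apply: (le_trans (integral_refine_le _ _ _ _ _)) => //.
  rewrite lee_fin -/(pil u) -/(S u) -[leLHS]add0r; apply: lerD => //.
  rewrite /tail_factor -[leRHS]mulrA ler_wpM2l//.
  (* On the failure event constants can be inflated by this ratio, so the crude risk bound becomes a
     multiple of [S u] alone. *)
  have dS : 1 <= S u / (d * sigma ^+ 2) by rewrite ler_pdivlMr ?mulr_gt0// mul1r ltW.
  have -> : (2 * t ^+ 2 / (d * sigma ^+ 2) + 2 * 32 ^+ 2 * (d^-1 + 1) / n2%:R) * S u =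
      2 * t ^+ 2 * (S u / (d * sigma ^+ 2)) +
      2 * 32 ^+ 2 * (sigma ^+ 2 * (S u / (d * sigma ^+ 2)) + S u) / n2%:R.
    by field; rewrite !gt_eqF.
  have t2 : 0 <= 2 * t ^+ 2 by rewrite mulr_ge0 ?sqr_ge0.
  apply: lerD; first exact: ler_peMr.
  rewrite ler_pM2r ?invr_gt0// ler_wpM2l ?mulr_ge0 ?exprn_ge0//.
  by rewrite lerD2r ler_peMr// ltW.
rewrite ge0_integralDT//; last 2 first.
- exact: measurable_funM.
- by move=> u; rewrite mulr_ge0.
rewrite integral_prob_cst (EFinD main_term) leeD2l// ge0_integralZlT//.
rewrite (EFinM tail_factor) lee_wpmul2l ?lee_fin//.
exact: (@integral_pilot_bad R n1 p k sigma d sigma0 d1 k0 kp n1k beta hb r0).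
Qed.

End upper_bound.

Lemma expRN_le_inv (R : realType) (x : R) : 0 < x -> expR (- x) <= x^-1.
Proof.
move=> x0; rewrite expRN lef_pV2 ?posrE ?expR_gt0//.
by apply: le_trans (expR_ge1Dx x); rewrite lerDr.
Qed.

Section tuned_upper_bound.
Context (R : realType) (n1 n2 p k : nat) (sigma d al : R).
Hypothesis sigma0 : 0 < sigma.
Hypothesis d01 : 0 < d <= 1 / 10.
Hypothesis k0 : (0 < k)%N.
Hypothesis kp : (k <= p)%N.
Hypothesis al0 : 0 < al.

Let q := d / 144.
Let rho := d / 32.
Let kap := q / (1 + q).
Let sd := ln (1 + kap * d).
Let C := 12 / (2 * kap * rho).
Let L := ln (p%:R / k%:R : R).
Let w := 1 + 19 * d.
Let d0 : 0 < d. Proof. by case/andP: d01. Qed.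
Let kap0 : 0 < kap.
Proof. by rewrite /kap divr_gt0// ?addr_gt0// /q divr_gt0. Qed.
Let sd0 : 0 < sd. Proof. by rewrite /sd ln_gt0// ltrDl mulr_gt0. Qed.
Let rho0 : 0 < rho. Proof. by rewrite /rho divr_gt0. Qed.
Let C0 : 0 < C.
Proof. by apply: divr_gt0 => //; apply: mulr_gt0 => //; exact: mulr_gt0. Qed.
Let kR : 0 < k%:R :> R. Proof. by rewrite ltr0n. Qed.
Let pR : 0 < p%:R :> R. Proof. by rewrite ltr0n; exact: leq_trans k0 kp. Qed.
Let expL : expR L = p%:R / k%:R.
Proof. by rewrite /L lnK// posrE divr_gt0. Qed.

(** All entropy terms are at most (2 + C) k L, half of the available n1 sd / 16; of the remaining
    exponential only decay 1 / n1 is kept. *)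
Lemma pilot_tail_le : (0 < n1)%N -> 1 <= L ->
  (2 + C) * (k%:R * L) <= n1%:R * sd / 32 ->
  p%:R / k%:R * pilot_tail n1 p k d <= kap^-1 * (32 / (n1%:R * sd)).
Proof.
move=> n10 L1 H.
have nR : 0 < n1%:R :> R by rewrite ltr0n.
have -> : p%:R / k%:R * pilot_tail n1 p k d =
    kap^-1 * expR (L + k%:R * L + k%:R * C - n1%:R * (sd / 16)).
  rewrite /pilot_tail -expL -/q -/kap -/rho -/C -/sd -expRM_natl !expRD mulr_natl; ring.
rewrite ler_wpM2l ?invr_ge0 ?(ltW kap0)//.
have -> : 32 / (n1%:R * sd) = (n1%:R * sd / 32)^-1 by rewrite invf_div.
apply: le_trans (expRN_le_inv _); last by rewrite divr_gt0 ?mulr_gt0.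
rewrite ler_expR.
have k1 : 1 <= k%:R :> R by rewrite ler1n.
have : L <= k%:R * L by rewrite ler_peMl// (le_trans ler01).
have : k%:R * C <= C * (k%:R * L).
  by rewrite mulrC ler_pM2l// ler_peMr// ltW.
lra.
Qed.

(** The bound is written relative to the rate: a leading constant close to 2 for small [al] and [d],
    a term of order 1 / L, and the contribution of a failing pilot. *)
Lemma minimax_risk_le_tuned : (16 * (2 * k).+1 <= n1)%N -> (0 < n2)%N ->
  1 <= L -> L / n2%:R <= d / 16 ->
  (minimax_risk (n1 + n2) p sigma k <=
   (k%:R * sigma ^+ 2 * L / n2%:R *
     ((1 + al) * (2 * w) + ((1 + al^-1) * (2 * 32 ^+ 2) + 4 * w) / L +
      p%:R / k%:R * pilot_tail n1 p k d *
        (4 * w / d + 2 * 32 ^+ 2 * (d^-1 + 1))))%:E)%E.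
Proof.
move=> n1k n20 L1 Ln.
have nR : 0 < n2%:R :> R by rewrite ltr0n.
have L0 : 0 < L by exact: lt_le_trans L1.
have w0 : 1 <= w by rewrite /w lerDl mulr_ge0// ltW.
have w00 : 0 < w by exact: lt_le_trans w0.
have s2 : 0 < sigma ^+ 2 by rewrite exprn_gt0.
(* The exponent of the contribution of the null coordinates is
   [- n2 a t + n2 a^2 sigma^2 w / 2]: this [a] minimizes it, and [t] makes the
   minimum [- L], i.e. each null coordinate is weighted by [k / p]. *)
pose t := Num.sqrt (2 * w * sigma ^+ 2 * L / n2%:R).
have t2 : t ^+ 2 = 2 * w * sigma ^+ 2 * L / n2%:R.
  by rewrite sqr_sqrtr// ltW// divr_gt0// !mulr_gt0.
have t0 : 0 < t by rewrite sqrtr_gt0 divr_gt0// !mulr_gt0.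
pose a := t / (sigma ^+ 2 * w).
have a0 : 0 < a by rewrite divr_gt0// mulr_gt0.
have a2 : a ^+ 2 * sigma ^+ 2 = 2 * L / (n2%:R * w).
  by rewrite /a expr_div_n t2; field; rewrite !gt_eqF.
have ad : a ^+ 2 * sigma ^+ 2 <= d / 8.
  rewrite a2 invfM mulrA ler_pdivrMr//.
  apply: (@le_trans _ _ (d / 8)); first by rewrite -mulrA; lra.
  by rewrite ler_peMr// divr_ge0// ltW.
apply: le_trans (minimax_risk_le_two_stage sigma0 d01 k0 kp n1k n20 (ltW t0) al0 a0 ad) _.
rewrite lee_fin /main_term /tail_factor.
have -> : - (n2%:R * a * t) + n2%:R * (a ^+ 2 * sigma ^+ 2 * ((1 + 19 * d) / 2)) = - L.
  rewrite a2 -/w /a (_ : n2%:R * _ * t = n2%:R * t ^+ 2 / (sigma ^+ 2 * w)); last by ring.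
  by rewrite t2; field; rewrite !gt_eqF.
have -> : (n2%:R * a) ^+ 2 = 2 * n2%:R * L / (w * sigma ^+ 2).
  by rewrite exprMn /a expr_div_n t2; field; rewrite !gt_eqF.
rewrite expRN expL t2.
set pt := pilot_tail _ _ _ _.
set X := k%:R * sigma ^+ 2 * L / n2%:R.
have X0 : 0 <= X by rewrite ltW// divr_gt0// !mulr_gt0.
have -> : k%:R * ((1 + al) * (2 * w * sigma ^+ 2 * L / n2%:R) +
      (1 + al^-1) * (2 * 32 ^+ 2 * sigma ^+ 2 / n2%:R)) +
    p%:R * (8 / (2 * n2%:R * L / (w * sigma ^+ 2)) * (p%:R / k%:R)^-1) +
    p%:R * (2 * (2 * w * sigma ^+ 2 * L / n2%:R) / (d * sigma ^+ 2) +
       2 * 32 ^+ 2 * (d^-1 + 1) / n2%:R) * (sigma ^+ 2 * pt) =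
    X * ((1 + al) * (2 * w) + ((1 + al^-1) * (2 * 32 ^+ 2) + 4 * w / L) / L +
      p%:R / k%:R * pt * (4 * w / d + 2 * 32 ^+ 2 * (d^-1 + 1) / L)).
  by rewrite /X; field; rewrite !gt_eqF.
rewrite ler_wpM2l//.
have LV : L^-1 <= 1 by rewrite invf_le1.
have pt0 : 0 <= pt.
  rewrite /pt /pilot_tail; apply: mulr_ge0; first exact: expR_ge0.
  apply: mulr_ge0; first by rewrite invr_ge0; exact: (ltW kap0).
  by apply: mulr_ge0; [rewrite exprn_ge0// divr_ge0|exact: expR_ge0].
apply: lerD; first rewrite lerD2l.
  by rewrite ler_pM2r ?invr_gt0// lerD2l ler_piMr// mulr_ge0// ltW.
apply: ler_wpM2l; first by apply: mulr_ge0 => //; rewrite divr_ge0.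
rewrite lerD2l ler_piMr//; apply: mulr_ge0; first lra.
by rewrite addr_ge0// invr_ge0 ltW.
Qed.

End tuned_upper_bound.

(** * Asymptotic form *)

Lemma exists_small4 (R : realType) (a b c d : R) : 0 < a -> 0 < b -> 0 < c -> 0 < d ->
  exists2 x, 0 < x & [/\ a * x <= 1, b * x <= 1, c * x <= 1 & d * x <= 1].
Proof.
move=> a0 b0 c0 d0; have s0 : 0 < a + b + c + d by rewrite !addr_gt0.
exists (a + b + c + d)^-1; first by rewrite invr_gt0.
by split; rewrite ler_pdivrMr// mul1r; lra.
Qed.

Lemma minimax_risk_le_asymp (R : realType) (sigma e : R) : 0 < sigma -> 0 < e <= 1 ->
  exists L0 c0 : R, 0 < c0 /\ forall n p k : nat, (0 < n)%N -> (0 < k)%N -> (k <= p)%N ->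
    L0 <= ln (p%:R / k%:R) -> k%:R * ln (p%:R / k%:R) / n%:R <= c0 ->
    (minimax_risk n p sigma k <=
     ((2 + e) * sigma ^+ 2 * k%:R * ln (p%:R / k%:R) / n%:R)%:E)%E.
Proof.
move=> sigma0 /andP[e0 e1].
(* A share of about 1 / Q, at most e / 20, of the sample goes to the pilot; [d] and [al] keep (1 +
   al) 2 w below 2 + 3 e / 10. *)
pose d := e / 200; pose al := e / 20; pose Q := (Num.bound (20 / e)).+1.
pose q := d / 144; pose rho := d / 32; pose kap := q / (1 + q).
pose sd := ln (1 + kap * d); pose C := 12 / (2 * kap * rho); pose w := 1 + 19 * d.
pose B1 := (1 + al^-1) * (2 * 32 ^+ 2) + 4 * w.
pose B2 := 4 * w / d + 2 * 32 ^+ 2 * (d^-1 + 1).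
have d0 : 0 < d by rewrite divr_gt0.
have d01 : 0 < d <= 1 / 10 by rewrite d0/= /d; lra.
have al0 : 0 < al by rewrite divr_gt0.
have kap0 : 0 < kap by rewrite /kap divr_gt0// ?addr_gt0// /q divr_gt0.
have sd0 : 0 < sd by rewrite /sd ln_gt0// ltrDl mulr_gt0.
have rho0 : 0 < rho by rewrite divr_gt0.
have C0 : 0 < C by apply: divr_gt0 => //; apply: mulr_gt0 => //; exact: mulr_gt0.
have w0 : 0 < w by rewrite /w addr_gt0// mulr_gt0.
have B20 : 0 < B2.
  by rewrite /B2 addr_gt0 ?divr_gt0 ?mulr_gt0// ?addr_gt0// invr_gt0.
have D0 : 0 < kap * sd by exact: mulr_gt0.
have eD0 : 0 < e * (kap * sd) by exact: mulr_gt0.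
have QR : 0 < Q%:R :> R by rewrite ltr0n.
have Qe : 20 / e <= Q%:R.
  apply: le_trans (ltW (archi_boundP _)) _; first by rewrite divr_ge0// ltW.
  by rewrite ler_nat.
(* In order, the four conditions make n1 at least 49 k, make L / n2 small, let the pilot exponent
   beat the entropy, and push the pilot failure term below e / 8. *)
have [||||c0 c00 [c1 c2 c3 c4]] := @exists_small4 R (49 * Q%:R) (32 / d)
    (64 * Q%:R * (2 + C) / sd) (8 * (64 * (Q%:R * B2)) / (e * (kap * sd))).
- exact: mulr_gt0.
- exact: divr_gt0.
- by apply: divr_gt0 => //; apply: mulr_gt0; [exact: mulr_gt0|rewrite addr_gt0].
- apply: divr_gt0 => //; apply: mulr_gt0 => //; apply: mulr_gt0 => //; exact: mulr_gt0.
exists (Num.max 1 (8 * B1 / e)), c0; split=> // n p k n0 k0 kp.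
set L := ln _; rewrite ge_max => /andP[L1 LB] kL.
have nR : 0 < n%:R :> R by rewrite ltr0n.
have kR : 0 < k%:R :> R by rewrite ltr0n.
have k1 : 1 <= k%:R :> R by rewrite ler1n.
have L0 : 0 < L by exact: lt_le_trans L1.
have kLn : k%:R * L <= c0 * n%:R by rewrite -ler_pdivrMr.
have kkL : k%:R <= k%:R * L by rewrite ler_peMr// ltW.
have LkL : L <= k%:R * L by rewrite ler_peMl// ltW.
pose n1 := (n %/ Q)%N; pose n2 := (n - n1)%N.
have n1n : (n1 <= n)%N by exact: leq_div.
have nk : (49 * k <= n1)%N.
  rewrite leq_divRL// -(ler_nat R) !natrM.
  apply: (@le_trans _ _ (49 * Q%:R * (c0 * n%:R))).
    by rewrite mulrAC ler_pM2l ?mulr_gt0//; exact: le_trans kkL kLn.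
  by rewrite mulrA ler_piMl// ltW.
have n10 : (0 < n1)%N by apply: leq_trans nk; rewrite muln_gt0.
have n1k : (16 * (2 * k).+1 <= n1)%N by apply: leq_trans nk; clear -k0; lia.
have n1R : 0 < n1%:R :> R by rewrite ltr0n.
have nn1 : n%:R <= 2 * Q%:R * n1%:R :> R.
  rewrite -natrM -natrM ler_nat {1}(divn_eq n Q) -/n1.
  have : (n %% Q < Q)%N by rewrite ltn_pmod.
  have : (Q <= n1 * Q)%N by rewrite leq_pmull.
  clear; nia.
have n1e : n1%:R <= e / 20 * n%:R.
  have : n1%:R * Q%:R <= n%:R :> R by rewrite -natrM ler_nat leq_divM.
  have : n1%:R * (20 / e) <= n1%:R * Q%:R by rewrite ler_pM2l.
  move=> h1 h2; have := le_trans h1 h2.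
  rewrite mulrA ler_pdivrMr// => h3; lra.
have n2R : n2%:R = n%:R - n1%:R :> R by rewrite natrB.
have n2e : (1 - e / 20) * n%:R <= n2%:R by rewrite n2R; lra.
have n2h : n%:R / 2 <= n2%:R :> R.
  apply: le_trans n2e; rewrite mulrC ler_pM2r//; lra.
have n2R0 : 0 < n2%:R :> R by apply: lt_le_trans n2h; rewrite divr_gt0.
have n20 : (0 < n2)%N by rewrite -(ltr0n R).
have Ln2 : L / n2%:R <= d / 16.
  rewrite ler_pdivrMr//.
  have h : 32 * c0 <= d by move: c2; rewrite mulrAC ler_pdivrMr// mul1r.
  have : 32 * c0 * n2%:R <= d * n2%:R by rewrite ler_pM2r.
  have : c0 * (n%:R / 2) <= c0 * n2%:R by rewrite ler_pM2l.
  lra.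
have hY : (2 + C) * (k%:R * L) <= n1%:R * sd / 32.
  apply: (@le_trans _ _ ((2 + C) * (c0 * (2 * Q%:R * n1%:R)))).
    rewrite ler_pM2l ?addr_gt0//; apply: le_trans kLn _; by rewrite ler_pM2l.
  have h : 64 * Q%:R * (2 + C) * c0 <= sd by move: c3; rewrite mulrAC ler_pdivrMr// mul1r.
  have := ler_wpM2r (ltW n1R) h; lra.
have := @minimax_risk_le_tuned R n1 n2 p k sigma d al sigma0 d01 k0 kp al0 n1k n20 L1 Ln2.
rewrite /n2 subnKC// -/n2 => H; apply: le_trans H _.
rewrite lee_fin -/L -/w -/B1 -/B2.
have tail : p%:R / k%:R * pilot_tail n1 p k d * B2 <= e / 8.
  apply: (@le_trans _ _ (kap^-1 * (32 / (n1%:R * sd)) * B2)).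
    by rewrite ler_pM2r//; exact: pilot_tail_le.
  have -> : kap^-1 * (32 / (n1%:R * sd)) * B2 = 32 * B2 / (kap * sd * n1%:R).
    by field; rewrite !gt_eqF// addr_gt0// divr_gt0.
  have Dn : 0 < kap * sd * n1%:R by exact: mulr_gt0.
  rewrite (ler_pdivrMr _ _ Dn).
  have h : 8 * (64 * (Q%:R * B2)) * c0 <= e * (kap * sd).
    by move: c4; rewrite mulrAC (ler_pdivrMr _ _ eD0) mul1r.
  (* Largeness of n1 is deduced from 1 <= k L <= c0 n. *)
  have h1 : 1 <= c0 * (2 * Q%:R * n1%:R).
    apply: le_trans (le_trans kLn _); last by rewrite ler_pM2l.
    exact: le_trans k1 kkL.
  have := ler_wpM2r (ltW n1R) h.
  have := ler_wpM2l (ltW B20) h1.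
  lra.
have HB : B1 / L <= e / 8.
  rewrite ler_pdivrMr//; move: LB; rewrite ler_pdivrMr//; lra.
have hw : (1 + al) * (2 * w) <= 2 + 3 / 10 * e.
  rewrite /al /w /d; nra.
(* The errors 3 e / 10, e / 8 and e / 8 add up to 55 e / 100; the remaining slack pays for replacing
   n2 by n. *)
apply: (@le_trans _ _ (k%:R * sigma ^+ 2 * L / n2%:R * (2 + 55 / 100 * e))).
  apply: ler_wpM2l; last lra.
  by rewrite ltW// divr_gt0// !mulr_gt0// exprn_gt0.
have -> : (2 + e) * sigma ^+ 2 * k%:R * L / n%:R = k%:R * sigma ^+ 2 * L * ((2 + e) / n%:R).
  by field; rewrite gt_eqF.
rewrite -[leLHS]mulrA ler_wpM2l//.
  by rewrite ltW// !mulr_gt0// exprn_gt0.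
rewrite ler_pdivrMl// mulrA ler_pdivlMr// [leRHS]mulrC.
apply: (@le_trans _ _ ((2 + e) * ((1 - e / 20) * n%:R))); last by rewrite ler_pM2l// addr_gt0.
rewrite mulrA ler_pM2r//; nra.
Qed.

Lemma minimax_risk_ge_asymp (R : realType) (sigma e : R) : 0 < sigma -> 0 < e <= 1 ->
  exists L0 c0 : R, 0 < c0 /\ forall n p k : nat, (0 < n)%N -> (0 < k)%N ->
    L0 <= ln (p%:R / k%:R) -> k%:R * ln (p%:R / k%:R) / n%:R <= c0 ->
    (((2 - e) * sigma ^+ 2 * k%:R * ln (p%:R / k%:R) / n%:R)%:E <=
     minimax_risk n p sigma k)%E.
Proof.
move=> sigma0 /andP[e0 e1]; pose d := e / 4.
have d0 : 0 < d by rewrite divr_gt0.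
have d2 : 0 < d <= 1 / 2 by rewrite d0/= /d; lra.
(* With e^(- x) <= 1 / x these thresholds give the two exponential smallness conditions of
   [minimax_risk_ge]; L >= 1 gives p / k >= 2. *)
exists (Num.max 1 (Num.max (16 / d ^+ 2) (32 / d ^+ 3))), (d / 8).
split=> [|n p k n0 k0]; first exact: divr_gt0.
set L := ln _; rewrite !ge_max => /and3P[L1 La Lb] kL.
have L0 : 0 < L by exact: lt_le_trans L1.
have k1 : 1 <= k%:R :> R by rewrite ler1n.
have pk : 0 < p%:R / k%:R :> R.
  (* [ln] is 0 at nonpositive arguments, so L > 0 forces p / k > 0. *)
  by rewrite ltNge; apply/negP => h; move: L0; rewrite /L ln0// ltxx.
have -> : 2 - e = 2 - 4 * d by rewrite /d; field.
apply: minimax_risk_ge => //.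
- rewrite -[leRHS]lnK ?posrE// -/L; apply: le_trans (expR_ge1Dx _); lra.
- rewrite -/L; apply: (@le_trans _ _ (2 * (d / 4 * L)^-1)).
    by rewrite ler_pM2l// expRN_le_inv// mulr_gt0// divr_gt0.
  move: La; rewrite ler_pdivrMr ?exprn_gt0// => La.
  rewrite ler_pdivrMr ?mulr_gt0 ?divr_gt0//; lra.
- rewrite -/L; apply: (@le_trans _ _ (d ^+ 2 / 16 * L)^-1).
    by rewrite expRN_le_inv// mulr_gt0// divr_gt0// exprn_gt0.
  move: Lb; rewrite ler_pdivrMr ?exprn_gt0// => Lb.
  rewrite -[leLHS]mul1r ler_pdivrMr ?mulr_gt0 ?divr_gt0 ?exprn_gt0//; lra.
- rewrite -/L; apply: le_trans kL; rewrite ler_pM2r ?invr_gt0 ?ltr0n//.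
  by rewrite ler_peMl// ltW.
Qed.

Lemma near_ln_ratio_ge (R : realType) (p k : nat -> nat) (A : R) :
  (forall m, (1 <= k m <= p m)%N) ->
  (k m)%:R / (p m)%:R @[m --> \oo] --> (0 : R) ->
  \forall m \near \oo, A <= ln ((p m)%:R / (k m)%:R).
Proof.
move=> kp /cvgrPdist_lt/(_ (expR (- A)) (expR_gt0 _)) H.
near=> m; have /andP[k0 kpm] := kp m.
have kR : 0 < (k m)%:R :> R by rewrite ltr0n.
have pR : 0 < (p m)%:R :> R by rewrite ltr0n; exact: leq_trans k0 kpm.
have : `|0 - (k m)%:R / (p m)%:R| < expR (- A) :> R by near: m.
rewrite sub0r normrN ger0_norm; last by rewrite divr_ge0// ltW.
rewrite expRN -[ltLHS]invf_div ltf_pV2 ?posrE ?expR_gt0 ?divr_gt0// => h.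
rewrite -[leLHS]expRK ler_ln ?posrE ?expR_gt0 ?divr_gt0//; exact: ltW.
Unshelve. all: by end_near. Qed.

Theorem theorem5 (R : realType) (sigma : R) (n p k : nat -> nat) :
  0 < sigma ->
  (forall m, (1 <= n m)%N) ->
  (forall m, (1 <= k m <= p m)%N) ->
  (k m)%:R / (p m)%:R @[m --> \oo] --> (0 : R) ->
  (k m)%:R * ln ((p m)%:R / (k m)%:R) / (n m)%:R @[m --> \oo] --> (0 : R) ->
  exists2 eps : nat -> R,
    eps m @[m --> \oo] --> (0 : R) &
    \forall m \near \oo,
      minimax_risk (n m) (p m) sigma (k m) =
      ((2 + eps m) * sigma ^+ 2 * (k m)%:R * ln ((p m)%:R / (k m)%:R)
         / (n m)%:R)%:E.
Proof.
move=> sigma0 n1 kp cvg_kp cvg_kL.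
pose L m : R := ln ((p m)%:R / (k m)%:R).
pose rate m : R := sigma ^+ 2 * (k m)%:R * L m / (n m)%:R.
have rateE x m : x * sigma ^+ 2 * (k m)%:R * ln ((p m)%:R / (k m)%:R) / (n m)%:R = x * rate m.
  by rewrite /rate !mulrA.
have k0 m : (0 < k m)%N by case/andP: (kp m).
have near_bounds (e : R) : 0 < e <= 1 -> \forall m \near \oo,
    0 < rate m /\ (((2 - e) * rate m)%:E <= minimax_risk (n m) (p m) sigma (k m) <=
    ((2 + e) * rate m)%:E)%E.
  move=> e01.
  have [Au [cu [cu0 Hu]]] := minimax_risk_le_asymp sigma0 e01.
  have [Al [cl [cl0 Hl]]] := minimax_risk_ge_asymp sigma0 e01.
  have /cvgrPdist_le/(_ _ cu0) nu := cvg_kL.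
  have /cvgrPdist_le/(_ _ cl0) nl := cvg_kL.
  near=> m; have /andP[_ kpm] := kp m.
  have LA : 1 <= L m by near: m; exact: near_ln_ratio_ge.
  have normE (c : R) : `|0 - (k m)%:R * ln ((p m)%:R / (k m)%:R) / (n m)%:R| <= c ->
      (k m)%:R * ln ((p m)%:R / (k m)%:R) / (n m)%:R <= c.
    by rewrite sub0r normrN; apply: le_trans; exact: ler_norm.
  split.
    rewrite /rate divr_gt0 ?ltr0n// !mulr_gt0 ?exprn_gt0 ?ltr0n//; exact: lt_le_trans LA.
  rewrite -!rateE; apply/andP; split.
    apply: Hl => //; first by near: m; exact: near_ln_ratio_ge.
    by apply: normE; near: m.
  apply: Hu => //; first by near: m; exact: near_ln_ratio_ge.
  by apply: normE; near: m.
pose risk m := fine (minimax_risk (n m) (p m) sigma (k m)).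
(* The o(1) term is solved for from the equation. Bounds with e = 1 make the risk finite and the
   rate positive eventually, which gives the equality; smaller e give the limit. *)
exists (fun m => risk m / rate m - 2).
  apply/cvgrPdist_le => e e0.
  pose e' := Num.min e 1.
  have e'01 : 0 < e' <= 1 by rewrite lt_min e0 ltr01 ge_min lexx orbT.
  near=> m.
  have [r0 /andP[lo up]] : 0 < rate m /\
      (((2 - e') * rate m)%:E <= minimax_risk (n m) (p m) sigma (k m) <=
      ((2 + e') * rate m)%:E)%E by near: m; exact: near_bounds.
  have fin : minimax_risk (n m) (p m) sigma (k m) \is a fin_num.
    by apply/fin_real; rewrite (lt_le_trans (ltNyr _) lo) (le_lt_trans up (ltry _)).
  move: lo up; rewrite -(fineK fin) -/(risk m) !lee_fin => lo up.
  rewrite sub0r normrN.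
  apply: (@le_trans _ _ e'); last by rewrite ge_min lexx.
  rewrite ler_norml; apply/andP; split.
    by rewrite lerBrDr addrC ler_pdivlMr.
  by rewrite lerBlDr addrC ler_pdivrMr.
have := near_bounds 1; rewrite ltr01 lexx => /(_ isT).
apply: filterS => m [r0 /andP[lo up]]; rewrite rateE.
have fin : minimax_risk (n m) (p m) sigma (k m) \is a fin_num.
  by apply/fin_real; rewrite (lt_le_trans (ltNyr _) lo) (le_lt_trans up (ltry _)).
by rewrite subrKC divfK ?gt_eqF// fineK.
Unshelve. all: by end_near. Qed.
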